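(* Let $\tau>\frac{2}{\pi-2}$. Then the equilibrium measure $\mu_\tau$ is an absolutely continuous measure on $$\operatorname{supp}(\mu_\tau)=[-1,-\beta_\tau]\cup[\beta_\tau,1],$$ where $\beta_\tau\in(0,1)$ is the only solution of the equation $$E(\beta_\tau)=\frac1\tau+1\in(1,\pi/2).$$ Its density (on the support) is $$\mu_\tau'(x)=\frac{\tau}{\pi}|x|\sqrt{\frac{x^2-\beta_\tau^2}{1-x^2}}\;I\left(\sqrt{1-x^2},\beta_\tau\right).$$ Furthermore, for $z\in\mathbb{C}\setminus\operatorname{supp}(\mu_\tau)$, $$C^{\mu_\tau}(z)=\frac{\tau}{2}\left(\frac{z^2-\beta_\tau^2}{z^2-1}\right)^{1/2}\int_{-\beta_\tau}^{\beta_\tau}\sqrt{\frac{1-x^2}{\beta_\tau^2-x^2}}\,\frac{dx}{z-x}-\frac{\tau}{2}\log\left(\frac{z+1}{z-1}\right).$$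
   Context: For a (signed) Borel measure $\sigma$ on $[-1,1]$, its logarithmic potential is $V^\sigma(z)=\int\log\frac{1}{|x-z|}\,d\sigma(x)$, and its Cauchy transform is $C^\sigma(z)=\int\frac{1}{z-x}\,d\sigma(x)$ for $z\in\mathbb{C}\setminus\operatorname{supp}(\sigma)$. Let $\lambda$ be the absolutely continuous probability measure $\frac12 dx$ on $[-1,1]$. For $\tau\in\mathbb{R}$, the equilibrium measure $\mu_\tau$ is the unique probability measure on $[-1,1]$ for which there is a constant $\omega_\tau\in\mathbb{R}$ (the equilibrium constant) such that $$V^{\mu_\tau}(x)+\tau V^\lambda(x)=\omega_\tau \ \text{ for } x\in\operatorname{supp}(\mu_\tau),\qquad V^{\mu_\tau}(x)+\tau V^\lambda(x)\ge\omega_\tau\ \text{ for } x\in[-1,1].$$ Equivalently, $\mu_\tau$ minimizes $\int V^\sigma\,d\sigma+2\tau\int V^\lambda\,d\sigma$ among probability measures $\sigma$ on $[-1,1]$. For $0\le k\le1$ and $a>0$, $$E(k)=\int_0^{\pi/2}\sqrt{1-k^2\sin^2\theta}\,d\theta=\int_0^1\sqrt{\frac{1-k^2x^2}{1-x^2}}\,dx,\qquad I(a,k)=\int_0^{\pi/2}\frac{d\theta}{a+\sqrt{1-k^2\sin^2\theta}}=\int_0^1\frac{1}{a+\sqrt{1-k^2x^2}}\frac{dx}{\sqrt{1-x^2}}.$$ Conventions: $\sqrt{\cdot}$ is the nonnegative square root of nonnegative reals; $(\cdot)^{1/2}$ and $\log$ are the principal branches in $\mathbb{C}\setminus(-\i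nfty,0]$.
   Formalization: For z in the gap (-β_τ, β_τ) the right-hand side of the Cauchy transform formula is undefined (divergent integral, log on its cut); there the formula is stated as a limit of its values at points off [-1,1], and as an equality for z off [-1,1]. *)

(* Defs.v *)
From HB Require Import structures.
From mathcomp Require Import all_boot all_order all_algebra.
From mathcomp Require Import complex.
From mathcomp Require Import all_classical all_reals all_analysis.

Set Implicit Arguments.
Unset Strict Implicit.
Unset Printing Implicit Defensive.

Import Order.TTheory GRing.Theory Num.Theory numFieldNormedType.Exports.

Local Open Scope classical_set_scope.
Local Open Scope ring_scope.
Local Open Scope complex_scope.

Definition cintegral d (T : measurableType d) (R : realType)
    (mu : {measure set T -> \bar R}) (D : set T)
    (f : T -> R[i]) : R[i] :=
  (\int[mu]_(x in D) complex.Re (f x)) +i* (\int[mu]_(x in D) complex.Im (f x)).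

(* Principal argument, with values in ]-pi, pi]; the value at 0 is junk. *)
Definition carg (R : realType) (w : R[i]) : R :=
  let t := acos (complex.Re w / Normc.normc w) in
  if 0 <= complex.Im w then t else - t.

Definition clog (R : realType) (w : R[i]) : R[i] :=
  ln (Normc.normc w) +i* carg w.

(* The principal square root is the library's [sqrtc]: off ]-oo, 0] it has
   positive real part (its imaginary part has the sign of that of its
   argument). *)

Section borel_measures_on_the_line.
Variable R : realType.
Implicit Types (mu : {measure set (measurableTypeR R) -> \bar R}) (z : R[i]).

Definition msupport mu : set R :=
  [set x | forall U : set R, open_nbhs x U -> (0 < mu U)%E].

(* [inve 0%:E = +oo], so the kernel is +oo on the diagonal. *)
Definition log_potential mu z : \bar R :=
  (\int[mu]_x lne (inve (Normc.normc (x%:C - z))%:E))%E.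

Definition cauchy_transform mu z : R[i] :=
  cintegral mu setT (fun x => (z - x%:C)^-1).

End borel_measures_on_the_line.

Fact ltN11 (R : realType) : -1 < 1 :> R.
Proof. exact: gtrN ltr01. Qed.

Definition lambda (R : realType) : probability (measurableTypeR R) R :=
  uniform_prob (@ltN11 R).

Definition is_equilibrium_measure (R : realType) (tau : R)
    (mu : probability (measurableTypeR R) R) : Prop :=
  mu `[-1, 1]%classic = 1%E /\
  exists omega : R,
    let W (x : R) :=
      (log_potential mu x%:C + tau%:E * log_potential (@lambda R) x%:C)%E in
    (forall x : R, msupport mu x -> W x = omega%:E) /\
    (forall x : R, -1 <= x <= 1 -> (omega%:E <= W x)%E).

Definition ellE (R : realType) (k : R) : R :=
  \int[lebesgue_measure]_(t in `[0, pi / 2])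
    Num.sqrt (1 - k ^+ 2 * sin t ^+ 2).

Definition ellI (R : realType) (a k : R) : R :=
  \int[lebesgue_measure]_(t in `[0, pi / 2])
    (a + Num.sqrt (1 - k ^+ 2 * sin t ^+ 2))^-1.

Definition two_cut (R : realType) (beta : R) : set R :=
  `[-1, - beta] `|` `[beta, 1].

Definition eq_density (R : realType) (tau beta x : R) : R :=
  tau / pi * `|x| * Num.sqrt ((x ^+ 2 - beta ^+ 2) / (1 - x ^+ 2))
  * ellI (Num.sqrt (1 - x ^+ 2)) beta.

(* A literal formula only for z outside [-1, 1]: at z in ]-beta, beta[ the
   integral is singular and (z + 1) / (z - 1) is on the cut of the logarithm. *)
Definition cauchy_formula (R : realType) (tau beta : R) (z : R[i]) : R[i] :=
  (tau / 2)%:C * sqrtc ((z ^+ 2 - (beta ^+ 2)%:C) / (z ^+ 2 - 1))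
    * cintegral lebesgue_measure `[- beta, beta]
        (fun x : R => (Num.sqrt ((1 - x ^+ 2) / (beta ^+ 2 - x ^+ 2)))%:C
                      / (z - x%:C))
  - (tau / 2)%:C * clog ((z + 1) / (z - 1)).

Definition complex_off (R : realType) (S : set R) : set R[i] :=
  ~` [set x%:C | x in S].

(* Main.v *)
Require Import Defs.
From HB Require Import structures.
From mathcomp Require Import all_boot all_order all_algebra.
From mathcomp Require Import complex.
From mathcomp Require Import all_classical all_reals all_analysis.
From mathcomp Require Import measurable_realfun ring lra.

(** The argument runs through the two-interval arcsine laws. For 0 <= q < 1
    let w_q(y) = |y| / sqrt((y^2 - q^2) (1 - y^2)) on [-1, -q] U [q, 1], a
    multiple of the equilibrium measure of that set: its logarithmic potential
    is a constant c_q on the set ([potential_arc_outside]) and at most c_q in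
    the gap ]-q, q[ ([potential_arc_inside]). Both facts follow from
    y^2 = q^2 cos^2 t + sin^2 t, which turns w_q dy into dt and log |x^2 - y^2|
    into log |sin (t - al)| + log |sin (t + al)| plus a constant; the integral
    of the latter over a quarter of a turn is independent of al.

    Put e(q) = - E'(q) >= 0, and let tau rho be the density claimed for mu. The
    identity on ]0, 1[ behind everything is [angle_density_split],

      (1/2) w_0 = 1/2 + rho + (1/pi) int_0^beta e(q) w_q dq,

    which is obtained by integrating in q the t-integral of the q-derivative of
    sqrt(y^2 - q^2) / (a + sqrt(1 - q^2 sin^2 t)), where a = sqrt(1 - y^2): up
    to a derivative in t that integrates to 0, this q-derivative is minus the
    integrand of e(q) / sqrt(y^2 - q^2) ([integral_weight_derivative]).
    Integrated, it says that tau rho has mass tau (E(beta) - 1), which is 1 by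
    the choice of beta ([eq_density_mass]). Taking potentials, the potential
    of tau rho plus tau times that of lambda equals a constant minus
    (tau/pi) int_0^beta e(q) U_q dq, where U_q is the potential of w_q
    ([potential_identity]). On the two cuts every U_q with q <= beta equals its
    maximal value c_q, and in the gap none exceeds it; so the measure with
    density tau rho satisfies the equilibrium conditions ([cut_potential]).

    Any equilibrium measure coincides with it ([equilibrium_unique]):
    integrating the equilibrium conditions of each measure against the other
    shows that their difference has nonpositive logarithmic energy, and the
    energy separates probability measures on [-1, 1] ([energy_uniqueness]).
    For the latter, log (2 / |x - y|) is 1 - |x - y| / 2 plus a superposition
    of products of interval indicators. The superposition is positive
    semidefinite, and the energy of the first part is the squared L^2 distance
    of the distribution functions. The kernel log (2 / |x - y|) is used
    throughout instead of log (1 / |x - y|) because it is nonnegative on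
    [-1, 1]^2, so that no integral requires a finiteness proof to be formed.

    For the Cauchy transform, the same parametrization y = y(t) of the cut
    turns the density into tau (R(t) / pi - y'(t) / 2), where R(t) is an
    integral over a second angle u ([cut_kernel_split]). The term in y'
    integrates to logarithms. In the term in R the order of integration is
    exchanged, and the integral in t is evaluated by partial fractions and

      int_0^(pi/2) dt / (c^2 cos^2 t + sin^2 t) = pi / (2 c)   (Re c > 0),

    with c the principal square root of (z^2 - beta^2) / (z^2 - 1). What is
    left is an integral in u, which the substitution x = beta sin u identifies
    with the one over the gap ([cauchy_transform_cut_measure]). At the points
    of the gap the formula is a limit, because the Cauchy transform is
    continuous off the support ([cauchy_transform_continuous]). *)

Set Implicit Arguments.
Unset Strict Implicit.
Unset Printing Implicit Defensive.

Import Order.TTheory GRing.Theory Num.Theory numFieldNormedType.Exports.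

Local Open Scope classical_set_scope.
Local Open Scope ring_scope.
Local Open Scope complex_scope.

(** * Rules for derivatives, continuity and measurability *)

Section pointwise_calculus.
Context (R : realType).
Implicit Types (f g : R -> R) (x a b c : R).
Local Notation der f x a := (is_derive (x : R) (1%R : R) f a).

Lemma derC c x : der (fun=> c) x 0.
Proof. exact: is_derive_cst. Qed.

Lemma derI x : der (fun t => t) x 1.
Proof. exact: is_derive_id. Qed.

Lemma derD f g x a b : der f x a -> der g x b -> der (fun t => f t + g t) x (a + b).
Proof. exact: is_deriveD. Qed.

Lemma derN f x a : der f x a -> der (fun t => - f t) x (- a).
Proof. exact: is_deriveN. Qed.

Lemma derM f g x a b : der f x a -> der g x b ->
  der (fun t => f t * g t) x (f x * b + g x * a).
Proof. exact: is_deriveM. Qed.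

Lemma derX f x a n : der f x a -> der (fun t => f t ^+ n) x (n%:R * f x ^+ n.-1 * a).
Proof.
move=> h; rewrite (_ : (fun t => f t ^+ n) = (f ^+ n)%R).
  by apply: (is_derive_eq (is_deriveX n h)).
by apply/funext => t; rewrite exprfctE.
Qed.

Lemma derV f x a : f x != 0 -> der f x a -> der (fun t => (f t)^-1) x (- (f x) ^- 2 * a).
Proof. by move=> f0 h; apply: (is_derive_eq (is_deriveV f0 h)). Qed.

Lemma der_comp f g x a b : der f (g x) a -> der g x b -> der (fun t => f (g t)) x (a * b).
Proof. exact: is_derive1_comp. Qed.

Lemma der_sin f x a : der f x a -> der (fun t => sin (f t)) x (cos (f x) * a).
Proof. by move=> h; exact: (der_comp (is_derive_sin (f x)) h). Qed.

Lemma der_cos f x a : der f x a -> der (fun t => cos (f t)) x (- sin (f x) * a).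
Proof. by move=> h; exact: (der_comp (is_derive_cos (f x)) h). Qed.

Lemma der_atan f x a : der f x a -> der (fun t => atan (f t)) x ((1 + f x ^+ 2)^-1 * a).
Proof. by move=> h; exact: (der_comp (is_derive1_atan (f x)) h). Qed.

Lemma der_sqrt f x a : 0 < f x -> der f x a ->
  der (fun t => Num.sqrt (f t)) x ((2 * Num.sqrt (f x))^-1 * a).
Proof. by move=> f0 h; exact: (der_comp (is_derive1_sqrt f0) h). Qed.

Lemma der_ln f x a : 0 < f x -> der f x a -> der (fun t => ln (f t)) x ((f x)^-1 * a).
Proof. by move=> f0 h; exact: (der_comp (is_derive1_ln f0) h). Qed.

Definition cont_at f x := {for x, continuous f}.

Lemma contC c x : cont_at (fun _ : R => c) x.
Proof. exact: cst_continuous. Qed.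

Lemma contI x : cont_at (fun t : R => t) x.
Proof. by []. Qed.

Lemma contD f g x : cont_at f x -> cont_at g x -> cont_at (fun t => f t + g t) x.
Proof. exact: continuousD. Qed.

Lemma contN f x : cont_at f x -> cont_at (fun t => - f t) x.
Proof. exact: continuousN. Qed.

Lemma contM f g x : cont_at f x -> cont_at g x -> cont_at (fun t => f t * g t) x.
Proof. exact: continuousM. Qed.

Lemma cont_comp f g x : cont_at g (f x) -> cont_at f x -> cont_at (fun t => g (f t)) x.
Proof. by move=> cg cf; apply: (@continuous_comp _ _ _ f g x). Qed.

Lemma contX f x n : cont_at f x -> cont_at (fun t => f t ^+ n) x.
Proof. by move=> cf; apply: (@cont_comp f (fun t => t ^+ n) x) => //; exact: exprn_continuous. Qed.

Lemma contV f x : f x != 0 -> cont_at f x -> cont_at (fun t => (f t)^-1) x.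
Proof. exact: continuousV. Qed.

Lemma cont_sin f x : cont_at f x -> cont_at (fun t => sin (f t)) x.
Proof. by move=> cf; apply: cont_comp cf; exact: continuous_sin. Qed.

Lemma cont_cos f x : cont_at f x -> cont_at (fun t => cos (f t)) x.
Proof. by move=> cf; apply: cont_comp cf; exact: continuous_cos. Qed.

Lemma cont_sqrt f x : cont_at f x -> cont_at (fun t => Num.sqrt (f t)) x.
Proof. by move=> cf; apply: cont_comp cf; exact: sqrt_continuous. Qed.

Lemma cont_ln f x : 0 < f x -> cont_at f x -> cont_at (fun t => ln (f t)) x.
Proof. by move=> f0 cf; apply: cont_comp cf; exact: continuous_ln. Qed.

Lemma der_continuous f x a : der f x a -> cont_at f x.
Proof. by move=> [h _]; exact/differentiable_continuous/derivable1_diffP. Qed.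

End pointwise_calculus.

(** Works through the head symbol of the function; the derivative is left as
    an existential variable, to be compared afterwards, and the nonvanishing
    and positivity conditions are left as goals. *)
Ltac derive_rules := repeat lazymatch goal with
  | |- is_derive _ _ (fun _ => ?c) _ => exact: derC
  | |- is_derive _ _ (fun t => t) _ => exact: derI
  | |- is_derive _ _ (fun t => @?f t + @?g t) _ => eapply (@derD _ f g)
  | |- is_derive _ _ (fun t => - @?f t) _ => eapply (@derN _ f)
  | |- is_derive _ _ (fun t => @?f t * @?g t) _ => eapply (@derM _ f g)
  | |- is_derive _ _ (fun t => @?f t ^+ _) _ => eapply (@derX _ f)
  | |- is_derive _ _ (fun t => (@?f t)^-1) _ => eapply (@derV _ f)
  | |- is_derive _ _ (fun t => Num.sqrt (@?f t)) _ => eapply (@der_sqrt _ f)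
  | |- is_derive _ _ (fun t => sin (@?f t)) _ => eapply (@der_sin _ f)
  | |- is_derive _ _ (fun t => cos (@?f t)) _ => eapply (@der_cos _ f)
  | |- is_derive _ _ (fun t => atan (@?f t)) _ => eapply (@der_atan _ f)
  | |- is_derive _ _ (fun t => ln (@?f t)) _ => eapply (@der_ln _ f)
  end.

Ltac cont_rules := repeat lazymatch goal with
  | |- cont_at (fun _ => ?c) _ => exact: contC
  | |- cont_at (fun t => t) _ => exact: contI
  | |- cont_at (fun t => @?f t + @?g t) _ => apply (@contD _ f g)
  | |- cont_at (fun t => - @?f t) _ => apply (@contN _ f)
  | |- cont_at (fun t => @?f t * @?g t) _ => apply (@contM _ f g)
  | |- cont_at (fun t => @?f t ^+ _) _ => apply (@contX _ f)
  | |- cont_at (fun t => (@?f t)^-1) _ => apply (@contV _ f)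
  | |- cont_at (fun t => Num.sqrt (@?f t)) _ => apply (@cont_sqrt _ f)
  | |- cont_at (fun t => sin (@?f t)) _ => apply (@cont_sin _ f)
  | |- cont_at (fun t => cos (@?f t)) _ => apply (@cont_cos _ f)
  | |- cont_at (fun t => ln (@?f t)) _ => apply (@cont_ln _ f)
  end.

Section measurability.
Context (R : realType) d (T : measurableType d) (D : set T).
Implicit Types f g : T -> R.

Lemma measurable_sqrtr : measurable_fun setT (@Num.sqrt R).
Proof. by apply: continuous_measurable_fun; exact: sqrt_continuous. Qed.

(** Inversion is continuous except at the single point 0, where its value is
    0. *)
Lemma measurable_invr : measurable_fun setT (@GRing.inv R).
Proof.
rewrite (_ : [set: R] = [set 0] `|` ~` [set 0]); last by rewrite setUv.
apply/measurable_funU => //; first exact: measurableC.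
split; first exact: measurable_fun_set1.
apply: open_continuous_measurable_fun.
  by rewrite openC; exact: closed_eq.
by move=> x; rewrite inE/= => /eqP x0; exact: inv_continuous.
Qed.

Lemma meas_cst (c : R) : measurable_fun D (fun=> c).
Proof. exact: measurable_cst. Qed.
Lemma measD f g : measurable_fun D f -> measurable_fun D g ->
  measurable_fun D (fun x => f x + g x).
Proof. exact: measurable_funD. Qed.
Lemma measM f g : measurable_fun D f -> measurable_fun D g ->
  measurable_fun D (fun x => f x * g x).
Proof. exact: measurable_funM. Qed.
Lemma measN f : measurable_fun D f -> measurable_fun D (fun x => - f x).
Proof. by move=> mf; apply: (measurableT_comp _ mf); exact: oppr_measurable. Qed.
Lemma measX f n : measurable_fun D f -> measurable_fun D (fun x => f x ^+ n).
Proof. exact: measurable_funX. Qed.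
Lemma measV f : measurable_fun D f -> measurable_fun D (fun x => (f x)^-1).
Proof. by move=> mf; exact: (measurableT_comp measurable_invr mf). Qed.
Lemma meas_sqrt f : measurable_fun D f -> measurable_fun D (fun x => Num.sqrt (f x)).
Proof. by move=> mf; exact: (measurableT_comp measurable_sqrtr mf). Qed.
Lemma meas_sin f : measurable_fun D f -> measurable_fun D (fun x => sin (f x)).
Proof. by move=> mf; exact: (measurableT_comp (continuous_measurable_fun (@continuous_sin R)) mf). Qed.
Lemma meas_cos f : measurable_fun D f -> measurable_fun D (fun x => cos (f x)).
Proof. by move=> mf; exact: (measurableT_comp (continuous_measurable_fun (@continuous_cos R)) mf). Qed.
Lemma meas_ln f : measurable_fun D f -> measurable_fun D (fun x => ln (f x)).
Proof. by move=> mf; exact: (measurableT_comp (@measurable_ln R) mf). Qed.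
Lemma meas_norm f : measurable_fun D f -> measurable_fun D (fun x => `|f x|).
Proof. by move=> mf; apply: (measurableT_comp _ mf); exact: normr_measurable. Qed.

End measurability.

Section measurability_pairs.
Context (R : realType).
Local Notation TR := (measurableTypeR R).
Lemma meas_fst (D : set (TR * TR)) : measurable_fun D (fun p : TR * TR => p.1).
Proof. exact: (measurable_funTS (@measurable_fst _ _ TR TR)). Qed.
Lemma meas_snd (D : set (TR * TR)) : measurable_fun D (fun p : TR * TR => p.2).
Proof. exact: (measurable_funTS (@measurable_snd _ _ TR TR)). Qed.
Lemma meas_id (D : set TR) : measurable_fun D (fun x : TR => x).
Proof. exact/measurable_funTS/measurable_id. Qed.
End measurability_pairs.

Ltac meas_rules := repeat lazymatch goal with
  | |- measurable_fun _ (fun _ => ?c) => exact: meas_cst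
  | |- measurable_fun _ (fun t => t) => exact: meas_id
  | |- measurable_fun _ (fun t => t.1) => exact: meas_fst
  | |- measurable_fun _ (fun t => t.2) => exact: meas_snd
  | |- measurable_fun _ (fun t => @?f t + @?g t) => apply: (@measD _ _ _ _ f g)
  | |- measurable_fun _ (fun t => - @?f t) => apply: (@measN _ _ _ _ f)
  | |- measurable_fun _ (fun t => @?f t * @?g t) => apply: (@measM _ _ _ _ f g)
  | |- measurable_fun _ (fun t => @?f t ^+ _) => apply: (@measX _ _ _ _ f)
  | |- measurable_fun _ (fun t => (@?f t)^-1) => apply: (@measV _ _ _ _ f)
  | |- measurable_fun _ (fun t => Num.sqrt (@?f t)) => apply: (@meas_sqrt _ _ _ _ f)
  | |- measurable_fun _ (fun t => sin (@?f t)) => apply: (@meas_sin _ _ _ _ f)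
  | |- measurable_fun _ (fun t => cos (@?f t)) => apply: (@meas_cos _ _ _ _ f)
  | |- measurable_fun _ (fun t => ln (@?f t)) => apply: (@meas_ln _ _ _ _ f)
  | |- measurable_fun _ (fun t => `|@?f t|) => apply: (@meas_norm _ _ _ _ f)
  end.

(** * Weighted measures, integrals over boxes, change of variables *)

Section weighted_measure.
Local Open Scope ereal_scope.
Context d (T : measurableType d) (R : realType).
Context (m : {measure set T -> \bar R}) (w : T -> R).
Context (w0 : forall x, (0 <= w x)%R) (mw : measurable_fun setT w).

(** The proofs that the weight is nonnegative and measurable are phantom
    arguments: they let the measure structure be inferred from the term. *)
Definition weighted of (forall x, (0 <= w x)%R) & measurable_fun setT w :=
  fun A : set T => \int[m]_(x in A) (w x)%:E.

Let wm := weighted w0 mw.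

Let wm0 : wm set0 = 0.
Proof. by rewrite /wm /weighted integral_set0. Qed.

Let wm_ge0 A : 0 <= wm A.
Proof. by apply: integral_ge0 => x _; rewrite lee_fin. Qed.

Let wm_sigma_additive : semi_sigma_additive wm.
Proof.
move=> /= F mF tF mUF; rewrite /wm /weighted; apply: cvg_toP.
  apply: ereal_nondecreasing_is_cvgn => p q pq.
  by apply: lee_sum_nneg_natr => // k _ _; apply: integral_ge0 => x _; rewrite lee_fin.
rewrite ge0_integral_bigcup//=.
  by apply/measurable_funTS; exact/measurable_EFinP.
by move=> x _; rewrite lee_fin.
Qed.

HB.instance Definition _ := isMeasure.Build _ _ _ (weighted w0 mw)
  wm0 wm_ge0 wm_sigma_additive.

Import HBNNSimple.

Let integral_wm_indic E : measurable E ->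
  \int[wm]_x (\1_E x)%:E = \int[m]_x ((\1_E x)%:E * (w x)%:E).
Proof.
move=> mE; rewrite integral_indic//= /wm /weighted setIT.
rewrite [LHS]integral_mkcond/=; apply: eq_integral => x _.
by rewrite patchE indicE; case: ifPn => xE; rewrite ?mul1e ?mul0e.
Qed.

Let integral_wm_nnsfun (f : {nnsfun T >-> R}) :
  \int[wm]_x (f x)%:E = \int[m]_x ((f x)%:E * (w x)%:E).
Proof.
under [LHS]eq_integral do rewrite fimfunE -fsumEFin//.
rewrite [LHS]ge0_integral_fsum//; last 2 first.
  - by move=> r; exact/measurable_EFinP/measurableT_comp.
  - by move=> n x _; rewrite EFinM nnfun_muleindic_ge0.
under [RHS]eq_integral.
  move=> x xD; rewrite fimfunE -fsumEFin// ge0_mule_fsuml; last first.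
    by move=> r; rewrite EFinM nnfun_muleindic_ge0.
  over.
rewrite [RHS]ge0_integral_fsum//; last 2 first.
  - move=> r; apply: emeasurable_funM; last exact/measurable_EFinP.
    exact/measurable_EFinP/measurableT_comp.
  - by move=> n x _; apply: mule_ge0; [rewrite EFinM nnfun_muleindic_ge0|rewrite lee_fin].
apply: eq_fsbigr => r rf.
have r0 : (0 <= r)%R by move: rf; rewrite inE => -[x _ <-].
under eq_integral do rewrite EFinM.
rewrite ge0_integralZl//; last exact/measurable_EFinP.
under [RHS]eq_integral do rewrite EFinM -muleA.
rewrite ge0_integralZl// ?integral_wm_indic//.
  by apply: emeasurable_funM; exact/measurable_EFinP.
by move=> x _; rewrite mule_ge0// lee_fin.
Qed.

(** From indicators to simple functions by linearity, then to nonnegative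
    functions by monotone convergence. *)
Lemma ge0_integral_weighted (f : T -> \bar R) :
  measurable_fun setT f -> (forall x, 0 <= f x) ->
  \int[wm]_x f x = \int[m]_x (f x * (w x)%:E).
Proof.
move=> mf f0.
pose f_ := nnsfun_approx measurableT mf.
have fcv x : (f_ n x)%:E @[n --> \oo] --> f x by exact: cvg_nnsfun_approx.
transitivity (limn (fun n => \int[wm]_x (f_ n x)%:E)).
  rewrite -monotone_convergence//=.
  - by apply: eq_integral => x _; apply/esym/cvg_lim.
  - by move=> n; exact/measurable_EFinP/measurable_funTS.
  - by move=> n ? _; rewrite lee_fin.
  - by move=> ? _ ? ? mn; rewrite lee_fin; exact/lefP/nd_nnsfun_approx.
rewrite (_ : (fun n => _) = (fun n => \int[m]_x ((f_ n x)%:E * (w x)%:E))); last first.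
  by apply/funext => n; exact: integral_wm_nnsfun.
rewrite -monotone_convergence//=.
- apply: eq_integral => x _; apply/cvg_lim => //.
  move: (fcv x) => /cvg_lim fE.
  have icv : cvgn (fun n => (f_ n x)%:E) by apply/cvg_ex; exists (f x); exact: fcv.
  rewrite -fE// muleC -limeMl//; under eq_fun do rewrite muleC.
  by apply: is_cvgeMl.
- by move=> n; apply: emeasurable_funM; exact/measurable_EFinP/measurable_funTS.
- by move=> n ? _; rewrite mule_ge0// lee_fin.
- move=> x _ p q pq; apply: lee_wpmul2r; first by rewrite lee_fin.
  by rewrite lee_fin; exact/lefP/nd_nnsfun_approx.
Qed.

End weighted_measure.

Section integrals_on_boxes.
Local Open Scope ereal_scope.
Context d1 d2 (T1 : measurableType d1) (T2 : measurableType d2) (R : realType).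
Context (m1 : {sigma_finite_measure set T1 -> \bar R}).
Context (m2 : {sigma_finite_measure set T2 -> \bar R}).
Context (D1 : set T1) (D2 : set T2).
Context (mD1 : measurable D1) (mD2 : measurable D2).

Let patchX (f : T1 * T2 -> \bar R) x :
  \int[m2]_(y in D2) f (x, y) * (\1_D1 x)%:E = \int[m2]_y (f \_ (D1 `*` D2)) (x, y).
Proof.
rewrite integral_mkcond indicE; case: (boolP (x \in D1)) => xD1.
  rewrite mule1; apply: eq_integral => y _; rewrite !patchE.
  by case: ifPn => yD; case: ifPn => //; rewrite ?inE ?notin_setE/=;
    move: xD1 yD; rewrite ?inE ?notin_setE; tauto.
rewrite mule0 integral0_eq// => y _; rewrite patchE; case: ifPn => //.
by move: xD1; rewrite inE notin_setE /=; tauto.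
Qed.

Let patchY (f : T1 * T2 -> \bar R) y :
  \int[m1]_(x in D1) f (x, y) * (\1_D2 y)%:E = \int[m1]_x (f \_ (D1 `*` D2)) (x, y).
Proof.
rewrite integral_mkcond indicE; case: (boolP (y \in D2)) => xD1.
  rewrite mule1; apply: eq_integral => x _; rewrite !patchE.
  by case: ifPn => yD; case: ifPn => //; rewrite ?inE ?notin_setE/=;
    move: xD1 yD; rewrite ?inE ?notin_setE; tauto.
rewrite mule0 integral0_eq// => x _; rewrite patchE; case: ifPn => //.
by move: xD1; rewrite inE notin_setE /=; tauto.
Qed.

Let mkindX (g : T1 -> \bar R) : \int[m1]_(x in D1) g x = \int[m1]_x (g x * (\1_D1 x)%:E).
Proof.
rewrite integral_mkcond; apply: eq_integral => x _; rewrite patchE indicE.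
by case: ifPn => _; rewrite ?mule1 ?mule0.
Qed.

Let mkindY (g : T2 -> \bar R) : \int[m2]_(x in D2) g x = \int[m2]_x (g x * (\1_D2 x)%:E).
Proof.
rewrite integral_mkcond; apply: eq_integral => x _; rewrite patchE indicE.
by case: ifPn => _; rewrite ?mule1 ?mule0.
Qed.

(** Fubini-Tonelli for the function extended by 0 outside the box. *)
Lemma ge0_fubini_on (f : T1 * T2 -> \bar R) :
  measurable_fun (D1 `*` D2) f ->
  (forall x y, D1 x -> D2 y -> 0 <= f (x, y)) ->
  \int[m1]_(x in D1) \int[m2]_(y in D2) f (x, y) =
  \int[m2]_(y in D2) \int[m1]_(x in D1) f (x, y).
Proof.
move=> mf f0; rewrite mkindX mkindY.
under eq_integral do rewrite patchX.
under [RHS]eq_integral do rewrite patchY.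
apply: fubini_tonelli.
  by apply/(measurable_restrictT _ _).1 => //; exact: measurableX.
move=> [x y]; rewrite patchE; case: ifPn => //.
by rewrite inE => -[/= /f0]; exact.
Qed.

Lemma fubini_on (f : T1 * T2 -> \bar R) :
  measurable_fun (D1 `*` D2) f ->
  \int[m1]_(x in D1) \int[m2]_(y in D2) `|f (x, y)| < +oo ->
  \int[m1]_(x in D1) \int[m2]_(y in D2) f (x, y) =
  \int[m2]_(y in D2) \int[m1]_(x in D1) f (x, y).
Proof.
move=> mf fi; rewrite mkindX mkindY.
under eq_integral do rewrite patchX.
under [RHS]eq_integral do rewrite patchY.
have mf' : measurable_fun setT (f \_ (D1 `*` D2)).
  by apply/(measurable_restrictT _ _).1 => //; exact: measurableX.
apply: Fubini; apply/integrable12ltyP => //.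
move: fi; rewrite mkindX.
under eq_integral do rewrite (patchX (abse \o f)).
apply: le_lt_trans; rewrite le_eqVlt; apply/orP; left; apply/eqP.
apply: eq_integral => x _; apply: eq_integral => y _.
by rewrite !patchE; case: ifPn => //; rewrite abse0.
Qed.

End integrals_on_boxes.

Section bounded_box.
Context (R : realType).
Local Notation leb := (@lebesgue_measure R).

Lemma bounded_integrable_itv (a b M : R) (f : R -> R) :
  measurable_fun `[a, b]%classic f -> (forall x, x \in `[a, b] -> `|f x| <= M) ->
  leb.-integrable `[a, b] (EFin \o f).
Proof.
move=> mf fM; apply: measurable_bounded_integrable => //.
  by rewrite /= lebesgue_measure_itv/=; case: ifP => //; rewrite -EFinD ltry.
exists M; split; first exact: num_real.
by move=> N MN x /= xab; rewrite (le_trans (fM _ xab)) ?ltW.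
Qed.

Lemma Rfubini_bounded (a b c d M : R)
    (f : measurableTypeR R * measurableTypeR R -> R) :
  measurable_fun (`[a, b]%classic `*` `[c, d]%classic) f ->
  (forall x y, x \in `[a, b] -> y \in `[c, d] -> `|f (x, y)| <= M) ->
  (\int[leb]_(x in `[a, b]) \int[leb]_(y in `[c, d]) f (x, y) =
   \int[leb]_(y in `[c, d]) \int[leb]_(x in `[a, b]) f (x, y))%R.
Proof.
move=> mf fM.
have mfx x : x \in `[a, b] -> measurable_fun `[c, d]%classic (fun y => f (x, y)).
  move=> xab; apply: (measurable_comp (F := `[a, b]%classic `*` `[c, d]%classic) (f := f)) => //.
  - exact: measurableX.
  - by move=> _ [y /= ycd <-]; split.
  - exact/measurable_funTS/measurable_pair1.
have mfy y : y \in `[c, d] -> measurable_fun `[a, b]%classic (fun x => f (x, y)).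
  move=> ycd; apply: (measurable_comp (F := `[a, b]%classic `*` `[c, d]%classic) (f := f)) => //.
  - exact: measurableX.
  - by move=> _ [x /= xab <-]; split.
  - exact/measurable_funTS/measurable_pair2.
have Efin g (x : R) A : leb.-integrable A (EFin \o g) -> measurable A ->
    (\int[leb]_(y in A) g y)%:E = (\int[leb]_(y in A) (g y)%:E)%E.
  by move=> ig mA; rewrite fineK//; exact: integrable_fin_num.
congr fine.
under eq_integral => x xab.
  rewrite inE/= in xab.
  rewrite Efin//; last by apply: (bounded_integrable_itv (M := M)) => [|y ycd]; [exact: mfx|exact: fM].
  over.
under [RHS]eq_integral => y ycd.
  rewrite inE/= in ycd.
  rewrite Efin//; last by apply: (bounded_integrable_itv (M := M)) => [|x xab]; [exact: mfy|exact: fM].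
  over.
apply: (@fubini_on _ _ _ _ _ leb leb _ _ _ _ (EFin \o f)) => //.
  exact/measurable_EFinP.
apply: (@le_lt_trans _ _ (\int[leb]_(x in `[a, b]) \int[leb]_(y in `[c, d]) M%:E)%E).
  have M0 : `[a, b]%classic !=set0 -> `[c, d]%classic !=set0 -> 0 <= M.
    by move=> [x xab] [y ycd]; apply: le_trans (fM x y xab ycd).
  apply: ge0_le_integral => //.
  - by move=> x _; apply: integral_ge0.
  - have mg : measurable_fun setT ((abse \o (EFin \o f)) \_ (`[a, b]%classic `*` `[c, d]%classic)).
      apply/(measurable_restrictT _ _).1; first exact: measurableX.
      by apply: measurableT_comp => //; exact/measurable_EFinP.
    have := @measurable_fun_fubini_tonelli_F _ _ (measurableTypeR R) (measurableTypeR R) R leb _ mg.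
    move=> /(_ _)/(measurable_funS measurableT (@subsetT _ `[a, b]%classic)) mF.
    apply: eq_measurable_fun; last apply: mF.
      move=> x; rewrite inE/= => xab; rewrite /fubini_F [RHS]integral_mkcond.
      apply: eq_integral => y _; rewrite !patchE.
      by case: ifPn => yD; case: ifPn => //; move: yD; rewrite !inE ?notin_setE/=; tauto.
    by move=> p; rewrite patchE; case: ifPn => _ //=; exact: abse_ge0.
  - move=> x xab; apply: ge0_le_integral => //.
    + apply: measurableT_comp => //; apply/measurable_EFinP; exact: mfx.
    + by move=> y ycd; rewrite /= lee_fin; exact: fM.
under eq_integral do rewrite (integral_cst leb)//=.
rewrite (integral_cst leb)//= !lebesgue_measure_itv/=.
by do 2 case: ifP => _; rewrite ?mule0 ?mul0e// -?EFinD -?EFinM ltry.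
Qed.

End bounded_box.

Section change_of_variables.
Context (R : realType).
Local Notation leb := (@lebesgue_measure R).
Local Open Scope ereal_scope.

(** The bounded half-open intervals are differences of rays; they form a
    pi-system that generates the Borel sets. *)
Lemma measure_eq_on_rays (m1 m2 : {measure set (measurableTypeR R) -> \bar R}) :
  m1 setT < +oo ->
  (forall r : R, m1 `]-oo, r]%classic = m2 `]-oo, r]%classic) ->
  forall A, measurable A -> m1 A = m2 A.
Proof.
move=> m1fin rays A mA.
have fin1 B : measurable B -> m1 B < +oo.
  by move=> mB; apply: le_lt_trans m1fin; apply: le_measure; rewrite ?inE.
have itv (m : {measure set (measurableTypeR R) -> \bar R}) (c d : R) :
    (c <= d)%R -> m `]-oo, d]%classic < +oo ->
    m `]c, d]%classic = m `]-oo, d]%classic - m `]-oo, c]%classic.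
  move=> cd md.
  have -> : `]c, d]%classic = `]-oo, d]%classic `\` `]-oo, c]%classic.
    by rewrite -[RHS]setCK setCD setCitvl setUC -[LHS]setCK setCitv.
  by rewrite measureD// setIidr//; apply: subset_itvl; rewrite bnd_simp.
have eqitv (c d : R) : m1 `]c, d]%classic = m2 `]c, d]%classic.
  have [cd|dc] := leP c d; last by rewrite set_itv_ge ?measure0// bnd_simp -leNgt ltW.
  rewrite itv//; last exact: fin1.
  by rewrite (itv m2)// -?rays//; exact: fin1.
apply: (@measure_unique _ _ (measurableTypeR R) (@ocitv R) (fun k => `](- k%:R)%R, k%:R]%classic)) => //.
- exact: ocitvI.
- by move=> i; exact: is_ocitv.
- by rewrite bigcup_itvT.
- by move=> _ [[c d] _ <-]; exact: eqitv.
- by move=> k; exact: fin1.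
Qed.

Lemma ge0_integral_reflect (D : set (measurableTypeR R)) (g : measurableTypeR R -> \bar R) :
  measurable D -> measurable_fun setT g -> (forall x, 0 <= g x) ->
  \int[leb]_(x in D) g x = \int[leb]_(x in -%R @^-1` D) g (- x)%R.
Proof.
move=> mD mg g0.
rewrite -(@ge0_integral_pushforward _ _ (measurableTypeR R) (measurableTypeR R) R (-%R : R -> R) _ leb D g)//=.
- by apply: eq_measure_integral => //= A mA AS; exact/esym/lebesgue_measureN.
- exact: measurable_funTS.
Qed.

(** Both sides integrate g against a measure: Lebesgue measure on the
    interval [F a, F b], and the image under F of the measure with density
    F'. By the fundamental theorem of calculus the two measures agree on
    rays. Thus g only has to be measurable, as is the case for the
    logarithmic kernels below, which take the value +oo. *)
Lemma ge0_integral_subst (F F' : R -> R) (a b : R) (g : R -> \bar R) :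
  (a < b)%R -> continuous F ->
  {in `[a, b] &, {mono F : x y / (x <= y)%R}} ->
  (forall x, x \in `]a, b[ -> is_derive x (1%R:R) F (F' x)) ->
  {within `[a, b], continuous F'} ->
  (forall x, x \in `[a, b] -> (0 <= F' x)%R) ->
  measurable_fun setT g -> (forall x, 0 <= g x) ->
  \int[leb]_(y in `[F a, F b]) g y = \int[leb]_(x in `[a, b]) (g (F x) * (F' x)%:E).
Proof.
move=> ab cF incF dF cF' F'0 mg g0.
have aab : a \in `[a, b] by rewrite in_itv/= lexx ltW.
have bab : b \in `[a, b] by rewrite in_itv/= lexx ltW.
have Fab : (F a < F b)%R by rewrite (leW_mono_in incF).
pose w := F' \_ `[a, b].
have mw : measurable_fun setT w.
  apply/(measurable_restrictT _ _).1 => //.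
  exact: subspace_continuous_measurable_fun.
have w0 x : (0 <= w x)%R.
  by rewrite /w patchE; case: ifPn => //; rewrite inE => /F'0.
have mF : measurable_fun setT (F : measurableTypeR R -> measurableTypeR R).
  exact: continuous_measurable_fun.
have mu1 : measurable_fun setT (\1_`[F a, F b]%classic : R -> R) by exact: measurable_indic.
have u0 x : (0 <= (\1_`[F a, F b]%classic x : R))%R by rewrite indicE.
(* n1 is Lebesgue measure on [F a, F b], and n2 is the image of F' dx. *)
pose n1 := weighted leb u0 mu1.
pose n2 := pushforward (weighted leb w0 mw) (F : measurableTypeR R -> measurableTypeR R).
have ftc t : (a < t <= b)%R -> \int[leb]_(x in `[a, t]) (F' x)%:E = (F t)%:E - (F a)%:E.
  move=> /andP[at_ tb]; apply: continuous_FTC2 => //.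
  - by apply: continuous_subspaceW cF'; apply: subset_itvl; rewrite bnd_simp.
  - split.
    + move=> x; rewrite in_itv/= => /andP[ax xt].
      by have [] := dF x; rewrite ?in_itv/= ?ax ?(lt_le_trans xt).
    + exact/cvg_at_right_filter/cF.
    + exact/cvg_at_left_filter/cF.
  - move=> x; rewrite in_itv/= => /andP[ax xt]; rewrite derive1E.
    by apply: derive_val; apply: dF; rewrite in_itv/= ax (lt_le_trans xt).
have nn A : measurable A -> n1 A = n2 A.
  apply: measure_eq_on_rays.
    change (\int[leb]_x (\1_`[F a, F b]%classic x)%:E < +oo).
    rewrite integral_indic//= setIT lebesgue_measure_itv/=.
    by case: ifP => // _; rewrite -EFinD ltry.
  move=> r.
  change (\int[leb]_(x in `]-oo, r]) (\1_`[F a, F b]%classic x)%:E =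
    \int[leb]_(x in F @^-1` `]-oo, r]) (w x)%:E).
  rewrite integral_indic//= setIC.
  have -> : (fun x => (w x)%:E) = (EFin \o F') \_ `[a, b] by apply/funext => x; rewrite /w !patchE; case: ifPn.
  rewrite -integral_mkcondr.
  have [rFa|Far] := ltP r (F a).
    rewrite (_ : `]-oo, r] `&` `[F a, F b] = set0)%classic; last first.
      rewrite -subset0 => x [/=]; rewrite !in_itv/= => xr /andP[Fax _].
      by move: (lt_le_trans rFa (le_trans Fax xr)); rewrite ltxx.
    rewrite measure0 (_ : _ `&` _ = set0) ?integral_set0// -subset0 => x [/=].
    rewrite !in_itv/= => xr /andP[ax xb].
    have : (F a <= F x)%R by rewrite incF// in_itv/= ax xb.
    by move=> /(lt_le_trans rFa)/lt_le_trans /(_ xr); rewrite ltxx.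
  have [t [tab Ft]] : exists t, t \in `[a, b] /\ F t = Num.min r (F b).
    have [t tab Ft] : exists2 t, t \in `[a, b] & F t = Num.min r (F b).
      apply: IVT; first exact: ltW.
        by move=> x; apply: continuous_subspaceT.
      by rewrite (min_idPl (ltW Fab)) (max_idPr (ltW Fab)) le_min Far ltW//= ge_min lexx orbT.
    by exists t.
  have [at_ tb] : (a <= t /\ t <= b)%R by move: tab; rewrite in_itv/= => /andP.
  rewrite (_ : `]-oo, r] `&` `[F a, F b] = `[F a, F t])%classic; last first.
    apply/seteqP; split => x /=; rewrite !in_itv/= Ft le_min.
      by move=> [-> /andP[-> ->]].
    by move=> /and3P[-> -> ->].
  rewrite (_ : _ `&` _ = `[a, t])%classic; last first.
    apply/seteqP; split => x /=; rewrite !in_itv/=.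
      move=> [Fxr /andP[ax xb]]; rewrite ax /= -(incF x t) ?in_itv/= ?ax ?at_//.
      by rewrite Ft le_min Fxr incF// in_itv/= ax xb.
    move=> /andP[ax xt]; rewrite ax (le_trans xt tb); split => //.
    have : (F x <= F t)%R by rewrite incF// ?in_itv/= ax (le_trans xt tb).
    by move=> /le_trans; apply; rewrite Ft ge_min lexx.
  move: at_; rewrite le_eqVlt => /predU1P[<-|at_].
    by rewrite !set_itv1 integral_set1 lebesgue_measure_set1.
  rewrite ftc ?at_// lebesgue_measure_itv/= lte_fin (leW_mono_in incF)// at_.
  by rewrite EFinN.
transitivity (\int[n1]_y g y).
  rewrite [LHS]integral_mkcond ge0_integral_weighted//; apply: eq_integral => y _.
  by rewrite patchE indicE; case: ifPn; rewrite ?mule1 ?mule0.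
rewrite (eq_measure_integral n2); last by move=> A mA _; exact: nn.
rewrite ge0_integral_pushforward//=.
rewrite ge0_integral_weighted//; last exact: measurableT_comp.
rewrite [RHS]integral_mkcond; apply: eq_integral => y _.
by rewrite /w !patchE; case: ifPn; rewrite ?mule1 ?mule0.
Qed.

End change_of_variables.

(** * The logarithmic energy separates measures *)

Lemma integral_cst_indic d (T : measurableType d) (R : realType)
    (m : {measure set T -> \bar R}) (c : \bar R) (A : set T) :
  measurable A -> (0 <= c)%E ->
  (\int[m]_x (c * (\1_A x)%:E) = c * m A)%E.
Proof.
move=> mA c0.
have m1 : measurable_fun setT (fun x : T => (\1_A x)%:E : \bar R).
  exact/measurable_EFinP/measurable_indic.
have p1 (x : T) : setT x -> (0 <= (\1_A x)%:E :> \bar R)%E by rewrite lee_fin indicE.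
by rewrite ge0_integralZl// integral_indic// setIT.
Qed.

Section positive_kernels.
Context (R : realType).
Local Notation leb := (@lebesgue_measure R).
Local Notation TR := (measurableTypeR R).
Local Open Scope ereal_scope.
Implicit Types (k : TR * TR -> \bar R) (mu nu : probability TR R).

Definition mutual_energy k mu nu := \int[mu]_x \int[nu]_y k (x, y).

Lemma mutual_energyC k mu nu : measurable_fun setT k -> (forall p, 0 <= k p) ->
  (forall x y, k (x, y) = k (y, x)) -> mutual_energy k mu nu = mutual_energy k nu mu.
Proof.
move=> mk k0 kC; transitivity (\int[nu]_y \int[mu]_x k (x, y)).
  exact: (@fubini_tonelli _ _ _ _ _ mu nu k).
by apply: eq_integral => x _; apply: eq_integral => y _; rewrite kC.
Qed.

Lemma mutual_energy_ge0 k mu nu : (forall p, 0 <= k p) -> 0 <= mutual_energy k mu nu.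
Proof. by move=> k0; do 2 apply: integral_ge0 => ? _. Qed.

(** Nonnegativity of the quadratic form of k at mu - nu, with the negative
    terms on the other side because energies may be infinite. *)
Definition psd_kernel k := forall mu nu,
  mutual_energy k mu nu + mutual_energy k mu nu <=
  mutual_energy k mu mu + mutual_energy k nu nu.

Section mixtures.
Context d (P : measurableType d) (m : {sigma_finite_measure set P -> \bar R}).
Context (D : set P) (kp : (TR * TR) * P -> \bar R).
Context (mD : measurable D) (mkp : measurable_fun setT kp).
Context (kp0 : forall q, 0 <= kp q).

Let inner nu (q : TR * P) := \int[nu]_y kp ((q.1, y), q.2).

Let inner_ge0 nu q : 0 <= inner nu q.
Proof. by apply: integral_ge0. Qed.

Let measurable_inner nu : measurable_fun setT (inner nu).
Proof.
have := @measurable_fun_fubini_tonelli_F _ _ (TR * P)%type TR R nu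
  (fun q => kp ((q.1.1, q.2), q.1.2)).
apply => [|q //]; apply: measurableT_comp => //.
apply: measurable_fun_pair; last exact: (measurableT_comp measurable_snd measurable_fst).
apply: measurable_fun_pair; last exact: measurable_snd.
exact: (measurableT_comp measurable_fst measurable_fst).
Qed.

Let measurable_energy mu nu :
  measurable_fun setT (fun p => mutual_energy (fun xy => kp (xy, p)) mu nu).
Proof.
exact: (@measurable_fun_fubini_tonelli_G _ _ TR P R mu (inner nu)).
Qed.

Lemma mutual_energy_mix mu nu :
  mutual_energy (fun xy => \int[m]_(p in D) kp (xy, p)) mu nu =
  \int[m]_(p in D) mutual_energy (fun xy => kp (xy, p)) mu nu.
Proof.
transitivity (\int[mu]_x \int[m]_(p in D) inner nu (x, p)).
  apply: eq_integral => x _.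
  rewrite (@ge0_fubini_on _ _ TR P R nu m setT D _ _ (fun yp => kp ((x, yp.1), yp.2)))//.
  apply: measurable_funTS; apply: measurableT_comp => //.
  apply: measurable_fun_pair; last exact: measurable_snd.
  apply: measurable_fun_pair; last exact: measurable_fst.
  exact: measurable_cst.
rewrite (@ge0_fubini_on _ _ TR P R mu m setT D _ _ (inner nu))//.
exact: measurable_funTS.
Qed.

Lemma measurable_mix : measurable_fun setT (fun xy => \int[m]_(p in D) kp (xy, p)).
Proof.
have H := @measurable_fun_fubini_tonelli_F _ _ _ P R m
     (fun q => kp q * (\1_D q.2)%:E).
apply: eq_measurable_fun; last apply: H.
- move=> xy _; rewrite /fubini_F [RHS]integral_mkcond; apply: eq_integral => p _.
  by rewrite patchE indicE; case: ifPn; rewrite ?mule1 ?mule0.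
- apply: emeasurable_funM => //; apply/measurable_EFinP.
  by apply: measurableT_comp => //; exact: measurable_indic.
- by move=> q; rewrite mule_ge0// lee_fin indicE.
Qed.

(** The energy is linear in the kernel, and by Fubini-Tonelli this extends
    to integrals of kernels. *)
Lemma psd_mix : (forall p, D p -> psd_kernel (fun xy => kp (xy, p))) ->
  psd_kernel (fun xy => \int[m]_(p in D) kp (xy, p)).
Proof.
move=> psd mu nu.
have E0 (mu' nu' : probability TR R) p :
    0 <= mutual_energy (fun xy => kp (xy, p)) mu' nu' by exact: mutual_energy_ge0.
rewrite (mutual_energy_mix mu nu) (mutual_energy_mix mu mu) (mutual_energy_mix nu nu).
have mED mu' nu' : measurable_fun D (fun p => mutual_energy (fun xy => kp (xy, p)) mu' nu').
  by apply: measurable_funTS.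
have addE mu1 nu1 mu2 nu2 :
    \int[m]_(p in D) mutual_energy (fun xy => kp (xy, p)) mu1 nu1 +
    \int[m]_(p in D) mutual_energy (fun xy => kp (xy, p)) mu2 nu2 =
    \int[m]_(p in D) (mutual_energy (fun xy => kp (xy, p)) mu1 nu1 +
                      mutual_energy (fun xy => kp (xy, p)) mu2 nu2).
  by apply/esym; apply: (ge0_integralD m mD) => // p _; exact: E0.
rewrite [leLHS](addE mu nu mu nu) [leRHS](addE mu mu nu nu).
apply: ge0_le_integral => //.
- by move=> p _; rewrite adde_ge0.
- exact: emeasurable_funD.
- exact: emeasurable_funD.
- by move=> p Dp; exact: psd.
Qed.

End mixtures.

(** The energy of a product is a product of integrals, so the claim is that
    2 a b is at most a^2 + b^2. *)
Lemma psd_rank1 (phi : TR -> \bar R) : measurable_fun setT phi ->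
  (forall x, 0 <= phi x) -> (forall mu, \int[mu]_x phi x < +oo) ->
  psd_kernel (fun xy => phi xy.1 * phi xy.2).
Proof.
move=> mphi phi0 fin.
have E (mu nu : probability TR R) : mutual_energy (fun xy => phi xy.1 * phi xy.2) mu nu =
    (\int[mu]_x phi x) * (\int[nu]_x phi x).
  rewrite /mutual_energy/= -ge0_integralZr//; last exact: integral_ge0.
  by apply: eq_integral => x _; rewrite ge0_integralZl.
move=> mu nu; rewrite !E.
have f0 (m : probability TR R) : \int[m]_x phi x \is a fin_num.
  by rewrite ge0_fin_numE//; exact: integral_ge0.
rewrite -(fineK (f0 mu)) -(fineK (f0 nu)) -!EFinM -!EFinD lee_fin.
by rewrite -subr_ge0; set a := fine _; set b := fine _;
  rewrite (_ : _ - _ = (a - b) ^+ 2)%R ?sqr_ge0//; ring.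
Qed.

End positive_kernels.

Section log_kernel.
Context (R : realType).
Local Notation leb := (@lebesgue_measure R).
Local Notation TR := (measurableTypeR R).
Local Open Scope ereal_scope.

(** The kernel log (2 / |x - y|) for x and y in [-1, 1]; the truncation,
    which is invisible there, makes it nonnegative everywhere. *)
Definition log_kernel (p : TR * TR) : \bar R :=
  if p.1 == p.2 then +oo else (Num.max 0 (ln (2 / `|p.1 - p.2|)))%:E.

Lemma log_kernel_ge0 p : 0 <= log_kernel p.
Proof. by rewrite /log_kernel; case: ifP => // _; rewrite lee_fin le_max lexx. Qed.

Lemma log_kernelC x y : log_kernel (x, y) = log_kernel (y, x).
Proof. by rewrite /log_kernel/= eq_sym distrC. Qed.

Lemma measurable_log_kernel : measurable_fun setT log_kernel.
Proof.
apply: measurable_fun_ifT => //.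
  exact: (measurable_fun_eqr (f := fst) (g := snd)).
apply/measurable_EFinP; apply: measurable_maxr => //.
apply: measurableT_comp; first exact: measurable_ln.
apply: measurable_funM => //.
apply: measurableT_comp; first exact: measurable_invr.
by apply: measurableT_comp => //; exact: measurable_funB.
Qed.

(** Superpositions of the rank-one kernels window x u r * window y u r make
    up the positive semidefinite part of the logarithmic kernel. *)
Definition window (x u r : R) : R := if (u < x)%R && (x <= u + r)%R then 1%R else 0%R.

Definition window2 (q : (TR * TR) * (TR * TR)) : \bar R :=
  (window q.1.1 q.2.1 q.2.2 * window q.1.2 q.2.1 q.2.2 / q.2.2 ^+ 2)%:E.

Lemma window_ge0 x u r : (0 <= window x u r)%R.
Proof. by rewrite /window; case: ifP. Qed.

Lemma measurable_window2 : measurable_fun setT window2.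
Proof.
have mw (f : (TR * TR) * (TR * TR) -> TR) : measurable_fun setT f ->
    measurable_fun setT (fun q => window (f q) q.2.1 q.2.2).
  move=> mf; apply: measurable_fun_ifT => //; apply: measurable_and.
    by apply: measurable_fun_ltr => //; exact: measurableT_comp.
  apply: measurable_fun_ler => //; apply: measurable_funD; exact: measurableT_comp.
apply/measurable_EFinP; apply: measurable_funM.
  by apply: measurable_funM; apply: mw; exact: measurableT_comp.
apply: measurableT_comp; first exact: measurable_invr.
by apply: measurable_funX; exact: measurableT_comp.
Qed.

(** The integral over u is, up to the factor 1 / r^2, the tent function
    max(0, r - |x - y|). *)
Definition tent_kernel (xy : TR * TR) : \bar R :=
  \int[leb]_(r in `]0%R, 2%R]) \int[leb]_u window2 (xy, (u, r)).

Lemma window2_ge0 q : 0 <= window2 q.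
Proof. by rewrite lee_fin mulr_ge0 ?invr_ge0 ?sqr_ge0// mulr_ge0// window_ge0. Qed.

Let inner_window q := \int[leb]_u window2 (q.1, (u, q.2)).

Let measurable_inner_window : measurable_fun setT inner_window.
Proof.
have := @measurable_fun_fubini_tonelli_F _ _ _ TR R leb
   (fun q => window2 (q.1.1, (q.2, q.1.2))).
apply => [|q]; last exact: window2_ge0.
apply: measurableT_comp; first exact: measurable_window2.
apply: measurable_fun_pair; first exact: (measurableT_comp measurable_fst measurable_fst).
apply: measurable_fun_pair; first exact: measurable_snd.
exact: (measurableT_comp measurable_snd measurable_fst).
Qed.

Let inner_window_ge0 q : 0 <= inner_window q.
Proof. by apply: integral_ge0 => u _; exact: window2_ge0. Qed.

Lemma measurable_tent_kernel : measurable_fun setT tent_kernel.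
Proof. exact: (@measurable_mix _ _ TR leb `]0%R, 2%R]%classic inner_window). Qed.

Lemma psd_tent_kernel : psd_kernel tent_kernel.
Proof.
apply: (@psd_mix _ _ TR leb `]0%R, 2%R]%classic inner_window) => //.
move=> r _ /=.
apply: (@psd_mix _ _ TR leb setT (fun q => window2 (q.1, (q.2, r)))) => //.
- apply: measurableT_comp; first exact: measurable_window2.
  apply: measurable_fun_pair; first exact: measurable_fst.
  apply: measurable_fun_pair; first exact: measurable_snd.
  exact: measurable_cst.
- by move=> q; exact: window2_ge0.
move=> u _ /=.
have mw : measurable_fun setT (fun x : TR => window x u r).
  apply: measurable_fun_ifT => //; apply: measurable_and.
    exact: measurable_fun_ltr.
  exact: measurable_fun_ler.
rewrite (_ : (fun xy => _) = (fun xy : TR * TR =>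
    (window xy.1 u r / `|r|)%:E * (window xy.2 u r / `|r|)%:E)).
  apply: (@psd_rank1 R (fun x => (window x u r / `|r|)%:E)).
  - by apply/measurable_EFinP; apply: measurable_funM.
  - by move=> x; rewrite lee_fin mulr_ge0 ?window_ge0// invr_ge0.
  - move=> mu; apply: (@le_lt_trans _ _ (\int[mu]_x (`|r|^-1)%:E)).
      apply: ge0_le_integral => //.
      + by move=> x _; rewrite lee_fin mulr_ge0 ?window_ge0// invr_ge0.
      + by apply/measurable_EFinP; apply: measurable_funM.
      + move=> x _; rewrite lee_fin ler_piMl ?invr_ge0//.
        by rewrite /window; case: ifP.
    by rewrite integral_cst//= probability_setT mule1 ltry.
apply/funext => xy; rewrite /window2 /= -EFinM; congr EFin.
by rewrite -[in LHS](@real_normK _ r) ?num_real// expr2 invfM; ring.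
Qed.

(** The windows of length r that contain both points are those that start in
    an interval of length r - |x - y|. *)
Lemma integral_window2 (x y r : R) : (0 < r)%R ->
  \int[leb]_u window2 ((x, y), (u, r)) = ((Num.max 0 (r - `|x - y|)) / r ^+ 2)%:E.
Proof.
move=> r0.
pose A : set TR := `[(Num.max x y - r)%R, (Num.min x y)%R[%classic.
transitivity (\int[leb]_u ((r ^+ 2)^-1%:E * (\1_A u)%:E)).
  apply: eq_integral => u _; rewrite /window2/= -EFinM; congr EFin.
  rewrite mulrC; congr (_ * _)%R; rewrite /window indicE.
  have -> : (u \in A) = ((u < x)%R && (x <= u + r)%R) && ((u < y)%R && (y <= u + r)%R).
    apply/idP/idP; rewrite inE /A /= in_itv/= lt_min lerBlDr ge_max.
      by move=> /andP[/andP[-> ->] /andP[-> ->]].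
    by move=> /andP[/andP[-> ->] /andP[-> ->]].
  by case: ifP; case: ifP; rewrite /= ?mulr1 ?mulr0 ?mul0r.
rewrite integral_cst_indic; [|exact: measurable_itv|by rewrite lee_fin invr_ge0 sqr_ge0].
rewrite /= /A lebesgue_measure_itv/= lte_fin muleC.
have xyE : (Num.min x y - (Num.max x y - r) = r - `|x - y|)%R.
  by case: (leP x y) => xy; [rewrite ler0_norm ?subr_le0//; lra|rewrite gtr0_norm ?subr_gt0//; lra].
rewrite -subr_gt0 xyE; case: ltP => [h|h].
  by rewrite -EFinD xyE -EFinM.
by rewrite mul0e mul0r.
Qed.

(** With t = |x - y|, the integral of (r - t) / r^2 over [t, 2] is log
    (2 / t) - 1 + t / 2. *)
Lemma log_kernel_decomposition (x y : R) : (-1 <= x <= 1)%R -> (-1 <= y <= 1)%R ->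
  log_kernel (x, y) = (1 - `|x - y| / 2)%:E + tent_kernel (x, y).
Proof.
move=> x1 y1; rewrite /tent_kernel.
have t2 : (`|x - y| <= 2)%R by rewrite ler_norml; lra.
under eq_integral => r r02.
  have r0 : (0 < r)%R by move: r02; rewrite inE/= in_itv/= => /andP[].
  rewrite integral_window2//; over.
(* On the diagonal the tent kernel is infinite because 1 / r is not
   integrable at 0. *)
rewrite /log_kernel/=; case: (eqVneq x y) => [<-|xy].
  rewrite subrr normr0 mul0r subr0.
  suff -> : \int[leb]_(r in `]0%R, 2%R]) (Num.max 0 (r - 0) / r ^+ 2)%:E = +oo by [].
  apply/eqyP => A A0.
  pose e := (2 * expR (- A))%R.
  have e0 : (0 < e)%R by rewrite mulr_gt0// expR_gt0.
  have e2 : (e < 2)%R.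
    by rewrite /e -[ltRHS]mulr1 ltr_pM2l// -expR0 ltr_expR oppr_lt0.
  have <- : \int[leb]_(r in `[e, 2%R]) (r^-1)%:E = A%:E.
    rewrite (@continuous_FTC2 _ (fun r => r^-1)%R (@ln R))//.
    - rewrite -EFinB; congr EFin; rewrite /e lnM ?posrE ?expR_gt0// expRK; lra.
    - apply: continuous_in_subspaceT => r; rewrite inE/= in_itv/= => /andP[er _].
      by apply: inv_continuous; rewrite gt_eqF// (lt_le_trans e0).
    - split => [r| |].
      + rewrite in_itv/= => /andP[er _].
        by have [] := is_derive1_ln (lt_trans e0 er).
      + by apply: cvg_at_right_filter; apply: continuous_ln.
      + by apply: cvg_at_left_filter; apply: continuous_ln.
    - move=> r; rewrite in_itv/= => /andP[er _]; rewrite derive1E.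
      by apply: derive_val; apply: is_derive1_ln; exact: lt_trans er.
  have mm : measurable_fun setT (fun r : R => (Num.max 0 (r - 0) / r ^+ 2)%:E).
    apply/measurable_EFinP; apply: measurable_funM.
      by apply: measurable_maxr => //; exact: measurable_funB.
    by apply: measurableT_comp; [exact: measurable_invr|exact: measurable_funX].
  apply: (@le_trans _ _ (\int[leb]_(r in `[e, 2%R]) (Num.max 0 (r - 0) / r ^+ 2)%:E)).
    apply: ge0_le_integral => //.
    + move=> r /=; rewrite in_itv/= => /andP[er _].
      by rewrite lee_fin invr_ge0 (le_trans _ er)// ltW.
    + by apply/measurable_EFinP; exact: (measurable_funTS (@measurable_invr R)).
    + exact: measurable_funTS.
    + move=> r /=; rewrite in_itv/= => /andP[er _]; rewrite lee_fin subr0.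
      have r0 := lt_le_trans e0 er.
      by rewrite max_r ?(ltW r0)// expr2 invfM mulrA divff ?mul1r// gt_eqF.
  apply: ge0_subset_integral => //.
  + exact: measurable_funTS.
  + by move=> r _; rewrite lee_fin mulr_ge0 ?invr_ge0 ?sqr_ge0// le_max lexx.
  + by apply: subset_itvr; rewrite bnd_simp.
set t := `|x - y|%R.
have t0 : (0 < t)%R by rewrite normr_gt0 subr_eq0.
rewrite max_r; last by rewrite ln_ge0// ler_pdivlMr// mul1r.
have split0 : `]0%R, 2%R]%classic = `]0%R, t[%classic `|` `[t, 2%R]%classic.
  by rewrite -itv_bndbnd_setU// bnd_simp// ltW.
have mm : measurable_fun setT (fun r : R => (Num.max 0 (r - t) / r ^+ 2)%:E).
  apply/measurable_EFinP; apply: measurable_funM.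
    by apply: measurable_maxr => //; exact: measurable_funB.
  by apply: measurableT_comp; [exact: measurable_invr|exact: measurable_funX].
rewrite split0 ge0_integral_setU//=; last 3 first.
- exact: measurable_funTS.
- by move=> r _; rewrite lee_fin mulr_ge0 ?invr_ge0 ?sqr_ge0// le_max lexx.
- rewrite disj_set2E; apply/eqP; rewrite -subset0 => r [/=]; rewrite !in_itv/=.
  by move=> /andP[_ rt] /andP[tr _]; move: (lt_le_trans rt tr); rewrite ltxx.
rewrite integral0_eq ?add0e; last first.
  move=> r /=; rewrite in_itv/= => /andP[r0 rt].
  by rewrite max_l ?mul0r// subr_le0 ltW.
under eq_integral => r.
  rewrite inE/= in_itv/= => /andP[tr _].
  rewrite max_r ?subr_ge0//; over.
have [t2'|t2'] := ltP t 2%R; last first.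
  have -> : t = 2%R by apply/eqP; rewrite eq_le t2.
  by rewrite set_itv1 integral_set1 divff// ln1 subrr adde0.
rewrite (@continuous_FTC2 _ (fun r => (r - t) / r ^+ 2)%R (fun r => ln r + t * r^-1)%R)//.
- rewrite -EFinB -EFinD; congr EFin.
  rewrite lnM ?posrE ?invr_gt0// lnV ?posrE// divff ?gt_eqF//; lra.
- apply: continuous_in_subspaceT => r; rewrite inE/= in_itv/= => /andP[er _].
  have r0 : r != 0%R by rewrite gt_eqF// (lt_le_trans t0).
  apply: cvgM; first by apply: cvgB => //; exact: cvg_cst.
  by apply: cvgV; [rewrite expf_neq0|exact: exprn_continuous].
- have cF r : (0 < r)%R -> {for r, continuous (fun r : R => ln r + t * r^-1)%R}.
    move=> r0; apply: cvgD; first exact: continuous_ln.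
    by apply: cvgMr; apply: inv_continuous; rewrite gt_eqF.
  split => [r| |].
  + rewrite in_itv/= => /andP[er _]; have r0 := lt_trans t0 er.
    apply: derivableD; first by have [] := is_derive1_ln r0.
    by apply: derivableM => //; apply: derivableV => //; rewrite gt_eqF.
  + by apply: cvg_at_right_filter; apply: cF.
  + by apply: cvg_at_left_filter; apply: cF.
- move=> r; rewrite in_itv/= => /andP[er _]; have r0 := lt_trans t0 er.
  rewrite derive1E; apply: derive_val.
  eapply is_derive_eq; first by derive_rules; rewrite ?gt_eqF.
  by rewrite /=; field; rewrite gt_eqF.
Qed.

End log_kernel.

Lemma not_both_near (R : realType) (a b c : R) :
  a <= c < a + `|a - b| / 2 -> b <= c < b + `|a - b| / 2 -> False.
Proof.
move=> /andP[h1 h2] /andP[h3 h4].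
have [s0|s0] := leP 0 (a - b).
  by move: h2 h4; rewrite ger0_norm// => h2 h4; lra.
by move: h2 h4; rewrite ltr0_norm// => h2 h4; lra.
Qed.

(** The tent energies may be cancelled because finite energies of mu and nu
    bound their tent energies; t3 may be infinite a priori and is controlled
    by the second inequality. *)
Lemma cancel_tent (R : realType) (a1 a2 a3 t1 t2 t3 : \bar R) :
  (0 <= a1 -> 0 <= a2 -> 0 <= a3 -> 0 <= t1 -> 0 <= t2 -> 0 <= t3 ->
  a1 + t1 + (a2 + t2) <= a3 + t3 + (a3 + t3) -> t3 + t3 <= t1 + t2 ->
  a1 + t1 < +oo -> a2 + t2 < +oo -> a1 + a2 <= a3 + a3)%E.
Proof.
case: a1 => [a1| |]//; case: a2 => [a2| |]//; case: a3 => [a3| |]//; case: t1 => [t1| |]//;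
  case: t2 => [t2| |]//; case: t3 => [t3| |]//; rewrite -?EFinD ?lee_fin ?leey//.
by move=> *; lra.
Qed.

Section energy_uniqueness.
Context (R : realType).
Local Notation leb := (@lebesgue_measure R).
Local Notation TR := (measurableTypeR R).
Local Notation I11 := (`[(-1)%R, 1%R]%classic : set TR).
Local Open Scope ereal_scope.
Implicit Types (mu nu : probability TR R).

(** The complement of a set of full measure is negligible. *)
Lemma integral_concentrated mu (D : set TR) (f : TR -> \bar R) :
  measurable D -> mu D = 1 -> measurable_fun setT f ->
  \int[mu]_x f x = \int[mu]_(x in D) f x.
Proof.
move=> mD muD mf.
have muDC : mu (~` D) = 0 by rewrite probability_setC// muD subee.
rewrite [RHS]integral_mkcond; apply: ae_eq_integral => //.
  by apply/(measurable_restrictT _ _).1 => //; exact: measurable_funTS.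
exists (~` D); split => //; first exact: measurableC.
by move=> x /= nfx Dx; apply: nfx => _; rewrite patchE mem_set.
Qed.

(** Half the indicator that x and y lie on the same side of u. Its integral
    over u in [-1, 1] is 1 - |x - y| / 2, and its energy only involves the
    values of the distribution functions at u. *)
Definition step2 (q : (TR * TR) * TR) : \bar R :=
  if (((q.1.1 <= q.2) && (q.1.2 <= q.2)) || ((q.2 < q.1.1) && (q.2 < q.1.2)))%R
  then (2^-1)%:E else 0.

Lemma step2_ge0 q : 0 <= step2 q.
Proof. by rewrite /step2; case: ifP => // _; rewrite lee_fin. Qed.

Lemma measurable_step2 : measurable_fun setT step2.
Proof.
have m11 : measurable_fun setT (fun q : (TR * TR) * TR => q.1.1).
  exact: (measurableT_comp measurable_fst measurable_fst).
have m12 : measurable_fun setT (fun q : (TR * TR) * TR => q.1.2).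
  exact: (measurableT_comp measurable_snd measurable_fst).
have m2 : measurable_fun setT (fun q : (TR * TR) * TR => q.2) by exact: measurable_snd.
apply: measurable_fun_ifT => //; apply: measurable_or; apply: measurable_and;
  by [exact: measurable_fun_ler|exact: measurable_fun_ltr].
Qed.

Lemma integral_step2 (x y : R) : (-1 <= x <= 1)%R -> (-1 <= y <= 1)%R ->
  \int[leb]_(u in I11) step2 ((x, y), u) = (1 - `|x - y| / 2)%:E.
Proof.
move=> /andP[x1 x2] /andP[y1 y2].
pose a := Num.min x y; pose b := Num.max x y.
have ab : (a <= b)%R by rewrite /a /b; case: (leP x y) => // /ltW.
have a1 : (-1 <= a)%R by rewrite /a le_min x1.
have b1 : (b <= 1)%R by rewrite /b ge_max x2.
have xyE : (b - a = `|x - y|)%R.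
  by rewrite /a /b; case: (leP x y) => xy; [rewrite ler0_norm ?subr_le0//; lra|rewrite gtr0_norm ?subr_gt0//; lra].
pose A : set TR := `[(-1)%R, a[%classic; pose B : set TR := `[b, 1%R]%classic.
have -> : \int[leb]_(u in I11) step2 ((x, y), u) =
    \int[leb]_u ((2^-1)%:E * (\1_A u)%:E + (2^-1)%:E * (\1_B u)%:E).
  rewrite integral_mkcond; apply: eq_integral => u _.
  rewrite patchE /step2/= !indicE /A /B.
  have -> : (u \in I11) = ((-1 <= u) && (u <= 1))%R.
    by apply/idP/idP; rewrite inE /= in_itv.
  have -> : (u \in (`[(-1)%R, a[%classic : set TR)) = ((-1 <= u) && (u < a))%R.
    by apply/idP/idP; rewrite inE /= in_itv.
  have -> : (u \in (`[b, 1%R]%classic : set TR)) = ((b <= u) && (u <= 1))%R.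
    by apply/idP/idP; rewrite inE /= in_itv.
  rewrite /a /b lt_min ge_max.
  case: (leP x u) => xu; case: (leP y u) => yu; rewrite /= ?andbF ?andbT ?mule0 ?add0e ?adde0.
  - have -> : (-1 <= u)%R by lra.
    by case: (u <= 1)%R; rewrite ?mule1 ?mule0.
  - by case: ifP.
  - by case: ifP.
  - have -> : (u <= 1)%R by lra.
    by rewrite andbT; case: (-1 <= u)%R; rewrite ?mule1 ?mule0.
have mi C : measurable C -> measurable_fun setT (fun u : TR => (2^-1)%:E * (\1_C u)%:E : \bar R).
  by move=> mC; apply: emeasurable_funM => //; exact/measurable_EFinP/measurable_indic.
have i0 C u : 0 <= (2^-1)%:E * (\1_C u)%:E :> \bar R.
  by rewrite mule_ge0// lee_fin// indicE.
have mA : measurable A by exact: measurable_itv.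
have mB : measurable B by exact: measurable_itv.
have h0 : 0 <= (2^-1)%:E :> \bar R by rewrite lee_fin.
have mA' := mi A mA; have mB' := mi B mB.
rewrite ge0_integralD// !integral_cst_indic//=.
rewrite /A /B !lebesgue_measure_itv/= !lte_fin.
have hA : (if (-1 < a)%R then (a%:E - (-1)%:E)%E else 0) = (a + 1)%:E.
  rewrite lt_neqAle a1 andbT; case: eqP => [<-|_] /=; last by rewrite -EFinB opprK.
  by rewrite addNr.
have hB : (if (b < 1)%R then (1%:E - b%:E)%E else 0) = (1 - b)%:E.
  by rewrite lt_neqAle b1 andbT; case: eqP => [->|_] //=; rewrite subrr.
by rewrite hA hB -!EFinM -EFinD; congr EFin; rewrite -xyE; field.
Qed.

Lemma mutual_energy_step2 mu nu (u : R) :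
  mutual_energy (fun xy => step2 (xy, u)) mu nu =
  (2^-1)%:E * (mu `]-oo, u]%classic * nu `]-oo, u]%classic +
    (1 - mu `]-oo, u]%classic) * (1 - nu `]-oo, u]%classic)).
Proof.
set A := `]-oo, u]%classic.
have mA : measurable (A : set TR) by exact: measurable_itv.
have iA m (c : TR) : \int[m : probability TR R]_x (\1_A x)%:E = m A.
  by rewrite integral_indic// setIT.
have inner (x : TR) : \int[nu]_y step2 ((x, y), u) =
    (2^-1)%:E * (if (x <= u)%R then nu A else 1 - nu A).
  rewrite -probability_setC//.
  have -> : (if (x <= u)%R then nu A else nu (~` A)) = nu (if (x <= u)%R then A else ~` A).
    by case: ifP.
  set B := if _ then _ else _.
  have mB : measurable B by rewrite /B; case: ifP => // _; exact: measurableC.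
  have <- : \int[nu]_y ((2^-1)%:E * (\1_B y)%:E) = (2^-1)%:E * nu B.
    by rewrite integral_cst_indic// lee_fin.
  apply: eq_integral => y _; rewrite /step2/= indicE.
  have yA : (y \in A) = (y <= u)%R by apply/idP/idP; rewrite inE /A /= in_itv.
  rewrite /B; case: (leP x u) => xu /=; rewrite ?in_setC yA.
    by rewrite orbF; case: ifP => _; rewrite ?mule1 ?mule0.
  by rewrite -ltNge; case: ifP => _; rewrite ?mule1 ?mule0.
rewrite /mutual_energy; under eq_integral do rewrite inner.
have n0 : 0 <= 1 - nu A by rewrite -probability_setC.
transitivity (\int[mu]_x ((2^-1)%:E * (nu A * (\1_A x)%:E + (1 - nu A) * (\1_(~` A) x)%:E))).
  apply: eq_integral => x _; congr (_ * _); rewrite !indicE in_setC.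
  have -> : (x \in A) = (x <= u)%R by apply/idP/idP; rewrite inE /A /= in_itv.
  by case: ifP => _; rewrite /= ?mule1 ?mule0 ?adde0 ?add0e.
have mi C : measurable C -> measurable_fun setT (fun x : TR => (\1_C x)%:E : \bar R).
  by move=> mC; exact/measurable_EFinP/measurable_indic.
have mAC := measurableC mA.
have m1 : measurable_fun setT (fun x : TR => nu A * (\1_A x)%:E).
  by apply: emeasurable_funM => //; exact: mi.
have m2 : measurable_fun setT (fun x : TR => (1 - nu A) * (\1_(~` A) x)%:E).
  by apply: emeasurable_funM => //; exact: mi.
have p1 (x : TR) : 0 <= nu A * (\1_A x)%:E by rewrite mule_ge0// lee_fin indicE.
have p2 (x : TR) : 0 <= (1 - nu A) * (\1_(~` A) x)%:E by rewrite mule_ge0// lee_fin indicE.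
rewrite ge0_integralZl//; last 2 first.
- exact: emeasurable_funD.
- by move=> x _; rewrite adde_ge0.
congr (_ * _); rewrite ge0_integralD//.
by rewrite !integral_cst_indic//; congr (_ + _); rewrite muleC//; congr (_ * _);
  exact: probability_setC.
Qed.

Lemma right_continuous_ray mu (u : R) : mu `]-oo, (u + k.+1%:R^-1)%R]%classic @[k --> \oo] --> mu `]-oo, u]%classic.
Proof.
have -> : `]-oo, u]%classic = \bigcap_(k in setT) (`]-oo, (u + k.+1%:R^-1)%R]%classic : set TR).
  apply/seteqP; split => x /=.
    by move=> + k _ /=; rewrite !in_itv/= => /le_trans; apply; rewrite lerDl.
  move=> h; rewrite in_itv/= leNgt; apply/negP => ux.
  have [k _ hk] := near_infty_natSinv_lt (PosNum (etrans (subr_gt0 u x) ux)).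
  have := h k I; rewrite /= in_itv/= => xk.
  have := hk k (leqnn k) => /=.
  by rewrite ltrBrDl => /(le_lt_trans xk); rewrite ltxx.
apply: nonincreasing_cvg_mu => //.
- by rewrite (le_lt_trans (probability_le1 _ _)) ?ltry//; exact: measurable_itv.
- by apply: bigcapT_measurable => k; exact: measurable_itv.
- move=> p q pq; apply/subsetPset => x /=; rewrite !in_itv/= => /le_trans; apply.
  by rewrite lerD2l lef_pV2 ?posrE// ler_nat.
Qed.

(** The two sides differ by the integral of the square of the difference of
    the distribution functions, which therefore agree almost everywhere on
    [-1, 1], and hence everywhere on [-1, 1[ by right-continuity. *)
Lemma cdf_eq_of_energy mu nu :
  \int[leb]_(u in I11) mutual_energy (fun xy => step2 (xy, u)) mu mu +
  \int[leb]_(u in I11) mutual_energy (fun xy => step2 (xy, u)) nu nu <=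
  \int[leb]_(u in I11) mutual_energy (fun xy => step2 (xy, u)) mu nu +
  \int[leb]_(u in I11) mutual_energy (fun xy => step2 (xy, u)) mu nu ->
  forall u : R, (-1 <= u < 1)%R -> mu `]-oo, u]%classic = nu `]-oo, u]%classic.
Proof.
pose F (m : probability TR R) (u : R) := fine (m `]-oo, u]%classic).
have FE (m : probability TR R) u : m `]-oo, u]%classic = (F m u)%:E.
  by rewrite fineK// fin_num_measure//; exact: measurable_itv.
have F0 (m : probability TR R) u : (0 <= F m u)%R by rewrite fine_ge0.
have F1 (m : probability TR R) u : (F m u <= 1)%R.
  by rewrite -lee_fin -FE probability_le1//; exact: measurable_itv.
have mF (m : probability TR R) : measurable_fun setT (F m).
  apply: nondecreasing_measurable => // x y xy; apply: fine_le.
  - by rewrite fin_num_measure//; exact: measurable_itv.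
  - by rewrite fin_num_measure//; exact: measurable_itv.
  - apply: le_measure; rewrite ?inE; [exact: measurable_itv|exact: measurable_itv|].
    by move=> z; rewrite /= !in_itv/= => /le_trans; exact.
pose e (m n : probability TR R) u := (2^-1 * (F m u * F n u + (1 - F m u) * (1 - F n u)))%R.
have eE m n : \int[leb]_(u in I11) mutual_energy (fun xy => step2 (xy, u)) m n =
    \int[leb]_(u in I11) (e m n u)%:E.
  by apply: eq_integral => u _; rewrite mutual_energy_step2 !FE.
have me m n : measurable_fun setT (e m n).
  by rewrite /e; meas_rules.
have e1 m n u : (0 <= e m n u <= 1)%R.
  rewrite /e; have := F0 m u; have := F0 n u; have := F1 m u; have := F1 n u => *.
  by nra.
have ie m n : leb.-integrable I11 (EFin \o e m n).
  apply: (bounded_integrable_itv (M := 1)); first exact: measurable_funTS.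
  by move=> x _; have /andP[h0 h1] := e1 m n x; rewrite ger0_norm.
rewrite !eE => le.
pose q u := ((F mu u - F nu u) ^+ 2)%R.
have qE u : q u = (e mu mu u + e nu nu u - (e mu nu u + e mu nu u))%R.
  by rewrite /q /e; field.
have mq : measurable_fun setT q by rewrite /q; meas_rules.
pose E m n := fine (\int[leb]_(u in I11) (e m n u)%:E).
have iE m n : \int[leb]_(u in I11) (e m n u)%:E = (E m n)%:E.
  by rewrite fineK//; apply: integrable_fin_num => //; exact: ie.
have q0 : \int[leb]_(u in I11) `|(EFin \o q) u| = 0.
  apply/eqP; rewrite eq_le integral_ge0 ?andbT//.
  have -> : \int[leb]_(u in I11) `|(EFin \o q) u| =
      \int[leb]_(u in I11) (((e mu mu u)%:E + (e nu nu u)%:E) - ((e mu nu u)%:E + (e mu nu u)%:E)).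
    by apply: eq_integral => u _; rewrite /= ger0_norm ?sqr_ge0// qE EFinB !EFinD.
  rewrite integralB//=; [|by apply: integrableD => //; exact: ie|by apply: integrableD => //; exact: ie].
  rewrite integralD//; [|exact: ie|exact: ie].
  rewrite integralD//; [|exact: ie|exact: ie].
  rewrite [leLHS](_ : _ = (E mu mu + E nu nu - (E mu nu + E mu nu))%:E); last first.
    by rewrite EFinB !EFinD; congr (_ + _ - (_ + _)); exact: iE.
  move: le; rewrite !iE -!EFinD !lee_fin => le; lra.
have [N [mN N0 NF]] : ae_eq leb I11 (EFin \o q) (cst 0).
  apply/ae_eq_integral_abs => //; apply/measurable_EFinP; exact: measurable_funTS.
move=> u /andP[u1 u2]; rewrite !FE; congr EFin; apply/eqP; apply: contraT => neq.
(* By right-continuity the distribution functions differ on a whole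
   interval to the right of u. *)
have cvF (m : probability TR R) : F m (u + k.+1%:R^-1)%R @[k --> \oo] --> F m u.
  apply: fine_cvg; rewrite -FE; exact: right_continuous_ray.
have cvq : q (u + k.+1%:R^-1)%R @[k --> \oo] --> q u.
  rewrite /q; under eq_fun do rewrite expr2.
  by rewrite expr2; apply: cvgM; apply: cvgB; exact: cvF.
have mono (x y : R) : (x <= y)%R -> forall m : probability TR R, (F m x <= F m y)%R.
  move=> xy m; rewrite -lee_fin -!FE; apply: le_measure; rewrite ?inE.
  - exact: measurable_itv.
  - exact: measurable_itv.
  - by move=> z; rewrite /= !in_itv/= => /le_trans; exact.
have rc (m : probability TR R) (d : R) : (0 < d)%R -> exists2 h : R, (0 < h)%R &
    forall x, (u <= x <= u + h)%R -> (F m u <= F m x < F m u + d)%R.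
  move=> d0; have /cvgrPdist_lt /(_ _ d0) [k _ hk] := cvF m.
  exists (k.+1%:R^-1)%R => // x /andP[ux xk]; rewrite mono//=.
  apply: le_lt_trans (mono _ _ xk m) _.
  have := hk k (leqnn k); rewrite /= ltr_distlC => /andP[]; lra.
pose d := (`|F mu u - F nu u| / 2)%R.
have d0 : (0 < d)%R by rewrite divr_gt0// normr_gt0 subr_eq0.
have [h1 h10 H1] := rc mu d d0; have [h2 h20 H2] := rc nu d d0.
pose h := Num.min (Num.min h1 h2) (1 - u)%R.
have h0 : (0 < h)%R by rewrite !lt_min h10 h20 subr_gt0.
have sub : `[u, (u + h)%R]%classic `<=` N.
  move=> x /=; rewrite in_itv/= => /andP[ux xh]; apply: NF => /= /(_ _).
  have hh1 : (h <= h1)%R by rewrite /h !ge_min lexx.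
  have hh2 : (h <= h2)%R by rewrite /h !ge_min lexx ?orbT.
  have hh3 : (h <= 1 - u)%R by rewrite /h ge_min lexx orbT.
  have xI : x \in `[(-1)%R, 1%R] by rewrite in_itv/=; lra.
  move=> /(_ xI) [] /eqP; rewrite sqrf_eq0 subr_eq0 => /eqP FF.
  have a1 : (F mu u <= F mu x < F mu u + d)%R by apply: H1; lra.
  have a2 : (F nu u <= F nu x < F nu u + d)%R by apply: H2; lra.
  by apply: (@not_both_near R (F mu u) (F nu u) (F mu x)) => //; rewrite [F mu x]FF.
have : leb `[u, (u + h)%R] <= leb N by apply: le_measure; rewrite ?inE.
rewrite N0 /= lebesgue_measure_itv/= lte_fin ltrDl h0 -EFinB.
by rewrite addrAC subrr add0r lee_fin leNgt h0.
Qed.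

(** The tent part of the kernel is positive semidefinite, so the hypothesis
    is inherited by the part 1 - |x - y| / 2, for which it forces the
    distribution functions to agree. *)
Lemma energy_uniqueness mu nu : mu I11 = 1 -> nu I11 = 1 ->
  mutual_energy (@log_kernel R) mu mu < +oo ->
  mutual_energy (@log_kernel R) nu nu < +oo ->
  mutual_energy (@log_kernel R) mu mu + mutual_energy (@log_kernel R) nu nu <=
  mutual_energy (@log_kernel R) mu nu + mutual_energy (@log_kernel R) mu nu ->
  forall A, measurable A -> mu A = nu A.
Proof.
move=> mu1 nu1 fmu fnu le.
pose tent := @tent_kernel R.
pose M (xy : TR * TR) := \int[leb]_(u in I11) step2 (xy, u).
have mI : measurable I11 by exact: measurable_itv.
have mtent : measurable_fun setT tent by exact: measurable_tent_kernel.
have tent0 xy : 0 <= tent xy.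
  by apply: integral_ge0 => r _; apply: integral_ge0 => u _; exact: window2_ge0.
have mM : measurable_fun setT M.
  by apply: (@measurable_mix R _ TR leb I11 step2) => //; [exact: measurable_step2|exact: step2_ge0].
have M0 xy : 0 <= M xy by apply: integral_ge0 => u _; exact: step2_ge0.
have kE (m n : probability TR R) : m I11 = 1 -> n I11 = 1 ->
    mutual_energy (@log_kernel R) m n = mutual_energy M m n + mutual_energy tent m n.
  move=> m1 n1; rewrite /mutual_energy.
  have mi (k : TR * TR -> \bar R) : measurable_fun setT k -> (forall p, 0 <= k p) ->
      measurable_fun setT (fun x => \int[n]_y k (x, y)).
    by move=> mk k0; exact: (@measurable_fun_fubini_tonelli_F _ _ TR TR R n k).
  have mir (k : TR * TR -> \bar R) x : measurable_fun setT k -> measurable_fun setT (fun y => k (x, y)).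
    by move=> mk; exact: measurable_fun_pair2.
  have mlk := @measurable_log_kernel R; have lk0 := @log_kernel_ge0 R.
  rewrite -ge0_integralD//; last 4 first.
  - by move=> x _; exact: integral_ge0.
  - exact: mi.
  - by move=> x _; exact: integral_ge0.
  - exact: mi.
  rewrite (integral_concentrated mI m1); last exact: mi.
  rewrite [RHS](integral_concentrated mI m1); last by apply: emeasurable_funD; exact: mi.
  apply: eq_integral => x; rewrite inE/= in_itv/= => x1.
  have mMx := mir M x mM; have mtx := mir tent x mtent.
  transitivity (\int[n]_y (M (x, y) + tent (x, y))); last first.
    exact: (ge0_integralD n measurableT (fun y _ => M0 (x, y)) mMx (fun y _ => tent0 (x, y)) mtx).
  rewrite [LHS](integral_concentrated mI n1); last exact: mir.
  rewrite [RHS](integral_concentrated mI n1); last by apply: emeasurable_funD; exact: mir.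
  apply: eq_integral => y; rewrite inE/= in_itv/= => y1.
  by rewrite log_kernel_decomposition// /M integral_step2.
have psd : mutual_energy tent mu nu + mutual_energy tent mu nu <=
    mutual_energy tent mu mu + mutual_energy tent nu nu := @psd_tent_kernel R mu nu.
have E0 (k : TR * TR -> \bar R) (m n : probability TR R) : (forall p, 0 <= k p) -> 0 <= mutual_energy k m n by exact: mutual_energy_ge0.
have Mle : mutual_energy M mu mu + mutual_energy M nu nu <=
    mutual_energy M mu nu + mutual_energy M mu nu.
  move: le psd fmu fnu; rewrite !kE//.
  by apply: cancel_tent; exact: E0.
have step_mix m n : mutual_energy M m n =
    \int[leb]_(u in I11) mutual_energy (fun xy => step2 (xy, u)) m n.
  apply: (@mutual_energy_mix R _ TR leb I11 step2) => //; first exact: measurable_step2.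
  exact: step2_ge0.
rewrite !step_mix in Mle.
have cdf := cdf_eq_of_energy Mle.
have muT : mu setT < +oo by apply: le_lt_trans (probability_le1 mu measurableT) _; rewrite ltry.
apply: (measure_eq_on_rays muT).
move=> r.
have muC (m : probability TR R) : m I11 = 1 -> m (~` I11) = 0 by move=> m1; rewrite probability_setC// m1 subee.
have [r1|r1] := ltP r (-1)%R.
  have z (m : probability TR R) : m I11 = 1 -> m `]-oo, r]%classic = 0.
    move=> /muC m0; apply/eqP; rewrite eq_le measure_ge0 andbT -m0.
    apply: le_measure; rewrite ?inE; [exact: measurable_itv|exact: measurableC|].
    move=> x /=; rewrite in_itv/= => xr; rewrite in_itv/= => /andP[x1 _].
    by move: (le_lt_trans (le_trans x1 xr) r1); rewrite ltxx.
  exact: (etrans (z mu mu1) (esym (z nu nu1))).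
have [r2|r2] := ltP r 1%R; first by apply: cdf; rewrite r1.
have z (m : probability TR R) : m I11 = 1 -> m `]-oo, r]%classic = 1.
  move=> m1; apply/eqP; rewrite eq_le probability_le1/=; last exact: measurable_itv.
  rewrite -m1; apply: le_measure; rewrite ?inE; [exact: mI|exact: measurable_itv|].
  by move=> x /=; rewrite !in_itv/= => /andP[_ /le_trans]; exact.
exact: (etrans (z mu mu1) (esym (z nu nu1))).
Qed.

End energy_uniqueness.

(** * Complete elliptic integrals *)

Section real_integrals.
Context (R : realType).
Local Notation leb := (@lebesgue_measure R).
Implicit Types (f F : R -> R) (a b : R).

Lemma cont_on_within f a b : (forall x, x \in `[a, b] -> cont_at f x) ->
  {within `[a, b], continuous f}.
Proof. by move=> cf; apply: continuous_in_subspaceT => x; rewrite inE/=; exact: cf. Qed.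

Lemma cont_on_integrable f a b : (forall x, x \in `[a, b] -> cont_at f x) ->
  leb.-integrable `[a, b] (EFin \o f).
Proof.
move=> cf; apply: continuous_compact_integrable; first exact: segment_compact.
exact: cont_on_within.
Qed.

Lemma EFin_Rintegral f (A : set R) : measurable (A : set (measurableTypeR R)) ->
  leb.-integrable A (EFin \o f) ->
  (\int[leb]_(x in A) f x)%:E = (\int[leb]_(x in A) (f x)%:E)%E.
Proof. by move=> mA fi; rewrite fineK//; exact: integrable_fin_num. Qed.

Lemma FTC_segment F f a b : a <= b ->
  (forall x, x \in `[a, b] -> is_derive (x : R) (1 : R) F (f x)) ->
  (forall x, x \in `[a, b] -> cont_at f x) ->
  (\int[leb]_(x in `[a, b]) (f x)%:E = (F b - F a)%:E)%E.
Proof.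
rewrite le_eqVlt => /predU1P[<- _ _|ab dF cf].
  by rewrite set_itv1 integral_set1 subrr.
have aab : a \in `[a, b] by rewrite in_itv/= lexx ltW.
have bab : b \in `[a, b] by rewrite in_itv/= lexx ltW.
rewrite (continuous_FTC2 ab (F := F)) ?EFinB//.
- exact: cont_on_within.
- split.
  + by move=> x /subset_itv_oo_cc xab; have [] := dF x xab.
  + exact: (cvg_at_right_filter (der_continuous (dF _ aab))).
  + exact: (cvg_at_left_filter (der_continuous (dF _ bab))).
- by move=> x /subset_itv_oo_cc xab; rewrite derive1E; apply: derive_val; exact: dF.
Qed.

Lemma RFTC_segment F f a b : a <= b ->
  (forall x, x \in `[a, b] -> is_derive (x : R) (1 : R) F (f x)) ->
  (forall x, x \in `[a, b] -> cont_at f x) ->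
  \int[leb]_(x in `[a, b]) f x = F b - F a.
Proof. by move=> ab dF cf; rewrite /Rintegral (FTC_segment ab dF cf). Qed.

(** The square root is Hoelder continuous of exponent 1/2 up to 0; this
    gives the continuity of E on all of [0, 1], including the endpoint
    k = 1. *)
Lemma sqrt_dist (x y : R) : `|Num.sqrt x - Num.sqrt y| <= Num.sqrt `|x - y|.
Proof.
wlog xy : x y / y <= x.
  move=> H; case/orP: (le_total y x) => [|xy]; first exact: H.
  by rewrite distrC (distrC x); exact: H.
rewrite (@ger0_norm _ (x - y)) ?subr_ge0//.
rewrite (@ger0_norm _ (Num.sqrt x - Num.sqrt y)) ?subr_ge0 ?ler_wsqrtr//.
have [y0|y0] := leP y 0.
  rewrite (ler0_sqrtr y0) subr0; apply: ler_wsqrtr; lra.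
have x0 : 0 <= x by lra.
have xy0 : 0 <= x - y by lra.
rewrite lerBlDr -(@ler_pXn2r _ 2) ?nnegrE ?addr_ge0 ?sqrtr_ge0//.
rewrite sqrrD !sqr_sqrtr//; last exact: ltW.
by have := mulr_ge0 (sqrtr_ge0 (x - y)) (sqrtr_ge0 y); lra.
Qed.

End real_integrals.

Section elliptic.
Context (R : realType).
Local Notation leb := (@lebesgue_measure R).
Local Notation H := (`[0, (pi : R) / 2]%classic).
Implicit Types (k t a y : R).

Definition ellD k t : R := Num.sqrt (1 - k ^+ 2 * sin t ^+ 2).

Let pi2_ge0 : 0 <= (pi : R) / 2.
Proof. by rewrite divr_ge0// pi_ge0. Qed.

Lemma sin2_le1 t : sin t ^+ 2 <= 1.
Proof. by rewrite -(cos2Dsin2 t) lerDr sqr_ge0. Qed.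

Lemma ellD_arg_gt0 k t : 0 <= k < 1 -> 1 - k ^+ 2 <= 1 - k ^+ 2 * sin t ^+ 2 /\
  0 < 1 - k ^+ 2.
Proof.
move=> /andP[k0 k1]; have := sin2_le1 t; have := sqr_ge0 (sin t); split; nra.
Qed.

Lemma ellD_gt0 k t : 0 <= k < 1 -> 0 < ellD k t.
Proof. by move=> /(ellD_arg_gt0 t)[h1 h2]; rewrite sqrtr_gt0 (lt_le_trans h2). Qed.

Lemma ellD_ge k t : 0 <= k < 1 -> Num.sqrt (1 - k ^+ 2) <= ellD k t.
Proof. by move=> /(ellD_arg_gt0 t)[h1 h2]; rewrite ler_wsqrtr. Qed.

Lemma ellD_le1 k t : ellD k t <= 1.
Proof.
rewrite -[leRHS]sqrtr1 ler_wsqrtr// gerBl; apply: mulr_ge0; exact: sqr_ge0.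
Qed.

Lemma sqr_ellD k t : 0 <= k <= 1 -> ellD k t ^+ 2 = 1 - k ^+ 2 * sin t ^+ 2.
Proof.
move=> /andP[k0 k1]; rewrite sqr_sqrtr//.
have := sin2_le1 t; have := sqr_ge0 (sin t); nra.
Qed.

Lemma cont_ellD k t : cont_at (ellD k) t.
Proof. by rewrite /ellD; cont_rules. Qed.

Lemma integral_sin2 : \int[leb]_(t in H) (sin t ^+ 2) = pi / 4 :> R.
Proof.
have dF t : t \in `[0, (pi : R) / 2] ->
    is_derive (t : R) (1 : R) (fun t => t / 2 - sin t * cos t / 2) (sin t ^+ 2).
  move=> _; eapply is_derive_eq; first by derive_rules.
  by rewrite /=; have := cos2Dsin2 t; lra.
rewrite (RFTC_segment pi2_ge0 dF); last by move=> t _; cont_rules.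
by rewrite sin0 sin_pihalf cos_pihalf; field.
Qed.

Lemma Rintegral_cst_pihalf (c : R) : \int[leb]_(t in H) c = c * (pi / 2).
Proof.
rewrite Rintegral_cst// /= lebesgue_measure_itv/= lte_fin divr_gt0 ?pi_gt0//.
by rewrite -EFinB/= subr0.
Qed.

Lemma ellE0 : ellE 0 = pi / 2 :> R.
Proof.
rewrite /ellE -[RHS]mul1r -Rintegral_cst_pihalf; apply: eq_Rintegral => t _.
by rewrite expr0n/= mul0r subr0 sqrtr1.
Qed.

Lemma ellE1 : ellE 1 = 1 :> R.
Proof.
rewrite /ellE; transitivity (\int[leb]_(t in H) (cos t : R)).
  apply: eq_Rintegral => t; rewrite inE/= in_itv/= => /andP[t0 t1].
  rewrite expr1n mul1r -cos2sin2 sqrtr_sqr ger0_norm//.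
  by apply: cos_ge0_pihalf; rewrite t1 andbT (le_trans _ t0)// oppr_le0.
rewrite (RFTC_segment (F := sin) pi2_ge0); first by rewrite sin0 sin_pihalf subr0.
by move=> t _; exact: continuous_cos.
Qed.

(** The difference of the integrands times their sum, which is at most 2, is
    (k'^2 - k^2) sin^2 t. Besides strict monotonicity, the case k = 0,
    k' = 1 yields 2 < pi. *)
Lemma ellE_decr k k' : 0 <= k -> k <= k' -> k' <= 1 ->
  (k' ^+ 2 - k ^+ 2) * (pi / 8) <= ellE k - ellE k' :> R.
Proof.
move=> k0 kk k1.
have ci q : leb.-integrable H (EFin \o ellD q).
  by apply: cont_on_integrable => t _; exact: cont_ellD.
rewrite /ellE -RintegralB//; [|exact: ci|exact: ci].
rewrite (_ : _ * (pi / 8) = \int[leb]_(t in H) ((k' ^+ 2 - k ^+ 2) / 2 * sin t ^+ 2)); last first.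
  rewrite RintegralZl//; first by rewrite integral_sin2; field.
  by apply: cont_on_integrable => t _; cont_rules.
apply: le_Rintegral => //.
- by apply: cont_on_integrable => t _; cont_rules.
- by apply: cont_on_integrable => t _; apply: contD; [|apply: contN]; exact: cont_ellD.
move=> t _.
have := @sqr_ellD k t; have := @sqr_ellD k' t; rewrite -/(ellD k t) -/(ellD k' t).
rewrite k0 k1 (le_trans kk k1) (le_trans k0 kk) => /(_ isT) e' /(_ isT) e.
have := ellD_le1 k t; have := ellD_le1 k' t.
have : 0 <= ellD k t by exact: sqrtr_ge0.
have : 0 <= ellD k' t by exact: sqrtr_ge0.
move: e e'; set x := ellD k t; set z := ellD k' t; move=> e e' z0 x0 z1 x1.
have zx : z <= x.
  rewrite -(@ler_pXn2r _ 2)// ?nnegrE// e e'.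
  have := sqr_ge0 (sin t); have : k ^+ 2 <= k' ^+ 2 by rewrite ler_pXn2r ?nnegrE// (le_trans k0).
  nra.
have -> : (k' ^+ 2 - k ^+ 2) / 2 * sin t ^+ 2 = (x ^+ 2 - z ^+ 2) / 2 by rewrite e e'; field.
rewrite subr_sqr; nra.
Qed.

Lemma ellE_continuous k : cont_at (@ellE R) k.
Proof.
have ci q : leb.-integrable H (EFin \o ellD q).
  by apply: cont_on_integrable => t _; exact: cont_ellD.
have bound q : `|ellE k - ellE q| <= pi / 2 * Num.sqrt `|q ^+ 2 - k ^+ 2|.
  rewrite /ellE -RintegralB//; [|exact: ci|exact: ci].
  have cD : leb.-integrable H (EFin \o (fun t => ellD k t - ellD q t)).
    by apply: cont_on_integrable => t _; apply: contD; [|apply: contN]; exact: cont_ellD.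
  apply: (le_trans (le_normr_Rintegral _ _)) => //.
  apply: (@le_trans _ _ (\int[leb]_(t in H) Num.sqrt `|q ^+ 2 - k ^+ 2|)).
    apply: le_Rintegral => //.
    - exact: integrable_norm.
    - by apply: cont_on_integrable => t _; exact: contC.
    move=> t _; apply: (le_trans (sqrt_dist _ _)); apply: ler_wsqrtr.
    have -> : 1 - k ^+ 2 * sin t ^+ 2 - (1 - q ^+ 2 * sin t ^+ 2) = (q ^+ 2 - k ^+ 2) * sin t ^+ 2 by ring.
    by rewrite normrM ler_piMr// ger0_norm ?sqr_ge0// sin2_le1.
  by rewrite Rintegral_cst_pihalf mulrC.
rewrite /cont_at; apply/cvgrPdist_le => e e0.
have c : cont_at (fun q => pi / 2 * Num.sqrt `|q ^+ 2 - k ^+ 2|) k.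
  apply: contM; first exact: contC.
  apply: cont_sqrt; apply: (@cont_comp _ _ Num.norm); first exact: norm_continuous.
  by cont_rules.
move: c; rewrite /cont_at => /cvgrPdist_le /(_ _ e0); apply: filterS => q.
rewrite subrr normr0 sqrtr0 mulr0 sub0r normrN => h.
by apply: le_trans (bound q) _; apply: le_trans h; rewrite ler_norm.
Qed.

(** E decreases continuously from pi / 2 to 1 on [0, 1]. *)
Lemma ellE_solution tau : 2 / (pi - 2) < tau ->
  exists b : R, [/\ 0 < b < 1, ellE b = tau^-1 + 1,
    (forall k, 0 <= k <= 1 -> ellE k = tau^-1 + 1 -> k = b)
    & 1 < tau^-1 + 1 < pi / 2].
Proof.
move=> tau2.
have pi2 : 0 < pi - 2 :> R by have := @ellE_decr 0 1 (lexx _) ler01 (lexx _);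
  rewrite ellE0 ellE1 expr1n expr0n/=; lra.
have tau0 : 0 < tau by apply: lt_trans tau2; rewrite divr_gt0.
have t1 : 1 < tau^-1 + 1 by rewrite ltrDr invr_gt0.
have t2 : tau^-1 + 1 < pi / 2.
  have : tau^-1 < (2 / (pi - 2))^-1 by rewrite ltf_pV2 ?posrE// divr_gt0.
  rewrite invf_div; lra.
have inj k k' : 0 <= k -> k < k' -> k' <= 1 -> ellE k' < ellE k.
  move=> k0 kk k1; rewrite -subr_gt0; apply: lt_le_trans (ellE_decr k0 (ltW kk) k1).
  by rewrite mulr_gt0 ?divr_gt0 ?pi_gt0// subr_gt0 ltr_pXn2r ?nnegrE// ltW// (le_lt_trans k0).
have [b bI bE] : exists2 b, b \in `[0, 1] & ellE b = tau^-1 + 1.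
  apply: IVT => //; first by apply: cont_on_within => x _; exact: ellE_continuous.
  by rewrite ge_min le_max ellE0 ellE1 (ltW t1) (ltW t2) orbT.
move: bI; rewrite in_itv/= => /andP[b0 b1].
exists b; split=> //.
- rewrite !lt_neqAle b0 b1 !andbT; apply/andP; split.
  + by apply/eqP => b00; move: bE t2; rewrite -b00 ellE0 => ->; rewrite ltxx.
  + by apply/eqP => b11; move: bE t1; rewrite b11 ellE1 => <-; rewrite ltxx.
- move=> k /andP[k0 k1] kE.
  have [kb|bk|//] := ltgtP k b.
  + by have := inj _ _ k0 kb b1; rewrite kE bE ltxx.
  + by have := inj _ _ b0 bk k1; rewrite kE bE ltxx.
- by rewrite t1.
Qed.

(** This is - E'(k). Defining it by its integral and integrating it back
    ([integral_ell_e]) avoids differentiation under the integral sign. *)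
Definition ell_e k : R := \int[leb]_(t in H) (k * sin t ^+ 2 / ellD k t).

Lemma ell_e_ge0 k : 0 <= k -> 0 <= ell_e k.
Proof.
move=> k0; apply: Rintegral_ge0 => t _.
by rewrite mulr_ge0 ?invr_ge0 ?sqrtr_ge0// mulr_ge0// sqr_ge0.
Qed.

Lemma measurable_ellD (D : set (measurableTypeR R * measurableTypeR R)) :
  measurable_fun D (fun p : measurableTypeR R * measurableTypeR R => ellD p.1 p.2).
Proof. by rewrite /ellD; meas_rules. Qed.

(** By Fubini: for fixed t, the integrand is the derivative in q
    of - sqrt(1 - q^2 sin^2 t). *)
Lemma integral_ell_e k : 0 <= k < 1 ->
  \int[leb]_(q in `[0, k]) ell_e q = ellE 0 - ellE k.
Proof.
move=> k01; have /andP[k0 k1] := k01.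
rewrite /ell_e (@Rfubini_bounded R 0 k 0 (pi / 2) (Num.sqrt (1 - k ^+ 2))^-1
  (fun p => p.1 * sin p.2 ^+ 2 / ellD p.1 p.2)); first last.
- move=> q t; rewrite !in_itv/= => /andP[q0 qk] _.
  have q01 : 0 <= q < 1 by rewrite q0 (le_lt_trans qk).
  have D0 := ellD_gt0 t q01.
  have [_ s0] := ellD_arg_gt0 t k01.
  rewrite ger0_norm; last by rewrite mulr_ge0 ?invr_ge0 ?(ltW D0)// mulr_ge0// sqr_ge0.
  rewrite -[leRHS]mul1r; apply: ler_pM.
  + by rewrite mulr_ge0// sqr_ge0.
  + by rewrite invr_ge0 ltW.
  + by rewrite mulr_ile1// ?sqr_ge0 ?sin2_le1// ltW// (le_lt_trans qk).
  + have le1 : Num.sqrt (1 - k ^+ 2) <= ellD q t.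
      apply: le_trans (ellD_ge t q01).
      by apply: ler_wsqrtr; rewrite lerB// ler_pXn2r ?nnegrE.
    by rewrite lef_pV2 ?posrE// sqrtr_gt0.
- apply: measM; first by meas_rules.
  apply: measV; exact: measurable_ellD.
rewrite /ellE -RintegralB//; [|by apply: cont_on_integrable => t _; exact: cont_ellD..].
apply: eq_Rintegral => t _ /=.
have dF q : q \in `[0, k] -> is_derive (q : R) (1 : R) (fun q => - ellD q t) (q * sin t ^+ 2 / ellD q t).
  rewrite in_itv/= => /andP[q0 qk].
  have q01 : 0 <= q < 1 by rewrite q0 (le_lt_trans qk).
  have D0 := ellD_gt0 t q01.
  have [h1 h2] := ellD_arg_gt0 t q01.
  have arg0 := lt_le_trans h2 h1.
  eapply is_derive_eq; first by rewrite /ellD; derive_rules.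
  by rewrite /= -/(ellD q t); field; rewrite gt_eqF.
rewrite (RFTC_segment k0 dF); first by rewrite opprK addrC.
move=> q; rewrite in_itv/= => /andP[q0 qk].
have q01 : 0 <= q < 1 by rewrite q0 (le_lt_trans qk).
have D0 := ellD_gt0 t q01.
by rewrite /ellD; cont_rules; rewrite gt_eqF.
Qed.

Lemma ellI_bounds a k : 0 <= a -> 0 <= k < 1 -> 0 <= ellI a k <= (pi / 2) / Num.sqrt (1 - k ^+ 2).
Proof.
move=> a0 k01.
have [_ s0] := ellD_arg_gt0 0 k01.
have h t : 0 < a + ellD k t by rewrite ltr_wpDl// ellD_gt0.
apply/andP; split.
  by apply: Rintegral_ge0 => t _; rewrite invr_ge0; apply/ltW; exact: h.
rewrite /ellI [leRHS]mulrC -Rintegral_cst_pihalf; apply: le_Rintegral => //.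
- apply: cont_on_integrable => t _; apply: contV; first by apply/lt0r_neq0; exact: h.
  by apply: contD; [exact: contC|exact: cont_ellD].
- by apply: cont_on_integrable => t _; exact: contC.
- move=> t _; rewrite lef_pV2 ?posrE ?sqrtr_gt0//; last exact: h.
  by apply: le_trans (ellD_ge t k01) _; rewrite lerDr.
Qed.

(** Minus the derivative in k of sqrt(y^2 - k^2) / (a + D), where
    D = sqrt(1 - k^2 sin^2 t) and p = (k, t). *)
Let weight_derivative a y (p : measurableTypeR R * measurableTypeR R) : R :=
  p.1 / (Num.sqrt (y ^+ 2 - p.1 ^+ 2) * (a + ellD p.1 p.2)) -
  Num.sqrt (y ^+ 2 - p.1 ^+ 2) * (p.1 * sin p.2 ^+ 2) / (ellD p.1 p.2 * (a + ellD p.1 p.2) ^+ 2).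

(** With s = sqrt(y^2 - k^2) and D = sqrt(1 - k^2 sin^2 t), the two
    integrands differ by the derivative in t of k sin t cos t / ((a + D) s),
    which vanishes at 0 and at pi / 2. *)
Let integral_weight_derivative a y k : 0 < y < 1 -> a ^+ 2 = 1 - y ^+ 2 -> 0 < a -> 0 <= k < y ->
  \int[leb]_(t in H) weight_derivative a y (k, t) = ell_e k / Num.sqrt (y ^+ 2 - k ^+ 2).
Proof.
move=> /andP[y0 y1] a2 a0 /andP[k0 ky].
have k01 : 0 <= k < 1 by rewrite k0 (lt_trans ky).
have s0 : 0 < Num.sqrt (y ^+ 2 - k ^+ 2).
  by rewrite sqrtr_gt0 subr_gt0 ltr_pXn2r ?nnegrE// ltW.
have s2 : Num.sqrt (y ^+ 2 - k ^+ 2) ^+ 2 = y ^+ 2 - k ^+ 2.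
  by rewrite sqr_sqrtr// ltW// -sqrtr_gt0.
set s := Num.sqrt _ in s0 s2 *.
have D0 t := ellD_gt0 t k01.
have k01' : 0 <= k <= 1 by rewrite k0 ltW// (lt_trans ky).
have D2 t := @sqr_ellD k t k01'.
have aD t : 0 < a + ellD k t by rewrite addr_gt0.
have cZ t : cont_at (fun t => weight_derivative a y (k, t)) t.
  rewrite /weight_derivative /= -/s; have := @cont_ellD k t => cD.
  by apply: contD; last apply: contN; apply: contM; cont_rules => //;
    rewrite ?mulf_neq0 ?expf_neq0// ?gt_eqF.
pose G t := k * sin t ^+ 2 / ellD k t.
have cG t : cont_at G t.
  by rewrite /G; have := @cont_ellD k t => cD; cont_rules; rewrite ?gt_eqF.
have -> : ell_e k / s = \int[leb]_(t in H) (G t / s).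
  by rewrite RintegralZr//; apply: cont_on_integrable => t _; exact: cG.
apply/eqP; rewrite -subr_eq0 -RintegralB//; last 2 first.
- by apply: cont_on_integrable => t _; exact: cZ.
- apply: cont_on_integrable => t _; apply: contM; [exact: cG|exact: contC].
pose W t := k * (sin t * cos t) / ((a + ellD k t) * s).
have dF t : t \in `[0, (pi : R) / 2] ->
    is_derive (t : R) (1 : R) W (weight_derivative a y (k, t) - G t / s).
  move=> _.
  have [h1 h2] := ellD_arg_gt0 t k01.
  have arg0 := lt_le_trans h2 h1.
  have aD0 : (a + ellD k t) * s != 0 by rewrite mulf_neq0// gt_eqF.
  eapply is_derive_eq; first by rewrite /W /ellD; derive_rules.
  rewrite /weight_derivative /G /= -/s -/(ellD k t).
  have D2t := D2 t; have c2 := cos2Dsin2 t; have D0t := D0 t; have aDt := aD t.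
  move: (ellD k t) (sin t) (cos t) D2t c2 D0t aDt => d x c D2t c2 D0t aDt.
  have e1 : a ^+ 2 + s ^+ 2 + k ^+ 2 - 1 = 0 by rewrite a2 s2; ring.
  have e3 : d ^+ 2 + k ^+ 2 * x ^+ 2 - 1 = 0 by rewrite D2t; ring.
  have e4 : c ^+ 2 + x ^+ 2 - 1 = 0 by rewrite c2 subrr.
  (* The identity only holds modulo the relations e1, e3 and e4; the
     multiple of them added here turns it into an identity of rational
     functions. *)
  have -> : k / (s * (a + d)) - s * (k * x ^+ 2) / (d * (a + d) ^+ 2) - k * x ^+ 2 / d / s =
     k / (s * (a + d)) - s * (k * x ^+ 2) / (d * (a + d) ^+ 2) - k * x ^+ 2 / d / s +
     k * (x ^+ 2 * ((a ^+ 2 + s ^+ 2 + k ^+ 2 - 1) - (d ^+ 2 + k ^+ 2 * x ^+ 2 - 1)) +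
       (c ^+ 2 + x ^+ 2 - 1) * (d * (a + d) + k ^+ 2 * x ^+ 2)) / (s * d * (a + d) ^+ 2).
    by rewrite e1 e3 e4 subrr mul0r mulr0 addr0 mulr0 mul0r addr0.
  by field; rewrite !gt_eqF.
rewrite (RFTC_segment pi2_ge0 dF).
  by rewrite /W cos_pihalf sin0 !(mulr0, mul0r) subrr.
move=> t _; apply: contD; [exact: cZ|apply: contN; apply: contM; [exact: cG|exact: contC]].
Qed.

(** The integrand is an integral over t by [integral_weight_derivative];
    after Fubini, the integral in q is immediate because the integrand is a
    derivative in q. *)
Lemma integral_ell_e_weight a y (k : R) : 0 < y < 1 -> a ^+ 2 = 1 - y ^+ 2 -> 0 < a -> 0 <= k < y ->
  \int[leb]_(q in `[0, k]) (ell_e q / Num.sqrt (y ^+ 2 - q ^+ 2)) =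
  y * (pi / 2) / (1 + a) - Num.sqrt (y ^+ 2 - k ^+ 2) * ellI a k.
Proof.
move=> y01 a2 a0 /andP[k0 ky]; have /andP[y0 y1] := y01.
have k1 := lt_trans ky y1.
have kk01 : 0 <= k < 1 by rewrite k0.
have sk0 : 0 < Num.sqrt (y ^+ 2 - k ^+ 2).
  by rewrite sqrtr_gt0 subr_gt0 ltr_pXn2r ?nnegrE// ltW.
have [_ rk0] := ellD_arg_gt0 0 kk01.
have hq q : q \in `[0, k] -> [/\ 0 <= q < y, 0 <= q < 1,
    Num.sqrt (y ^+ 2 - k ^+ 2) <= Num.sqrt (y ^+ 2 - q ^+ 2),
    0 < Num.sqrt (y ^+ 2 - q ^+ 2) & q ^+ 2 <= k ^+ 2].
  rewrite in_itv/= => /andP[q0 qk]; have qy := le_lt_trans qk ky.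
  have le : Num.sqrt (y ^+ 2 - k ^+ 2) <= Num.sqrt (y ^+ 2 - q ^+ 2).
    by apply: ler_wsqrtr; rewrite lerB// ler_pXn2r ?nnegrE.
  split => //; rewrite ?q0 ?qy ?(lt_trans qy y1)//; first exact: lt_le_trans le.
  by rewrite ler_pXn2r ?nnegrE.
transitivity (\int[leb]_(q in `[0, k]) \int[leb]_(t in H) weight_derivative a y (q, t)).
  apply: eq_Rintegral => q; rewrite inE/= => /hq[qy _ _ _ _].
  by rewrite integral_weight_derivative.
have sy1 q : Num.sqrt (y ^+ 2 - q ^+ 2) <= 1.
  rewrite -[leRHS]sqrtr1; apply: ler_wsqrtr.
  have : y ^+ 2 <= 1 by rewrite expr_le1// ltW.
  by have := sqr_ge0 q; lra.
rewrite (@Rfubini_bounded R 0 k 0 (pi / 2)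
  ((Num.sqrt (y ^+ 2 - k ^+ 2) * a)^-1 + (Num.sqrt (1 - k ^+ 2) * a ^+ 2)^-1)); first last.
- move=> q t /hq[qy q01 sle s0 q2] _; rewrite /weight_derivative /=.
  have D0 := ellD_gt0 t q01.
  have Dk : Num.sqrt (1 - k ^+ 2) <= ellD q t.
    by apply: le_trans (ellD_ge t q01); apply: ler_wsqrtr; rewrite lerB.
  have /andP[q0 q1] := q01.
  have aD : a <= a + ellD q t by rewrite lerDl ltW.
  have aD0 : 0 < a + ellD q t by rewrite addr_gt0.
  have sD0 : 0 < Num.sqrt (1 - k ^+ 2) by rewrite sqrtr_gt0.
  apply: (le_trans (ler_normB _ _)); apply: lerD.
    rewrite ger0_norm; last by rewrite mulr_ge0 ?invr_ge0// mulr_ge0// ltW.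
    rewrite -[leRHS]mul1r; apply: ler_pM => //.
    + by rewrite invr_ge0 mulr_ge0// ltW.
    + exact: ltW.
    + rewrite lef_pV2 ?posrE ?mulr_gt0//; apply: ler_pM => //; exact: ltW.
  rewrite ger0_norm; last first.
    apply: mulr_ge0; first by rewrite mulr_ge0 ?sqrtr_ge0// mulr_ge0// sqr_ge0.
    by rewrite invr_ge0; exact: (mulr_ge0 (ltW D0) (sqr_ge0 _)).
  rewrite -[leRHS]mul1r; apply: ler_pM.
  + by rewrite mulr_ge0 ?sqrtr_ge0// mulr_ge0// sqr_ge0.
  + by rewrite invr_ge0; exact: (mulr_ge0 (ltW D0) (sqr_ge0 _)).
  + rewrite mulr_ile1 ?sqrtr_ge0 ?sy1//; first by rewrite mulr_ge0// sqr_ge0.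
    by rewrite mulr_ile1 ?sqr_ge0 ?sin2_le1// ltW.
  + rewrite lef_pV2 ?posrE ?mulr_gt0 ?exprn_gt0//; apply: ler_pM => //.
    * exact: sqr_ge0.
    * by rewrite ler_pXn2r ?nnegrE// ltW.
- by rewrite /weight_derivative /ellD; meas_rules.
transitivity (\int[leb]_(t in H) (y / (1 + a) - Num.sqrt (y ^+ 2 - k ^+ 2) * (a + ellD k t)^-1)).
  apply: eq_Rintegral => t _ /=.
  have dF q : q \in `[0, k] -> is_derive (q : R) (1 : R)
      (fun q => - (Num.sqrt (y ^+ 2 - q ^+ 2) / (a + ellD q t))) (weight_derivative a y (q, t)).
    move=> /hq[qy q01 sle s0 q2].
    have D0 := ellD_gt0 t q01.
    have [h1 h2] := ellD_arg_gt0 t q01.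
    have arg0 := lt_le_trans h2 h1.
    have s0' : 0 < y ^+ 2 - q ^+ 2 by rewrite -sqrtr_gt0.
    have aD0 : 0 < a + ellD q t by rewrite addr_gt0.
    eapply is_derive_eq; first by rewrite /ellD; derive_rules; rewrite // gt_eqF.
    rewrite /weight_derivative /= -/(ellD q t).
    move: (Num.sqrt (y ^+ 2 - q ^+ 2)) s0 => s s0.
    by field; rewrite !gt_eqF.
  rewrite (RFTC_segment k0 dF).
    rewrite /ellD !expr0n/= mul0r !subr0 sqrtr1 sqrtr_sqr gtr0_norm//.
    by rewrite opprK addrC (addrC a 1).
  move=> q /hq[qy q01 sle s0 q2].
  have D0 := ellD_gt0 t q01.
  have aD0 : 0 < a + ellD q t by rewrite addr_gt0.
  rewrite /weight_derivative /=.
  have cD : cont_at (fun q => ellD q t) q by rewrite /ellD; cont_rules.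
  by apply: contD; last apply: contN; apply: contM; cont_rules => //;
    rewrite ?mulf_neq0 ?expf_neq0// ?gt_eqF.
have cI t : cont_at (fun t => (a + ellD k t)^-1) t.
  have := @cont_ellD k t => cD; cont_rules => //.
  by rewrite gt_eqF// addr_gt0// ellD_gt0.
rewrite RintegralB//; last 2 first.
- by apply: cont_on_integrable => t _; exact: contC.
- by apply: cont_on_integrable => t _; apply: contM; [exact: contC|exact: cI].
rewrite Rintegral_cst_pihalf RintegralZl//; last first.
  by apply: cont_on_integrable => t _; exact: cI.
by congr (_ - _); ring.
Qed.

End elliptic.

(** * Arcsine laws of two intervals and the main identity *)

Section two_cut_parametrization.
Context (R : realType).
Local Notation leb := (@lebesgue_measure R).
Local Notation TR := (measurableTypeR R).
Local Notation H := (`[0, (pi : R) / 2]%classic).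
Implicit Types (k t y : R).

Lemma in_pihalf t : t \in `]0, (pi : R) / 2[ -> [/\ 0 < sin t, sin t < 1, 0 < cos t & cos t < 1].
Proof.
rewrite in_itv/= => /andP[t0 t1].
have p0 : 0 < (pi : R) by exact: pi_gt0.
have s0 : 0 < sin t by apply: sin_gt0_pi; rewrite t0/=; lra.
have c0 : 0 < cos t by apply: cos_gt0_pihalf; rewrite t1 andbT; lra.
have e := cos2Dsin2 t.
split => //.
- rewrite -(@ltr_pXn2r _ 2)// ?nnegrE ?(ltW s0)// expr1n -e.
  by rewrite ltrDr exprn_gt0.
- rewrite -(@ltr_pXn2r _ 2)// ?nnegrE ?(ltW c0)// expr1n -e.
  by rewrite ltrDl exprn_gt0.
Qed.

Lemma in_pihalf_cc t : t \in `[0, (pi : R) / 2] -> 0 <= sin t <= 1 /\ 0 <= cos t <= 1.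
Proof.
rewrite in_itv/= => /andP[t0 t1].
have p0 : 0 < (pi : R) by exact: pi_gt0.
split; apply/andP; split; rewrite ?sin_le1 ?cos_le1//.
- by apply: sin_ge0_pi; rewrite t0/=; lra.
- by apply: cos_ge0_pihalf; rewrite t1 andbT; lra.
Qed.

(** An angular parametrization y(t) of [k, 1] for which
    y^2 - k^2 = (1 - k^2) sin^2 t and 1 - y^2 = (1 - k^2) cos^2 t, so that
    the square roots singular at the ends of the cut become smooth. *)
Definition cutpar k t : R := Num.sqrt (k ^+ 2 * cos t ^+ 2 + sin t ^+ 2).

Lemma cutpar_arg k t : k ^+ 2 * cos t ^+ 2 + sin t ^+ 2 = k ^+ 2 + (1 - k ^+ 2) * sin t ^+ 2.
Proof. by rewrite cos2sin2; ring. Qed.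

Lemma sqr_cutpar k t : cutpar k t ^+ 2 = k ^+ 2 + (1 - k ^+ 2) * sin t ^+ 2.
Proof.
by rewrite sqr_sqrtr ?cutpar_arg// -cutpar_arg addr_ge0 ?sqr_ge0// mulr_ge0 ?sqr_ge0.
Qed.

Lemma cutpar_ge0 k t : 0 <= cutpar k t. Proof. exact: sqrtr_ge0. Qed.

Lemma cutpar_bounds k t : 0 <= k < 1 -> k <= cutpar k t <= 1.
Proof.
move=> /andP[k0 k1]; have k2 : k ^+ 2 <= 1 by rewrite expr_le1// ltW.
have s1 := @sin2_le1 R t; have s0 := sqr_ge0 (sin t).
apply/andP; split; rewrite -(@ler_pXn2r _ 2)// ?nnegrE ?cutpar_ge0// sqr_cutpar.
  by rewrite lerDl mulr_ge0// subr_ge0.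
by rewrite expr1n; nra.
Qed.

Lemma cont_cutpar k t : cont_at (cutpar k) t.
Proof. by rewrite /cutpar; cont_rules. Qed.

Lemma measurable_cutpar k (D : set TR) : measurable_fun D (cutpar k : TR -> R).
Proof. by rewrite /cutpar; meas_rules. Qed.

(** On [k, 1], half of the arcsine law of [-1, -k] U [k, 1] up to
    normalization. It is 0 for 0 <= y <= k since square roots of negative
    reals are 0. *)
Definition arc_density k y : R := y / (Num.sqrt (y ^+ 2 - k ^+ 2) * Num.sqrt (1 - y ^+ 2)).

Lemma measurable_arc_density1 k (D : set TR) :
  measurable_fun D (arc_density k : TR -> R).
Proof. by rewrite /arc_density; meas_rules. Qed.

Lemma arc_density_ge0 k y : 0 <= y -> 0 <= arc_density k y.
Proof. by move=> y0; rewrite mulr_ge0// invr_ge0 mulr_ge0// sqrtr_ge0. Qed.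

Lemma arc_density_cutpar k t : 0 <= k < 1 -> t \in `]0, (pi : R) / 2[ ->
  arc_density k (cutpar k t) = cutpar k t / ((1 - k ^+ 2) * sin t * cos t).
Proof.
move=> /andP[k0 k1] /in_pihalf[s0 s1 c0 c1]; rewrite /arc_density.
have k2 : k ^+ 2 <= 1 by rewrite expr_le1// ltW.
have r0 : 0 <= 1 - k ^+ 2 by rewrite subr_ge0.
have -> : cutpar k t ^+ 2 - k ^+ 2 = (1 - k ^+ 2) * sin t ^+ 2 by rewrite sqr_cutpar; ring.
have -> : 1 - cutpar k t ^+ 2 = (1 - k ^+ 2) * cos t ^+ 2 by rewrite sqr_cutpar cos2sin2; ring.
rewrite (sqrtrM (sin t ^+ 2) r0) (sqrtrM (cos t ^+ 2) r0) !sqrtr_sqr !gtr0_norm//.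
congr (_ / _); rewrite mulrACA -expr2 sqr_sqrtr//; ring.
Qed.

Local Open Scope ereal_scope.

(** The parametrization [cutpar] has derivative 1 / arc_density in the
    interior of the quarter turn. For k = 0 it is |sin t|, which is not
    differentiable at 0, so the substitution is made with sin instead. *)
Lemma integral_arc_density k (g : TR -> \bar R) : (0 <= k < 1)%R ->
  measurable_fun setT g -> (forall y, 0 <= g y) ->
  \int[leb]_(y in `[k, 1%R]) (g y * (arc_density k y)%:E) =
  \int[leb]_(t in H) g (cutpar k t).
Proof.
move=> /andP[k0 k1] mg g0.
have p0 : (0 < (pi : R) / 2)%R by rewrite divr_gt0// pi_gt0.
have k2 : (0 < 1 - k ^+ 2)%R by rewrite subr_gt0 expr_lt1.
pose h y := g y * (arc_density k `|y|)%:E.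
have mh : measurable_fun setT h.
  apply: emeasurable_funM => //; apply/measurable_EFinP.
  by rewrite /arc_density; meas_rules.
have h0 y : 0 <= h y by rewrite mule_ge0// lee_fin arc_density_ge0.
have hE y : y \in `[k, 1%R] -> h y = g y * (arc_density k y)%:E.
  by rewrite in_itv/= => /andP[ky _]; rewrite /h ger0_norm// (le_trans k0).
transitivity (\int[leb]_(y in `[k, 1%R]) h y).
  by apply: eq_integral => y; rewrite inE/= => /hE ->.
have sin_mono : {in `[0%R, (pi / 2)%R] &, {mono (@sin R) : x y / (x <= y)%R}}.
  move=> x y; rewrite !in_itv/= => /andP[x0 x1] /andP[y0 y1].
  apply: (le_mono_in (D := [pred x : R | x \in `[(- (pi / 2))%R, (pi / 2)%R]])).
  - by move=> u v u_ v_; rewrite ltr_sin.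
  - by rewrite inE in_itv/= x1 andbT; lra.
  - by rewrite inE in_itv/= y1 andbT; lra.
have fin h1 : (forall t, t \in `]0%R, ((pi : R) / 2)%R[ -> h1 t = g (cutpar k t)) ->
   measurable_fun `]0%R, (pi / 2)%R[ h1 ->
   \int[leb]_(t in H) h1 t = \int[leb]_(t in H) g (cutpar k t).
  move=> h1E mh1; rewrite integral_itv_bndoo// [RHS]integral_itv_bndoo.
    by apply: eq_integral => t; rewrite inE/= => /h1E.
  apply: measurable_funTS; apply: measurableT_comp => //; exact: measurable_cutpar.
have [k00|k00] := eqVneq k 0%R.
  have c0 t : t \in `[0%R, (pi / 2)%R] -> cutpar k t = sin t.
    move=> /in_pihalf_cc[/andP[s0 _] _].
    by rewrite /cutpar k00 expr0n/= mul0r add0r sqrtr_sqr ger0_norm.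
  have := @ge0_integral_subst R sin cos 0 (pi / 2) h p0 (@continuous_sin R) sin_mono.
  have sE : sin 0 = k :> R by rewrite sin0 k00.
  rewrite sE sin_pihalf => ->//; first last.
  - by move=> t /in_pihalf_cc[_ /andP[]].
  - by apply: continuous_subspaceT; exact: continuous_cos.
  apply: fin.
    move=> t tI; have [s0 s1 cs0 cs1] := in_pihalf tI.
    rewrite -c0; last exact: subset_itv_oo_cc.
    have sc : sin t = cutpar k t by rewrite c0//; exact: subset_itv_oo_cc.
    rewrite /h ger0_norm ?cutpar_ge0// arc_density_cutpar ?lexx ?k0 ?k1//.
    rewrite -muleA -EFinM -sc k00 expr0n/= subr0 mul1r.
    rewrite (_ : (_ * _)%R = 1%R) ?mule1//; field; rewrite !gt_eqF//.
  apply: measurable_funTS; apply: emeasurable_funM.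
    apply: (measurableT_comp mh); apply: continuous_measurable_fun; exact: continuous_sin.
  by apply/measurable_EFinP; apply: continuous_measurable_fun; exact: continuous_cos.
have kp : (0 < k)%R by rewrite lt_neqAle eq_sym k00.
pose F' t := ((1 - k ^+ 2) * (sin t * cos t) / cutpar k t)%R.
have cp0 t : (0 < cutpar k t)%R.
  rewrite sqrtr_gt0 cutpar_arg; apply: ltr_pwDl; first by rewrite exprn_gt0.
  by rewrite mulr_ge0 ?sqr_ge0// ltW.
have dC t : t \in `]0%R, (pi / 2)%R[ -> is_derive (t : R) (1%R : R) (cutpar k) (F' t).
  move=> _; have := cp0 t; rewrite sqrtr_gt0 => arg0.
  eapply is_derive_eq; first by rewrite /cutpar; derive_rules.
  by rewrite /F' /= -/(cutpar k t); have := cp0 t => c0; field; rewrite gt_eqF.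
have monoC : {in `[0%R, (pi / 2)%R] &, {mono (cutpar k) : x y / (x <= y)%R}}.
  move=> x y xI yI.
  rewrite -(@ler_pXn2r _ 2)// ?nnegrE ?cutpar_ge0// !sqr_cutpar lerD2l ler_pM2l//.
  have [/andP[sx _] _] := in_pihalf_cc xI; have [/andP[sy _] _] := in_pihalf_cc yI.
  by rewrite ler_pXn2r ?nnegrE// sin_mono.
have := @ge0_integral_subst R (cutpar k) F' 0 (pi / 2) h p0 (@cont_cutpar k) monoC dC.
have -> : cutpar k 0 = k.
  by rewrite /cutpar cos0 sin0 expr0n/= expr1n mulr1 addr0 sqrtr_sqr gtr0_norm.
have -> : cutpar k (pi / 2) = 1%R.
  by rewrite /cutpar cos_pihalf sin_pihalf expr0n/= mulr0 add0r expr1n sqrtr1.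
move=> ->//; first last.
- move=> t /in_pihalf_cc[/andP[s0 _] /andP[c0 _]].
  by rewrite /F' mulr_ge0 ?invr_ge0 ?cutpar_ge0// mulr_ge0 ?mulr_ge0// ltW.
- apply: cont_on_within => t _; rewrite /F'; have := @cont_cutpar k t => cc.
  by cont_rules => //; rewrite gt_eqF.
apply: fin.
  move=> t tI; have [s0 s1 cs0 cs1] := in_pihalf tI.
  rewrite /h ger0_norm ?cutpar_ge0// arc_density_cutpar ?k0 ?k1// -muleA -EFinM.
  rewrite (_ : (_ * _)%R = 1%R) ?mule1// /F'; have := cp0 t => c0.
  by field; rewrite !gt_eqF.
apply: measurable_funTS; apply: emeasurable_funM.
  by apply: measurableT_comp => //; exact: measurable_cutpar.
by apply/measurable_EFinP; rewrite /F' /cutpar; meas_rules.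
Qed.

Local Close Scope ereal_scope.

Lemma measurable_Rintegral_param (f : TR * TR -> R) : measurable_fun setT f ->
  (forall p, 0 <= f p) ->
  measurable_fun setT (fun x : TR => \int[leb]_(t in H) f (x, t)).
Proof.
move=> mf f0; pose h (p : TR * TR) : \bar R := (f p * \1_H p.2)%:E.
have mh : measurable_fun setT h.
  apply/measurable_EFinP; apply: measM => //.
  have mi : measurable_fun setT (\1_H : TR -> R) by apply: measurable_indic; exact: measurable_itv.
  exact: (measurableT_comp mi measurable_snd).
have h0 p : (0 <= h p)%E by rewrite lee_fin mulr_ge0.
have mF := @measurable_fun_fubini_tonelli_F _ _ TR TR R leb h mh h0.
have mfine : measurable_fun setT (fun x => fine (fubini_F leb h x)).
  by apply: measurableT_comp mF; exact: fine_measurable.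
apply: (eq_measurable_fun (fun x => fine (fubini_F leb h x))); last exact: mfine.
move=> x _; rewrite /Rintegral; congr fine.
rewrite [RHS]integral_mkcond /fubini_F; apply: eq_integral => t _.
by rewrite /h patchE /= indicE; case: ifP => tH; rewrite /= ?mulr1 ?mulr0.
Qed.

Lemma measurable_ell_e_abs : measurable_fun setT (fun q : TR => ell_e `|q|).
Proof.
apply: (@measurable_Rintegral_param (fun p => `|p.1| * sin p.2 ^+ 2 / ellD `|p.1| p.2)).
  by rewrite /ellD; meas_rules.
by move=> p; rewrite mulr_ge0 ?invr_ge0 ?sqrtr_ge0// mulr_ge0// sqr_ge0.
Qed.

Lemma measurable_ell_e b : measurable_fun (`[0, b]%classic : set TR) (@ell_e R).
Proof.
apply: (eq_measurable_fun (fun q : TR => ell_e `|q|)).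
  by move=> q; rewrite inE/= in_itv/= => /andP[q0 _]; rewrite ger0_norm.
by apply: measurable_funTS; exact: measurable_ell_e_abs.
Qed.

Lemma measurable_eq_density tau b : measurable_fun setT (fun y : TR => eq_density tau b y).
Proof.
rewrite /eq_density; apply: measM; first by meas_rules.
apply: (@measurable_Rintegral_param (fun p => (Num.sqrt (1 - p.1 ^+ 2) + ellD b p.2)^-1)).
  by rewrite /ellD; meas_rules.
by move=> p; rewrite invr_ge0 addr_ge0// sqrtr_ge0.
Qed.

Lemma eq_density_ge0 tau b y : 0 <= tau -> 0 <= eq_density tau b y.
Proof.
move=> t0; apply: mulr_ge0.
  by rewrite mulr_ge0 ?sqrtr_ge0// mulr_ge0// mulr_ge0// invr_ge0 pi_ge0.
by apply: Rintegral_ge0 => t _; rewrite invr_ge0 addr_ge0// sqrtr_ge0.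
Qed.

Lemma eq_density_gap tau b y : `|y| <= b -> b < 1 -> eq_density tau b y = 0.
Proof.
move=> yb b1; rewrite /eq_density ler0_sqrtr ?mulr0 ?mul0r//.
have b0 := le_trans (normr_ge0 y) yb.
rewrite mulr_le0_ge0// ?subr_le0 ?invr_ge0 ?subr_ge0 -real_normK ?num_real//.
  by rewrite ler_pXn2r ?nnegrE.
by rewrite expr_le1// (le_trans yb)// ltW.
Qed.

Lemma eq_densityZ tau b y : eq_density tau b y = tau * eq_density 1 b y.
Proof. by rewrite /eq_density mul1r !mulrA. Qed.

Lemma eq_densityN tau b y : eq_density tau b (- y) = eq_density tau b y.
Proof. by rewrite /eq_density normrN sqrrN. Qed.

Lemma eq_density1E b y : 0 <= y <= 1 ->
  eq_density 1 b y = (pi^-1 * (y / Num.sqrt (1 - y ^+ 2))) *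
     (Num.sqrt (y ^+ 2 - b ^+ 2) * ellI (Num.sqrt (1 - y ^+ 2)) b).
Proof.
move=> /andP[y0 y1]; rewrite /eq_density ger0_norm// mul1r.
have y2 : 0 <= 1 - y ^+ 2 by rewrite subr_ge0 expr_le1.
suff -> : Num.sqrt ((y ^+ 2 - b ^+ 2) / (1 - y ^+ 2)) =
  Num.sqrt (y ^+ 2 - b ^+ 2) / Num.sqrt (1 - y ^+ 2) by ring.
have [h|h] := leP 0 (y ^+ 2 - b ^+ 2); first by rewrite (sqrtrM _ h) sqrtrV.
rewrite (ler0_sqrtr (ltW h)) mul0r ler0_sqrtr//.
by rewrite mulr_le0_ge0 ?invr_ge0// ltW.
Qed.

Lemma ell_e_le q k : 0 <= q <= k -> k < 1 -> ell_e q <= (Num.sqrt (1 - k ^+ 2))^-1 * (pi / 2).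
Proof.
move=> /andP[q0 qk] k1; have q01 : 0 <= q < 1 by rewrite q0 (le_lt_trans qk).
have k01 : 0 <= k < 1 by rewrite (le_trans q0)//=.
rewrite /ell_e -Rintegral_cst_pihalf; apply: le_Rintegral => //.
- apply: cont_on_integrable => t _; have := @cont_ellD _ q t => cD; cont_rules; [by rewrite gt_eqF// ellD_gt0|exact: cD].
- by apply: cont_on_integrable => t _; exact: contC.
- move=> t _; have D0 := ellD_gt0 t q01; have [_ s0] := ellD_arg_gt0 t k01.
  rewrite -[leRHS]mul1r; apply: ler_pM.
  + by rewrite mulr_ge0// sqr_ge0.
  + by rewrite invr_ge0 ltW.
  + by rewrite mulr_ile1// ?sqr_ge0 ?sin2_le1// ltW// (le_lt_trans qk).
  + have le1 : Num.sqrt (1 - k ^+ 2) <= ellD q t.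
      apply: le_trans (ellD_ge t q01).
      by apply: ler_wsqrtr; rewrite lerB// ler_pXn2r ?nnegrE// (le_trans q0).
    by rewrite lef_pV2 ?posrE// sqrtr_gt0.
Qed.

(** The arc densities at y > q contain the factor 1 / sqrt(y^2 - q^2)
    required by [integral_ell_e_weight], and a further y / a that does not
    depend on q. *)
Lemma integral_ell_e_arc_below y k : 0 < y < 1 -> 0 <= k < y ->
  let a := Num.sqrt (1 - y ^+ 2) in
  (\int[leb]_(q in `[0%R, k]) (ell_e q * arc_density q y)%:E =
   (pi / 2 * ((1 - a) / a) - y / a * (Num.sqrt (y ^+ 2 - k ^+ 2) * ellI a k))%:E)%E.
Proof.
move=> y01 k0y a; have /andP[y0 y1] := y01; have /andP[k0 ky] := k0y.
have a2' : 0 < 1 - y ^+ 2 by rewrite subr_gt0 expr_lt1// ltW.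
have a2 : a ^+ 2 = 1 - y ^+ 2 by rewrite sqr_sqrtr// ltW.
have a0 : 0 < a by rewrite sqrtr_gt0.
have sk0 : 0 < Num.sqrt (y ^+ 2 - k ^+ 2).
  by rewrite sqrtr_gt0 subr_gt0 ltr_pXn2r ?nnegrE// ltW.
have ie : leb.-integrable `[0, k] (EFin \o (fun q => ell_e q / Num.sqrt (y ^+ 2 - q ^+ 2))).
  apply: (@bounded_integrable_itv R 0 k ((Num.sqrt (1 - k ^+ 2))^-1 * (pi / 2) / Num.sqrt (y ^+ 2 - k ^+ 2))).
    by apply: measM; [exact: measurable_ell_e|meas_rules].
  move=> q; rewrite in_itv/= => /andP[q0 qk].
  have e0 := ell_e_ge0 q0.
  rewrite ger0_norm; last by rewrite mulr_ge0// invr_ge0 sqrtr_ge0.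
  apply: ler_pM; [by []|by rewrite invr_ge0 sqrtr_ge0| |].
    by apply: ell_e_le; rewrite ?q0// (lt_trans ky).
  have sle : Num.sqrt (y ^+ 2 - k ^+ 2) <= Num.sqrt (y ^+ 2 - q ^+ 2).
    by apply: ler_wsqrtr; rewrite lerB// ler_pXn2r ?nnegrE.
  by rewrite lef_pV2 ?posrE// (lt_le_trans sk0).
transitivity (\int[leb]_(q in `[0%R, k]) ((ell_e q / Num.sqrt (y ^+ 2 - q ^+ 2)) * (y / a))%:E)%E.
  by apply: eq_integral => q _; congr (_%:E); rewrite /arc_density invfM -/a; ring.
rewrite -EFin_Rintegral//; last first.
  rewrite (_ : EFin \o _ = (fun q => (ell_e q / Num.sqrt (y ^+ 2 - q ^+ 2))%:E * (y / a)%:E)%E).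
    exact: integrableZr.
  by apply/funext => q; rewrite /= EFinM.
rewrite RintegralZr// (integral_ell_e_weight y01 a2 a0 k0y); congr (_%:E).
have y2 : y ^+ 2 = (1 - a) * (1 + a) by rewrite -subr_sqr a2 expr1n; ring.
have a10 : 1 + a != 0 by rewrite gt_eqF// addr_gt0.
rewrite mulrBl (_ : y * (pi / 2) / (1 + a) * (y / a) = y ^+ 2 * (pi / 2) / (1 + a) / a); last by ring.
by rewrite y2; field; rewrite a10 gt_eqF.
Qed.

(** The arcs with q > y do not reach y, so only q < y contributes. As k
    tends to y from below the boundary term of [integral_ell_e_arc_below]
    vanishes, because ellI stays bounded. *)
Lemma integral_ell_e_arc_above y b : 0 < y < 1 -> y <= b ->
  let a := Num.sqrt (1 - y ^+ 2) in
  (\int[leb]_(q in `[0%R, b]) (ell_e q * arc_density q y)%:E = (pi / 2 * ((1 - a) / a))%:E)%E.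
Proof.
move=> y01 yb a; have /andP[y0 y1] := y01.
have a2' : 0 < 1 - y ^+ 2 by rewrite subr_gt0 expr_lt1// ltW.
have a0 : 0 < a by rewrite sqrtr_gt0.
pose f q := (ell_e q * arc_density q y)%:E.
have -> : (\int[leb]_(q in `[0%R, b]) f q = \int[leb]_(q in `[0%R, y[) f q)%E.
  have -> : `[0, y[%classic = `[0, b]%classic `&` `[0, y[%classic :> set R.
    apply/seteqP; split => q /=; rewrite !in_itv/=; last by case.
    by move=> /andP[q0 qy]; rewrite q0 qy (le_trans (ltW qy)).
  rewrite integral_mkcondr; apply: eq_integral => q; rewrite inE/= in_itv/= => /andP[q0 qb].
  rewrite patchE; case: ifPn => //; rewrite notin_setE/= in_itv/= q0/= => /negP; rewrite -leNgt => yq.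
  rewrite /f /arc_density ler0_sqrtr ?mul0r ?invr0 ?mulr0//.
  by rewrite subr_le0 ler_pXn2r ?nnegrE// ltW.
(* These bounds increase to y and stay below it, where the formula for k < y
   applies. *)
pose kap (n : nat) := y * (1 - n.+1%:R^-1).
have kap0 n : 0 <= kap n < y.
  rewrite mulr_ge0 ?(ltW y0) ?subr_ge0 ?invf_le1 ?ler1n//=.
  by rewrite gtr_pMr// gtrBl invr_gt0.
have -> : (\int[leb]_(q in `[0%R, y[) f q = limn (fun n => \int[leb]_(q in `[0%R, kap n]) f q))%E.
  apply/esym/cvg_lim => //.
  have -> : `[0, y[%classic = \bigcup_n (`[0, kap n]%classic : set R).
    apply/seteqP; split => q /=.
      rewrite in_itv/= => /andP[q0 qy].
      have d0 : 0 < 1 - q / y by rewrite subr_gt0 ltr_pdivrMr// mul1r.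
      have [k _ hk] := near_infty_natSinv_lt (PosNum d0).
      exists k => //=; rewrite in_itv/= q0/= /kap mulrC -ler_pdivrMr//.
      have hkk : k.+1%:R^-1 < 1 - q / y := hk k (leqnn _).
      by rewrite lerBrDr -lerBrDl ltW.
    by move=> [n _]/=; rewrite !in_itv/= => /andP[-> qk]/=; have /andP[_] := kap0 n; exact: le_lt_trans.
  apply: ge0_nondecreasing_set_cvg_integral.
  - move=> m n mn; apply/subsetPset => q /=; rewrite !in_itv/= => /andP[-> qm]/=.
    apply: (le_trans qm); rewrite /kap ler_pM2l// lerB// lef_pV2 ?posrE ?ltr0n// ler_nat.
    by rewrite ltnS.
  - by move=> n; exact: measurable_itv.
  - move=> n; apply/measurable_EFinP; apply: measM; first exact: measurable_ell_e.
    by rewrite /arc_density; meas_rules.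
  - move=> n q; rewrite /= in_itv/= => /andP[q0 _].
    by rewrite lee_fin mulr_ge0 ?ell_e_ge0// arc_density_ge0// ltW.
apply/cvg_lim => //; rewrite (_ : (fun n => _) = (fun n =>
   (pi / 2 * ((1 - a) / a) - y / a * (Num.sqrt (y ^+ 2 - kap n ^+ 2) * ellI a (kap n)))%:E)); last first.
  by apply/funext => n; rewrite (integral_ell_e_arc_below y01 (kap0 n)).
apply: cvg_EFin; first exact: nearW.
rewrite /comp/= -[X in _ --> X]subr0; apply: cvgB; first exact: cvg_cst.
rewrite -[X in _ --> X](mulr0 (y / a)); apply: cvgMr.
apply: (@squeeze_cvgr _ _ _ _ (cst 0) (fun n => Num.sqrt (y ^+ 2 - kap n ^+ 2) * ((pi / 2) / a))).
- apply: nearW => n; have k01 : 0 <= kap n < 1 by have /andP[-> /lt_trans -> //] := kap0 n.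
  have /andP[i0 i1] := ellI_bounds (ltW a0) k01; rewrite mulr_ge0 ?sqrtr_ge0//=.
  apply: ler_wpM2l; first exact: sqrtr_ge0.
  apply: (le_trans i1); apply: ler_wpM2l; first by rewrite divr_ge0// pi_ge0.
  have le : a <= Num.sqrt (1 - kap n ^+ 2).
    have /andP[? /ltW ?] := kap0 n.
    by apply: ler_wsqrtr; rewrite lerB// ler_pXn2r ?nnegrE// ltW.
  by rewrite lef_pV2 ?posrE// (lt_le_trans a0).
- exact: cvg_cst.
- rewrite -[X in _ --> X](mul0r ((pi / 2) / a)); apply: cvgMl.
  rewrite -[X in _ --> X]sqrtr0.
  apply: (@continuous_cvg _ _ _ _ _ _ (@Num.sqrt R)); first exact: sqrt_continuous.
  rewrite -(subrr (y ^+ 2)); apply: cvgB; first exact: cvg_cst.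
  rewrite (_ : (fun n => _) = (fun n => kap n * kap n)); last by apply/funext => n; rewrite expr2.
  have kc : kap n @[n --> \oo] --> y.
    rewrite -[X in _ --> X]mulr1; apply: cvgMr.
    rewrite -[X in _ --> X]subr0; apply: cvgB; first exact: cvg_cst.
    exact: cvg_harmonic.
  rewrite expr2; exact: cvgM.
Qed.

(** The angular density is the superposition of the uniform density, of the
    claimed density for tau = 1, and of the arc densities with weight - E'.
    Below b the claimed density is 0 and the arcs alone compensate for the
    uniform density. *)
Lemma angle_density_split b y : 0 < b < 1 -> 0 < y < 1 ->
  ((2^-1 / Num.sqrt (1 - y ^+ 2))%:E = (2^-1 + eq_density 1 b y)%:E +
  (pi^-1)%:E * \int[leb]_(q in `[0%R, b]) (ell_e q * arc_density q y)%:E)%E.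
Proof.
move=> b01 y01; have /andP[b0 b1] := b01; have /andP[y0 y1] := y01.
have a2' : 0 < 1 - y ^+ 2 by rewrite subr_gt0 expr_lt1// ltW.
have a0 : 0 < Num.sqrt (1 - y ^+ 2) by rewrite sqrtr_gt0.
have p0 : 0 < (pi : R) by exact: pi_gt0.
rewrite eq_density1E ?ltW//; have [yb|by_] := leP y b.
  have -> : Num.sqrt (y ^+ 2 - b ^+ 2) = 0.
    by apply: ler0_sqrtr; rewrite subr_le0 ler_pXn2r ?nnegrE// ltW.
  rewrite (integral_ell_e_arc_above y01 yb).
  rewrite -EFinM -EFinD; congr (_%:E).
  rewrite mul0r mulr0 addr0; move: (Num.sqrt _) (pi : R) a0 p0 => a p a0 p0.
  by field; rewrite !gt_eqF.
rewrite (integral_ell_e_arc_below y01) ?by_ ?ltW//.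
rewrite -EFinM -EFinD; congr (_%:E).
move: (Num.sqrt (1 - y ^+ 2)) a0 => a a0.
by move: (Num.sqrt _) (ellI _ _) (pi : R) p0 => r i p p0; field; rewrite !gt_eqF.
Qed.

End two_cut_parametrization.

(** * The main identity in integrated form *)

Section angle_split.
Context (R : realType).
Local Notation leb := (@lebesgue_measure R).
Local Notation TR := (measurableTypeR R).
Local Notation H := (`[0%R, ((pi : R) / 2)%R]%classic).
Implicit Types (k t y : R).

(** For k = 0 the cuts merge and the law is the arcsine law of [-1, 1]. *)
Lemma arc_density0 y : 0 < y -> arc_density 0 y = (Num.sqrt (1 - y ^+ 2))^-1.
Proof.
move=> y0; rewrite /arc_density expr0n/= subr0 sqrtr_sqr gtr0_norm// invfM mulrA.
by rewrite divff ?mul1r// gt_eqF.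
Qed.

Local Open Scope ereal_scope.

Lemma integral_arc_density_oo k (g : TR -> \bar R) : (0 <= k < 1)%R ->
  measurable_fun setT g -> (forall y, 0 <= g y) ->
  \int[leb]_(y in `]0%R, 1%R[) (g y * (arc_density k y)%:E) =
  \int[leb]_(t in H) g (cutpar k t).
Proof.
move=> k01 mg g0; have /andP[k0 k1] := k01.
rewrite -(integral_arc_density k01 mg g0).
have mga : measurable_fun setT (fun y : TR => g y * (arc_density k y)%:E).
  by apply: emeasurable_funM => //; apply/measurable_EFinP; exact: measurable_arc_density1.
rewrite [RHS]integral_itv_bndoo; last exact: measurable_funTS.
have -> : `]k, 1%R[%classic = `]0%R, 1%R[%classic `&` `]k, 1%R[%classic :> set R.
  apply/seteqP; split => q /=; rewrite !in_itv/=; last by case.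
  by move=> /andP[kq q1]; rewrite kq q1 (le_lt_trans k0).
rewrite [RHS]integral_mkcondr; apply: eq_integral => q; rewrite inE/= in_itv/= => /andP[q0 q1].
rewrite patchE; case: ifPn => //; rewrite notin_setE/= in_itv/= q1 andbT => /negP; rewrite -leNgt => qk.
rewrite /arc_density ler0_sqrtr ?mul0r ?invr0 ?mulr0 ?mule0//.
by rewrite subr_le0 ler_pXn2r ?nnegrE// ltW.
Qed.

(** [angle_density_split] integrated against g, with Fubini-Tonelli for the
    superposition of arcs. *)
Lemma angle_integral_split b (g : TR -> \bar R) : (0 < b < 1)%R ->
  measurable_fun setT g -> (forall y, 0 <= g y) ->
  (2^-1)%:E * \int[leb]_(t in H) g (sin t) =
  (2^-1)%:E * \int[leb]_(y in `[0%R, 1%R]) g y +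
  \int[leb]_(y in `[b, 1%R]) (g y * (eq_density 1 b y)%:E) +
  (pi^-1)%:E * \int[leb]_(q in `[0%R, b]) ((ell_e q)%:E * \int[leb]_(t in H) g (cutpar q t)).
Proof.
move=> b01 mg g0; have /andP[b0 b1] := b01.
have p0 : (0 <= (pi : R)^-1)%R by rewrite invr_ge0 pi_ge0.
have md : measurable_fun setT (fun y : TR => (eq_density 1 b y)%:E).
  by apply/measurable_EFinP; exact: measurable_eq_density.
pose A (y : R) := \int[leb]_(q in `[0%R, b]) (ell_e q * arc_density q y)%:E.
pose f (p : TR * TR) := g p.1 * (ell_e `|p.2| * arc_density p.2 p.1)%:E.
have mf : measurable_fun setT f.
  apply: emeasurable_funM; first exact: (measurableT_comp mg measurable_fst).
  apply/measurable_EFinP; apply: measM.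
    exact: (measurableT_comp (@measurable_ell_e_abs R) measurable_snd).
  by rewrite /arc_density; meas_rules.
have absq q : q \in `[0%R, b] -> ell_e `|q|%R = ell_e q.
  by rewrite in_itv/= => /andP[q0 _]; rewrite ger0_norm.
have f0 y q : (0 < y)%R -> 0 <= f (y, q).
  move=> y0; rewrite mule_ge0// lee_fin mulr_ge0 ?ell_e_ge0// arc_density_ge0//; exact: ltW.
have A_f y : y \in `]0%R, 1%R[ -> g y * A y = \int[leb]_(q in `[0%R, b]) f (y, q).
  rewrite in_itv/= => /andP[y0 y1].
  have m1 : measurable_fun (`[0%R, b]%classic : set TR) (fun q : TR => (ell_e q * arc_density q y)%:E).
    apply/measurable_EFinP; apply: measM; first exact: measurable_ell_e.
    by rewrite /arc_density; meas_rules.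
  have n1 q : `[0%R, b]%classic q -> 0 <= (ell_e q * arc_density q y)%:E.
    rewrite /= in_itv/= => /andP[q0 _].
    by rewrite lee_fin mulr_ge0 ?ell_e_ge0// arc_density_ge0// ltW.
  rewrite -[LHS](ge0_integralZl leb (measurable_itv _) m1 n1 (g0 y)).
  by apply: eq_integral => q; rewrite inE/= => qb; rewrite /f /= absq.
have A0 y : (0 < y)%R -> 0 <= A y.
  move=> y0; apply: integral_ge0 => q; rewrite /= in_itv/= => /andP[q0 _].
  by rewrite lee_fin mulr_ge0 ?ell_e_ge0// arc_density_ge0// ltW.
have mIf : measurable_fun (`]0%R, 1%R[%classic : set TR) (fun y : TR => g y * A y).
  pose f' (p : TR * TR) := f (`|p.1|%R, p.2) * (\1_(`[0%R, b]%classic : set TR) p.2)%:E.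
  have mf' : measurable_fun setT f'.
    apply: emeasurable_funM; last first.
      apply/measurable_EFinP.
      have mi : measurable_fun setT (\1_(`[0%R, b]%classic : set TR) : TR -> R).
        by apply: measurable_indic; exact: measurable_itv.
      exact: (measurableT_comp mi measurable_snd).
    apply: (measurableT_comp mf); apply/measurable_fun_pairP; split.
      rewrite (_ : _ \o _ = (fun p : TR * TR => `|p.1|%R))//; meas_rules.
    exact: measurable_snd.
  have f'0 p : 0 <= f' p.
    rewrite mule_ge0 ?lee_fin// /f/= mule_ge0// lee_fin mulr_ge0 ?ell_e_ge0//.
    by rewrite arc_density_ge0.
  apply: (eq_measurable_fun (fubini_F (T1 := TR) (T2 := TR) leb f')).
    move=> y; rewrite inE/= => y01; rewrite A_f// /fubini_F.
    rewrite [RHS]integral_mkcond; apply: eq_integral => q _.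
    move: y01; rewrite in_itv/= => /andP[y0 _].
    by rewrite /f' patchE /= indicE ger0_norm ?ltW//; case: ifP => _; rewrite ?mule1 ?mule0.
  apply: measurable_funTS.
  exact: (@measurable_fun_fubini_tonelli_F _ _ TR TR R leb f' mf' f'0).
transitivity (\int[leb]_(y in `]0%R, 1%R[)
   ((2^-1)%:E * g y + g y * (eq_density 1 b y)%:E + (pi^-1)%:E * (g y * A y))).
  have c0 t : t \in H -> g (sin t) = g (cutpar 0 t).
    rewrite inE/= => /in_pihalf_cc[/andP[s0 _] _].
    by rewrite /cutpar expr0n/= mul0r add0r sqrtr_sqr ger0_norm.
  transitivity ((2^-1)%:E * \int[leb]_(t in H) g (cutpar 0 t)).
    by congr (_ * _); exact: eq_integral.
  have m1 : measurable_fun (`]0%R, 1%R[%classic : set TR) (fun y : TR => g y * (arc_density 0 y)%:E).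
    apply: measurable_funTS; apply: emeasurable_funM => //.
    by apply/measurable_EFinP; exact: measurable_arc_density1.
  have n1 y : `]0%R, 1%R[%classic y -> 0 <= g y * (arc_density 0 y)%:E.
    rewrite /= in_itv/= => /andP[y0 _].
    by rewrite mule_ge0// lee_fin arc_density_ge0// ltW.
  have h0 : (0 <= 2^-1 :> R)%R by rewrite invr_ge0.
  rewrite -integral_arc_density_oo ?lexx ?ltr01//.
  rewrite -[LHS](ge0_integralZl_EFin leb (measurable_itv _) n1 m1 h0).
  - apply: eq_integral => y; rewrite inE/= in_itv/= => y01; have /andP[y0 y1] := y01.
    have := angle_density_split b01 y01; rewrite -/(A y) EFinD => e.
    rewrite muleA (muleC _ (g y)) -muleA -EFinM.
    rewrite arc_density0//.
    have d0 := @eq_density_ge0 R 1%R b y ler01.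
    have AA := A0 y y0; rewrite e; move: (A y) AA => Ay AA.
    rewrite ge0_muleDr; [|by rewrite adde_ge0 ?lee_fin|by apply: mule_ge0 => //; rewrite lee_fin].
    rewrite ge0_muleDr; [|by rewrite lee_fin..].
    by rewrite muleA (muleC (g y) (pi^-1)%:E) -muleA (muleC (g y) (2^-1)%:E).
have mgd : measurable_fun setT (fun y : TR => g y * (eq_density 1 b y)%:E) by exact: emeasurable_funM.
have gd0 y : 0 <= g y * (eq_density 1 b y)%:E by rewrite mule_ge0// lee_fin eq_density_ge0.
have mgh : measurable_fun setT (fun y : TR => (2^-1)%:E * g y) by exact: measurable_funeM.
have gh0 y : 0 <= (2^-1)%:E * g y by rewrite mule_ge0// lee_fin invr_ge0.
have gA0 y : `]0%R, 1%R[%classic y -> 0 <= g y * A y.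
  by rewrite /= in_itv/= => /andP[y0 _]; rewrite mule_ge0// A0.
have pA0 y : `]0%R, 1%R[%classic y -> 0 <= (pi^-1)%:E * (g y * A y).
  by move=> y01; rewrite mule_ge0 ?lee_fin// gA0.
rewrite [LHS](ge0_integralD leb (measurable_itv _) (fun y _ => adde_ge0 (gh0 y) (gd0 y))
  (measurable_funTS (emeasurable_funD mgh mgd)) pA0 (measurable_funeM _ mIf)).
rewrite (ge0_integralD leb (measurable_itv _) (fun y _ => gh0 y) (measurable_funTS mgh)
  (fun y _ => gd0 y) (measurable_funTS mgd)).
congr (_ + _ + _).
- have h0 : (0 <= 2^-1 :> R)%R by rewrite invr_ge0.
  rewrite (ge0_integralZl_EFin leb (measurable_itv _) (fun y _ => g0 y) (measurable_funTS mg) h0).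
  by rewrite [in RHS]integral_itv_bndoo//; exact: measurable_funTS.
- rewrite [RHS]integral_itv_bndoo; last exact: measurable_funTS.
  have -> : `]b, 1%R[%classic = `]0%R, 1%R[%classic `&` `]b, 1%R[%classic :> set R.
    apply/seteqP; split => q /=; rewrite !in_itv/=; last by case.
    by move=> /andP[kq q1]; rewrite kq q1 (lt_trans b0).
  rewrite [RHS]integral_mkcondr; apply: eq_integral => q; rewrite inE/= in_itv/= => /andP[q0 q1].
  rewrite patchE; case: ifPn => //; rewrite notin_setE/= in_itv/= q1 andbT => /negP; rewrite -leNgt => qk.
  by rewrite eq_density_gap ?mule0// ger0_norm// ltW.
- rewrite (ge0_integralZl_EFin leb (measurable_itv _) gA0 mIf p0).
  congr (_ * _).
  transitivity (\int[leb]_(y in `]0%R, 1%R[) \int[leb]_(q in `[0%R, b]) f (y, q)).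
    by apply: eq_integral => y; rewrite inE/= => /A_f.
  rewrite (@ge0_fubini_on _ _ TR TR R leb leb `]0%R, 1%R[%classic `[0%R, b]%classic _ _ f); first last.
  + by move=> y q; rewrite /= in_itv/= => /andP[y0 _] _; exact: f0.
  + exact: measurable_funTS.
  + exact: measurable_itv.
  + exact: measurable_itv.
  apply: eq_integral => q; rewrite inE/= => qb.
  have /andP[q0 qb'] : (0 <= q <= b)%R by move: qb; rewrite in_itv.
  have q01 : (0 <= q < 1)%R by rewrite q0 (le_lt_trans qb').
  have m1 : measurable_fun (`]0%R, 1%R[%classic : set TR) (fun y : TR => g y * (arc_density q y)%:E).
    apply: measurable_funTS; apply: emeasurable_funM => //.
    by apply/measurable_EFinP; exact: measurable_arc_density1.
  have n1 y : `]0%R, 1%R[%classic y -> 0 <= g y * (arc_density q y)%:E.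
    rewrite /= in_itv/= => /andP[y0 _].
    by rewrite mule_ge0// lee_fin arc_density_ge0// ltW.
  rewrite -integral_arc_density_oo// -[RHS](ge0_integralZl_EFin leb (measurable_itv _) n1 m1 (ell_e_ge0 q0)).
  apply: eq_integral => y _; rewrite /f /= absq// EFinM.
  exact: muleCA.
Qed.

(** [angle_integral_split] for the constant function 1; every arc has mass
    pi / 2, and - E' integrates to pi / 2 - E(b). *)
Lemma eq_density_mass b : (0 < b < 1)%R ->
  \int[leb]_(y in `[b, 1%R]) (eq_density 1 b y)%:E = ((ellE b - 1) / 2)%:E.
Proof.
move=> b01; have /andP[b0 b1] := b01.
have b01' : (0 <= b < 1)%R by rewrite b1 ltW.
have H1 : \int[leb]_(t in H) (1 : \bar R) = (pi / 2)%:E.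
  by rewrite integral_cst//= mul1e lebesgue_measure_itv/= lte_fin divr_gt0 ?pi_gt0// -EFinB subr0.
have I1 : \int[leb]_(y in `[0%R, 1%R]) (1 : \bar R) = 1%:E.
  by rewrite integral_cst//= mul1e lebesgue_measure_itv/= lte_fin ltr01 -EFinB subr0.
have := @angle_integral_split b (cst 1) b01 (measurable_cst _) (fun=> lee01).
rewrite /= H1 I1.
have -> : \int[leb]_(y in `[b, 1%R]) (1 * (eq_density 1 b y)%:E) =
   \int[leb]_(y in `[b, 1%R]) (eq_density 1 b y)%:E.
  by apply: eq_integral => y _; rewrite mul1e.
have ie : leb.-integrable `[0%R, b] (EFin \o @ell_e R).
  apply: (@bounded_integrable_itv R 0 b ((Num.sqrt (1 - b ^+ 2))^-1 * (pi / 2))).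
    exact: measurable_ell_e.
  move=> q; rewrite in_itv/= => qb; have /andP[q0 _] := qb.
  by rewrite ger0_norm ?ell_e_ge0// ell_e_le.
have -> : \int[leb]_(q in `[0%R, b]) ((ell_e q)%:E * (pi / 2)%:E) =
   ((pi / 2 - ellE b) * (pi / 2))%:E.
  have iz : leb.-integrable `[0%R, b] (EFin \o (fun q => ell_e q * (pi / 2))%R).
    rewrite (_ : EFin \o _ = (fun q => (ell_e q)%:E * (pi / 2)%:E)); first exact: integrableZr.
    by apply/funext => q; rewrite /= EFinM.
  transitivity (\int[leb]_(q in `[0%R, b]) (ell_e q * (pi / 2))%:E).
    by apply: eq_integral => q _; rewrite EFinM.
  by rewrite -(EFin_Rintegral (measurable_itv _) iz) RintegralZr// integral_ell_e// ellE0.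
rewrite -!EFinM => e.
have fin : \int[leb]_(y in `[b, 1%R]) (eq_density 1 b y)%:E \is a fin_num.
  by move: e; case: (\int[leb]_(y in _) _).
move: e; rewrite -(fineK fin) -!EFinD => -[e]; congr (_%:E).
move: e; set r := fine _ => e.
have p0 : (pi : R) != 0%R by rewrite gt_eqF// pi_gt0.
have : (pi^-1 * ((pi / 2 - ellE b) * (pi / 2)) = (pi / 2 - ellE b) / 2 :> R)%R.
  by move: (pi : R) p0 => p p0; field.
lra.
Qed.

End angle_split.

(** * Potentials of the arcsine laws *)

Section sine_logarithm.
Context (R : realType).
Local Notation leb := (@lebesgue_measure R).
Local Notation TR := (measurableTypeR R).
Local Notation H := (`[0%R, ((pi : R) / 2)%R]%classic).
Implicit Types (a b c t x y k : R).

Let pi2_gt0 : 0 < (pi : R) / 2. Proof. by rewrite divr_gt0 ?pi_gt0. Qed.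

(** A linear lower bound, which makes log sin integrable at 0. *)
Lemma sin_ge_half t : 0 <= t <= pi / 2 -> t / 2 <= sin t.
Proof.
have tcos (u : R) : 0 <= u <= pi / 2 -> u * cos u <= sin u.
  move=> /andP[u0 u1].
  have dF s : s \in `[0, u] -> is_derive (s : R) (1 : R) (fun s => sin s - s * cos s) (s * sin s).
    by move=> _; eapply is_derive_eq; [derive_rules|rewrite /=; ring].
  rewrite -subr_ge0; have := RFTC_segment u0 dF; rewrite sin0 mul0r subrr subr0 => <-.
    apply: Rintegral_ge0 => s; rewrite /= in_itv/= => /andP[s0 s1].
    rewrite mulr_ge0// sin_ge0_pi// s0/= (le_trans s1)// (le_trans u1)// ler_pdivrMr//.
    by rewrite ler_peMr ?pi_ge0// ler1n.
  by move=> s _; cont_rules.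
move=> /andP[t0 t1].
have h0 : 0 <= t / 2 <= pi / 2 by apply/andP; split; lra.
have c0 : 0 <= cos (t / 2) by apply: cos_ge0_pihalf; lra.
have := tcos _ h0.
have e : sin t = 2 * (sin (t / 2) * cos (t / 2)).
  by rewrite [in LHS](_ : t = t / 2 + t / 2) ?sinD; [ring|field].
have ec : cos t = 2 * cos (t / 2) ^+ 2 - 1.
  rewrite [in LHS](_ : t = t / 2 + t / 2); last by field.
  by rewrite cosD -!expr2 sin2cos2; ring.
have ct : 0 <= cos t by apply: cos_ge0_pihalf; lra.
move=> tc; have c2 : 1 / 2 <= cos (t / 2) ^+ 2 by lra.
have t20 : 0 <= t / 2 by rewrite divr_ge0.
have h1 := ler_wpM2r c0 tc; have h2 := ler_wpM2l t20 c2; lra.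
Qed.

Local Open Scope ereal_scope.

Lemma ge0_integral_shift c a b (g : TR -> \bar R) : (a <= b)%R ->
  measurable_fun setT g -> (forall x, 0 <= g x) ->
  \int[leb]_(x in `[(a + c)%R, (b + c)%R]) g x = \int[leb]_(x in `[a, b]) g (x + c)%R.
Proof.
rewrite le_eqVlt => /predU1P[<-|ab] mg g0.
  by rewrite !set_itv1 !integral_set1.
have mono : {in `[a, b] &, {mono (fun x => x + c)%R : x y / (x <= y)%R}}.
  by move=> x y _ _; rewrite lerD2r.
have dF x : x \in `]a, b[ -> is_derive (x : R) (1%R : R) (fun x => x + c)%R 1%R.
  by move=> _; eapply is_derive_eq; [derive_rules|rewrite /= addr0].
have cF : continuous (fun x => x + c)%R.
  by move=> x; apply: contD; [exact: contI|exact: contC].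
rewrite (@ge0_integral_subst R (fun x => x + c)%R (cst 1%R) a b g ab cF mono dF)//.
- by apply: eq_integral => x _; rewrite mule1.
- by apply: continuous_subspaceT => x; exact: cvg_cst.
Qed.

Lemma ge0_integral_itv_split a b c (g : TR -> \bar R) : (a <= b)%R -> (b <= c)%R ->
  measurable_fun setT g -> (forall x, 0 <= g x) ->
  \int[leb]_(x in `[a, c]) g x = \int[leb]_(x in `[a, b]) g x + \int[leb]_(x in `[b, c]) g x.
Proof.
move=> ab bc mg g0.
have -> : `[a, c]%classic = `[a, b]%classic `|` `]b, c]%classic :> set R.
  apply/seteqP; split => x /=; rewrite !in_itv/=.
    by move=> /andP[ax xc]; case: (leP x b) => xb; [left; rewrite ax|right].
  move=> [/andP[-> xb]|/andP[bx ->]]/=; first exact: le_trans bc.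
  by rewrite andbT (le_trans ab)// ltW.
rewrite ge0_integral_setU//; last 2 first.
- exact: measurable_funTS.
- apply/disj_setPS => x [] /=; rewrite !in_itv/= => /andP[_ xb] /andP[bx _].
  by move: (le_lt_trans xb bx); rewrite ltxx.
congr (_ + _); rewrite integral_itv_bndoo; last exact: measurable_funTS.
by rewrite [LHS]integral_itv_bndoo//; exact: measurable_funTS.
Qed.

Definition lsin t : \bar R := if sin t == 0%R then +oo else (- ln `|sin t|)%:E.

Lemma lsin_ge0 t : 0 <= lsin t.
Proof.
rewrite /lsin; case: ifPn => // s0; by rewrite lee_fin oppr_ge0 ln_le0// ler_norml sin_geN1 sin_le1.
Qed.

Lemma measurable_lsin : measurable_fun setT (lsin : TR -> \bar R).
Proof.
apply: measurable_fun_ifT => //.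
- apply: (@measurable_fun_eqr _ _ R _ (@sin R) (cst 0%R)); last exact: measurable_cst.
  by apply: continuous_measurable_fun; exact: continuous_sin.
- apply/measurable_EFinP; apply: measN; apply: meas_ln; apply: meas_norm.
  by apply: continuous_measurable_fun; exact: continuous_sin.
Qed.

Lemma lsinN t : lsin (- t) = lsin t.
Proof. by rewrite /lsin sinN oppr_eq0 normrN. Qed.

Lemma lsinDpi t : lsin (t + pi) = lsin t.
Proof. by rewrite /lsin sinDpi oppr_eq0 normrN. Qed.

Definition lsin_mass : \bar R := \int[leb]_(t in `[(- (pi / 2))%R, (pi / 2)%R]) lsin t.

Lemma integral_lsin_reflect a b :
  \int[leb]_(t in `[(- b)%R, (- a)%R]) lsin t = \int[leb]_(t in `[a, b]) lsin t.
Proof.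
rewrite [LHS](ge0_integral_reflect (measurable_itv _) measurable_lsin lsin_ge0).
under eq_integral do rewrite lsinN.
congr (integral _ _ _); apply/seteqP; split => x /=; rewrite !in_itv/= !lerN2.
  by move=> /andP[-> ->].
by move=> /andP[-> ->].
Qed.

(** Compare with - log (t / 2), whose primitive t - t log (t / 2) is
    bounded. *)
Lemma lsin_mass_lty : lsin_mass < +oo.
Proof.
have p0 := pi2_gt0; have ml := measurable_lsin.
rewrite /lsin_mass (@ge0_integral_itv_split _ 0)//; last 3 first.
- by rewrite oppr_le0 ltW.
- exact: ltW.
- exact: lsin_ge0.
rewrite -[X in `[_, X]]oppr0 integral_lsin_reflect.
suff h : \int[leb]_(t in H) lsin t < +oo by rewrite lte_add_pinfty.
pose G t := (t - t * ln (t / 2))%R.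
apply: (@le_lt_trans _ _ (G (pi / 2))%:E); last exact: ltry.
have pi4 : (pi / 2 / 2 <= 1 :> R)%R by have /andP[_] := @pihalf_02 R; lra.
rewrite integral_itv_bndoo; last exact: measurable_funTS.
pose eps (n : nat) := (pi / 2 * n.+1%:R^-1)%R : R.
have eps0 n : (0 < eps n <= pi / 2)%R.
  by rewrite mulr_gt0 ?invr_gt0//= ger_pMr// invf_le1 ?ler1n.
pose f t := (- ln (t / 2))%:E.
have mf : measurable_fun setT (f : TR -> \bar R) by apply/measurable_EFinP; meas_rules.
have f0 t : (t <= pi / 2)%R -> 0 <= f t.
  move=> t2; rewrite lee_fin oppr_ge0 ln_le0// (le_trans _ pi4)//.
  by rewrite ler_pM2r.
apply: (@le_trans _ _ (\int[leb]_(t in `]0%R, (pi / 2)%R]) f t)).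
  rewrite [leRHS]integral_itv_bndoo; last exact: measurable_funTS.
  apply: ge0_le_integral => //.
  - by move=> t _; exact: lsin_ge0.
  - exact: measurable_funTS.
  - exact: measurable_funTS.
  - move=> t; rewrite /= in_itv/= => /andP[t0 t1].
    have st : (t / 2 <= sin t)%R by apply: sin_ge_half; rewrite !ltW.
    have t20 : (0 < t / 2)%R by rewrite divr_gt0.
    have s0 := lt_le_trans t20 st.
    by rewrite /lsin gt_eqF// lee_fin lerN2 ler_ln ?posrE ?normr_gt0 ?gt_eqF// gtr0_norm.
have cv : \int[leb]_(t in `[eps n, (pi / 2)%R]) f t @[n --> \oo] --> \int[leb]_(t in `]0%R, (pi / 2)%R]) f t.
  have -> : `]0%R, (pi / 2)%R]%classic = \bigcup_n (`[eps n, (pi / 2)%R]%classic : set R).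
    apply/seteqP; split => q /=.
      rewrite in_itv/= => /andP[q0 qy].
      have d0 : (0 < q / (pi / 2))%R by rewrite divr_gt0.
      have [k _ hk] := near_infty_natSinv_lt (PosNum d0).
      exists k => //=; rewrite in_itv/= qy andbT /eps mulrC -ler_pdivlMr//.
      by apply: ltW; exact: (hk k (leqnn _)).
    by move=> [n _]/=; rewrite !in_itv/= => /andP[eq ->]; have /andP[e0 _] := eps0 n; rewrite (lt_le_trans e0).
  apply: ge0_nondecreasing_set_cvg_integral.
  - move=> m n mn; apply/subsetPset => q /=; rewrite !in_itv/= => /andP[qm ->].
    rewrite andbT (le_trans _ qm)// /eps ler_pM2l// lef_pV2 ?posrE ?ltr0n// ler_nat.
    by rewrite ltnS.
  - by move=> n; exact: measurable_itv.
  - by move=> n; exact: measurable_funTS.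
  - by move=> n q; rewrite /= in_itv/= => /andP[_ q1]; exact: f0.
rewrite -(cvg_lim _ cv)//; apply: lime_le; first by apply/cvg_ex; eexists; exact: cv.
apply: nearW => n; have /andP[e0 e1] := eps0 n.
have dG t : t \in `[eps n, (pi / 2)%R] -> is_derive (t : R) (1%R : R) G (- ln (t / 2))%R.
  rewrite in_itv/= => /andP[et _]; have t0 := lt_le_trans e0 et.
  have t20 : (0 < t / 2)%R by rewrite divr_gt0.
  eapply is_derive_eq; first by rewrite /G; derive_rules.
  by rewrite /=; field; rewrite gt_eqF.
rewrite /f (FTC_segment e1 dG).
  rewrite lee_fin gerBl /G subr_ge0 (le_trans _ (ltW e0))//.
  apply: mulr_ge0_le0; first exact: ltW.
  by rewrite ln_le0// (le_trans _ pi4)// ler_pM2r.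
move=> t; rewrite in_itv/= => /andP[et _]; have t0 := lt_le_trans e0 et.
have t20 : (0 < t / 2)%R by rewrite divr_gt0.
by cont_rules.
Qed.

(** By evenness and periodicity, the translates of the quarter turn by al
    and - al together cover one period. *)
Lemma integral_lsin_pair (al : R) : (0 <= al <= pi / 2)%R ->
  \int[leb]_(t in H) (lsin (t - al) + lsin (t + al)) = lsin_mass.
Proof.
move=> /andP[a0 a1]; have p0 := pi2_gt0.
have ml := measurable_lsin.
have msh c : measurable_fun setT (fun t : TR => lsin (t + c)).
  apply: (measurableT_comp ml); meas_rules.
rewrite (ge0_integralD leb (measurable_itv _) (fun t _ => lsin_ge0 _) (measurable_funTS (msh _))
  (fun t _ => lsin_ge0 _) (measurable_funTS (msh _))).
rewrite -(@ge0_integral_shift al 0 (pi / 2) lsin (ltW p0) ml lsin_ge0).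
rewrite -(@ge0_integral_shift (- al) 0 (pi / 2) lsin (ltW p0) ml lsin_ge0) !add0r.
rewrite /lsin_mass (@ge0_integral_itv_split (- (pi / 2)) (- al))//; last 3 first.
- by rewrite lerN2.
- by rewrite (le_trans _ (ltW p0))// oppr_le0.
- exact: lsin_ge0.
rewrite integral_lsin_reflect [in RHS](@ge0_integral_itv_split (- al) (pi / 2 - al))//; last 3 first.
- by rewrite lerDr ltW.
- by rewrite gerBl.
- exact: lsin_ge0.
rewrite (@ge0_integral_itv_split al (pi / 2) (pi / 2 + al))//; last 2 first.
- by rewrite lerDl.
- exact: lsin_ge0.
have -> : \int[leb]_(x in `[(pi / 2)%R, (pi / 2 + al)%R]) lsin x =
   \int[leb]_(x in `[(pi / 2 - al)%R, (pi / 2)%R]) lsin x.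
  rewrite -[RHS]integral_lsin_reflect.
  have e1 : (- (pi / 2) + pi = pi / 2 :> R)%R by field.
  have e2 : (- (pi / 2 - al) + pi = pi / 2 + al :> R)%R by field.
  transitivity (\int[leb]_(x in `[(- (pi / 2) + pi)%R, (- (pi / 2 - al) + pi)%R]) lsin x).
    by rewrite e1 e2.
  rewrite (@ge0_integral_shift pi _ _ lsin)//; last 2 first.
  - by rewrite opprB; lra.
  - exact: lsin_ge0.
  by under eq_integral do rewrite lsinDpi.
by rewrite addeCA.
Qed.

(** The kernel summed over the two points y and - y of a symmetric measure;
    it only depends on x^2 and y^2. *)
Definition log_kernel_even x y : \bar R := log_kernel (x, y) + log_kernel (x, (- y)%R).

Lemma log_kernel_evenE x y : (`|x| <= 1)%R -> (`|y| <= 1)%R ->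
  log_kernel_even x y =
  if (x ^+ 2 == y ^+ 2)%R then +oo else (ln (4 / `|x ^+ 2 - y ^+ 2|))%:E.
Proof.
move=> x1 y1; rewrite /log_kernel_even /log_kernel /= eqf_sqr.
have [->|xy] /= := eqVneq x y; first by case: ifP.
have [xNy|xNy] /= := eqVneq x (- y)%R; first by [].
rewrite -EFinD; congr (_%:E).
have d0 : (0 < `|x - y|)%R by rewrite normr_gt0 subr_eq0.
have s0 : (0 < `|x + y|)%R by rewrite normr_gt0 addr_eq0.
have n1 : (`|x - y| <= 2)%R by rewrite (le_trans (ler_normB _ _))// (_ : 2 = 1 + 1)%R// lerD.
have n2 : (`|x + y| <= 2)%R by rewrite (le_trans (ler_normD _ _))// (_ : 2 = 1 + 1)%R// lerD.
rewrite opprK !max_r ?ln_ge0 ?ler_pdivlMr ?mul1r//.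
rewrite -lnM ?posrE ?divr_gt0//; congr ln.
by rewrite subr_sqr normrM; field; rewrite !gt_eqF.
Qed.

Lemma log_kernel_even_ge0 x y : 0 <= log_kernel_even x y.
Proof. by rewrite adde_ge0// log_kernel_ge0. Qed.

Lemma measurable_log_kernel_even x : measurable_fun setT (log_kernel_even x : TR -> \bar R).
Proof.
have mN : measurable_fun setT (-%R : TR -> R) by meas_rules.
apply: emeasurable_funD; apply: (measurableT_comp (@measurable_log_kernel R));
  apply/measurable_fun_pairP; split; [exact: measurable_cst|exact: measurable_id|
  exact: measurable_cst|exact: mN].
Qed.

(** The value on the arcs of the potential of the measure arc_density k on
    both arcs. *)
Definition arc_constant k : \bar R := (ln (4 / (1 - k ^+ 2)) * (pi / 2))%:E + lsin_mass.

Lemma arc_constant_lty k : arc_constant k < +oo.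
Proof. by rewrite lte_add_pinfty// ?ltry// lsin_mass_lty. Qed.

Lemma arc_constant_angle k al : (0 <= k < 1)%R -> (0 <= al <= pi / 2)%R ->
  \int[leb]_(t in H) ((ln (4 / (1 - k ^+ 2)))%:E + (lsin (t - al) + lsin (t + al))) =
  arc_constant k.
Proof.
move=> k01 al01; have [_ k2] := ellD_arg_gt0 0 k01; have p0 := pi2_gt0.
have ml := measurable_lsin.
have msh c : measurable_fun setT (fun t : TR => lsin (t + c)).
  apply: (measurableT_comp ml); meas_rules.
have l0 : (0 <= ln (4 / (1 - k ^+ 2)))%R.
  by rewrite ln_ge0// ler_pdivlMr// mul1r; have := sqr_ge0 k; lra.
rewrite (ge0_integralD leb (measurable_itv _) (f1 := cst (ln (4 / (1 - k ^+ 2)))%:E) (f2 := fun t => lsin (t - al) + lsin (t + al))) //.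
- rewrite integral_lsin_pair// integral_cst//= lebesgue_measure_itv/= lte_fin p0.
  by rewrite -EFinB subr0 EFinM.
- by move=> t _; rewrite adde_ge0// lsin_ge0.
- by apply: measurable_funTS; apply: emeasurable_funD; exact: msh.
Qed.

Lemma sinD_sinB (t al : R) : (sin (t - al) * sin (t + al) = sin t ^+ 2 - sin al ^+ 2)%R.
Proof. by rewrite sinB sinD; have := cos2Dsin2 t; have := cos2Dsin2 al; nra. Qed.

Lemma lsin_pairE k t al : (0 < 1 - k ^+ 2)%R ->
  (ln (4 / (1 - k ^+ 2)))%:E + (lsin (t - al) + lsin (t + al)) =
  if (sin t ^+ 2 == sin al ^+ 2)%R then +oo else (ln (4 / ((1 - k ^+ 2) * `|sin t ^+ 2 - sin al ^+ 2|)))%:E.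
Proof.
move=> k0; rewrite -(subr_eq0 (sin t ^+ 2)%R) -sinD_sinB mulf_eq0 /lsin.
have [e|e] /= := eqVneq (sin (t - al)) 0%R; first by case: ifP.
have [e'|e'] /= := eqVneq (sin (t + al)) 0%R; first by [].
rewrite -!EFinD; congr (_%:E); rewrite normrM.
have d1 : (0 < `|sin (t - al)|)%R by rewrite normr_gt0.
have d2 : (0 < `|sin (t + al)|)%R by rewrite normr_gt0.
by rewrite -!lnV ?posrE// -!lnM ?posrE ?mulr_gt0 ?invr_gt0//; congr ln; rewrite !invfM; ring.
Qed.

(** With sin^2 al = (x^2 - k^2) / (1 - k^2), the kernel at the point y(t) of
    the arc is log (4 / (1 - k^2)) - log |sin (t - al)| - log |sin
    (t + al)|. *)
Lemma potential_arc_outside k x : (0 <= k < 1)%R -> (k <= `|x| <= 1)%R ->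
  \int[leb]_(t in H) log_kernel_even x (cutpar k t) = arc_constant k.
Proof.
move=> k01 /andP[kx x1]; have [_ k2] := ellD_arg_gt0 0 k01; have p0 := pi2_gt0.
have /andP[k0 k1] := k01.
pose s := Num.sqrt ((x ^+ 2 - k ^+ 2) / (1 - k ^+ 2)).
have kx2 : (k ^+ 2 <= x ^+ 2)%R by rewrite -(real_normK (num_real x)) ler_pXn2r ?nnegrE.
have x2 : (x ^+ 2 <= 1)%R by rewrite -(real_normK (num_real x)) expr_le1.
have q0 : (0 <= (x ^+ 2 - k ^+ 2) / (1 - k ^+ 2))%R by rewrite divr_ge0 ?(ltW k2)// subr_ge0.
have s1 : (0 <= s <= 1)%R.
  rewrite sqrtr_ge0/= -[leRHS]sqrtr1 ler_wsqrtr// ler_pdivrMr// mul1r lerD2r//.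
have s11 : (-1 <= s <= 1)%R by have /andP[s1a s1b] := s1; rewrite s1b andbT (le_trans _ s1a)// lerN10.
have sE : sin (asin s) = s by rewrite asinK// in_itv.
have al01 : (0 <= asin s <= pi / 2)%R.
  rewrite asin_lepi2// andbT leNgt; apply/negP => a0.
  have := @sin_gt0_pi _ (- asin s)%R; rewrite sinN sE oppr_gt0 a0/= => h3.
  have h2 := @asin_geNpi2 R _ s11.
  have : (0 < - s)%R by apply: h3; have := p0; move: (asin s) h2 => u; lra.
  by have /andP[s1a _] := s1; rewrite oppr_gt0 ltNge s1a.
rewrite -(arc_constant_angle k01 al01); apply: eq_integral => t _.
have /andP[c0 c1] := cutpar_bounds t k01.
rewrite log_kernel_evenE//; last by rewrite ger0_norm ?cutpar_ge0.
rewrite sqr_cutpar lsin_pairE// sE sqr_sqrtr//.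
have e : (x ^+ 2 - (k ^+ 2 + (1 - k ^+ 2) * sin t ^+ 2) =
   - ((1 - k ^+ 2) * (sin t ^+ 2 - (x ^+ 2 - k ^+ 2) / (1 - k ^+ 2))))%R.
  by field; rewrite gt_eqF.
rewrite -[in LHS]subr_eq0 e oppr_eq0 mulf_eq0 (gt_eqF k2)/= subr_eq0.
by rewrite normrN normrM (gtr0_norm k2).
Qed.

(** In the gap, |x^2 - y(t)^2| is at least (1 - k^2) sin^2 t, its value for
    |x| = k, so the potential is bounded by the one at the end of an arc. *)
Lemma potential_arc_inside k x : (0 <= k < 1)%R -> (`|x| < k)%R ->
  \int[leb]_(t in H) log_kernel_even x (cutpar k t) <= arc_constant k.
Proof.
move=> k01 xk; have [_ k2] := ellD_arg_gt0 0 k01; have p0 := pi2_gt0.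
have /andP[k0 k1] := k01.
have x1 : (`|x| <= 1)%R by rewrite ltW// (lt_trans xk).
have al01 : (0 <= (0 : R) <= pi / 2)%R by rewrite lexx ltW.
rewrite -(arc_constant_angle k01 al01).
have mcut : measurable_fun setT (cutpar k : TR -> R) by exact: measurable_cutpar.
have ml := measurable_lsin.
have msh c : measurable_fun setT (fun t : TR => lsin (t + c)).
  apply: (measurableT_comp ml); meas_rules.
apply: ge0_le_integral => //.
- by move=> t _; exact: log_kernel_even_ge0.
- by apply: measurable_funTS; exact: (measurableT_comp (measurable_log_kernel_even x) mcut).
- apply: measurable_funTS; apply: emeasurable_funD; first exact: measurable_cst.
  apply: emeasurable_funD; exact: msh.
- move=> t _; have /andP[c0 c1] := cutpar_bounds t k01.
  rewrite log_kernel_evenE//; last by rewrite ger0_norm ?cutpar_ge0.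
  rewrite lsin_pairE// sin0 expr0n/= subr0 sqr_cutpar.
  have x2 : (x ^+ 2 < k ^+ 2)%R by rewrite -(real_normK (num_real x)) ltr_pXn2r ?nnegrE.
  have s0 := sqr_ge0 (sin t).
  case: ifPn => sx; first by move/eqP: sx => sx; exfalso; nra.
  case: ifPn => st; first exact: leey.
  have st0 : (0 < sin t ^+ 2)%R by rewrite lt_neqAle eq_sym st.
  rewrite lee_fin ler_ln ?posrE ?divr_gt0 ?mulr_gt0 ?normr_gt0//; last by rewrite subr_eq0.
  rewrite ler_pM2l// lef_pV2 ?posrE ?mulr_gt0 ?normr_gt0//; last by rewrite subr_eq0.
  rewrite (gtr0_norm st0) distrC ger0_norm; nra.
Qed.

End sine_logarithm.

(** * The measure on the two cuts and its potential *)

Section potentials.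
Context (R : realType).
Local Notation leb := (@lebesgue_measure R).
Local Notation TR := (measurableTypeR R).
Local Notation H := (`[0%R, ((pi : R) / 2)%R]%classic).
Implicit Types (a b c t x y k q tau : R).

Local Open Scope ereal_scope.

(** The integral of a nonnegative function is a supremum over the simple
    functions below it. *)
Lemma le_integral_ge0 d (T : measurableType d) (mu : {measure set T -> \bar R}) (D : set T) (f g : T -> \bar R) :
  (forall u, D u -> 0 <= f u) -> (forall u, D u -> f u <= g u) ->
  \int[mu]_(x in D) f x <= \int[mu]_(x in D) g x.
Proof.
move=> f0 fg; rewrite !ge0_integralE//; last first.
  by move=> x Dx; exact: le_trans (f0 _ Dx) (fg _ Dx).
apply: le_ereal_sup => _ [h hf <-]; exists h => // x.
apply: le_trans (hf x) _.
by apply: lee_restrict.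
Qed.

Lemma measurable_reflect_sum (h : TR -> \bar R) : measurable_fun setT h ->
  measurable_fun setT (fun y : TR => h y + h (- y)%R).
Proof.
move=> mh; apply: emeasurable_funD => //; apply: (measurableT_comp mh).
by meas_rules.
Qed.

Lemma integral_sym_fold a b (h : TR -> \bar R) : measurable_fun setT h -> (forall x, 0 <= h x) ->
  \int[leb]_(y in `[a, b]) h y + \int[leb]_(y in `[(- b)%R, (- a)%R]) h y =
  \int[leb]_(y in `[a, b]) (h y + h (- y)%R).
Proof.
move=> mh h0; have mN : measurable_fun setT (fun y : TR => h (- y)%R).
  by apply: (measurableT_comp mh); meas_rules.
rewrite (ge0_integralD leb (measurable_itv _) (fun y _ => h0 y) (measurable_funTS mh)
  (fun y _ => h0 _) (measurable_funTS mN)).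
congr (_ + _); rewrite (ge0_integral_reflect (measurable_itv _) mh h0).
congr (integral _ _ _); apply/seteqP; split => x /=; rewrite !in_itv/= !lerN2.
  by move=> /andP[-> ->].
by move=> /andP[-> ->].
Qed.

Lemma integral_lambda (h : TR -> \bar R) : measurable_fun setT h -> (forall x, 0 <= h x) ->
  \int[@lambda R]_y h y = (2^-1)%:E * \int[leb]_(y in `[0%R, 1%R]) (h y + h (- y)%R).
Proof.
move=> mh h0; rewrite (integral_uniform (@ltN11 R) mh h0).
congr ((_^-1)%:E * _); first by rewrite opprK.
rewrite -integral_sym_fold// oppr0 addeC -ge0_integral_itv_split//.
Qed.

(** The absolute value of tau makes the weight nonnegative for all
    parameters, so that it always defines a measure. *)
Definition cut_weight tau b y : R := (eq_density `|tau| b y * \1_(two_cut b : set TR) y)%R.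

Lemma measurable_two_cut b : measurable (two_cut b : set TR).
Proof. by apply: measurableU; exact: measurable_itv. Qed.

Lemma cut_weight_ge0 tau b y : (0 <= cut_weight tau b y)%R.
Proof. by rewrite mulr_ge0// eq_density_ge0. Qed.

Lemma measurable_cut_weight tau b : measurable_fun setT (cut_weight tau b : TR -> R).
Proof.
apply: measM; first exact: measurable_eq_density.
by apply: measurable_indic; exact: measurable_two_cut.
Qed.

Definition cut_weighted tau b : {measure set TR -> \bar R} :=
  weighted leb (cut_weight_ge0 tau b) (measurable_cut_weight tau b).

Lemma integral_cut_weighted tau b (h : TR -> \bar R) : (0 < b < 1)%R -> (0 <= tau)%R ->
  measurable_fun setT h -> (forall x, 0 <= h x) ->
  \int[cut_weighted tau b]_y h y =
  tau%:E * \int[leb]_(y in `[b, 1%R]) ((h y + h (- y)%R) * (eq_density 1 b y)%:E).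
Proof.
move=> b01 tau0 mh h0; have /andP[b0 b1] := b01.
rewrite (ge0_integral_weighted leb (cut_weight_ge0 tau b) (measurable_cut_weight tau b))//.
pose f y := h y * (eq_density tau b y)%:E.
have mf : measurable_fun setT (f : TR -> \bar R).
  by apply: emeasurable_funM => //; apply/measurable_EFinP; exact: measurable_eq_density.
have f0 y : 0 <= f y by rewrite mule_ge0// lee_fin eq_density_ge0.
have -> : \int[leb]_y (h y * (cut_weight tau b y)%:E) = \int[leb]_(y in two_cut b) f y.
  rewrite [RHS]integral_mkcond; apply: eq_integral => y _.
  rewrite patchE /cut_weight indicE ger0_norm//; case: ifP => _; first by rewrite mulr1.
  by rewrite mulr0 mule0.
rewrite /two_cut ge0_integral_setU//; last 2 first.
- exact: measurable_funTS.
- apply/disj_setPS => y [] /=; rewrite !in_itv/= => /andP[_ yb] /andP[by_ _]; lra.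
rewrite addeC integral_sym_fold//.
rewrite -(ge0_integralZl_EFin leb (measurable_itv _) _ _ tau0).
- apply: eq_integral => y _; rewrite /f eq_densityN eq_densityZ EFinM.
  rewrite -ge0_muleDl//.
  by rewrite muleCA.
- by move=> y _; rewrite mule_ge0 ?adde_ge0// lee_fin eq_density_ge0.
- apply: measurable_funTS; apply: emeasurable_funM; first exact: measurable_reflect_sum.
  by apply/measurable_EFinP; exact: measurable_eq_density.
Qed.

(** The mass is tau (E(b) - 1). *)
Lemma cut_weighted_mass tau b : (0 < b < 1)%R -> (0 < tau)%R -> ellE b = (tau^-1 + 1)%R ->
  cut_weighted tau b setT = 1.
Proof.
move=> b01 tau0 Eb.
have := @integral_cut_weighted tau b (cst 1) b01 (ltW tau0) (measurable_cst _) (fun=> lee01).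
rewrite integral_cst//= mul1e => ->.
have -> : \int[leb]_(y in `[b, 1%R]) ((1 + 1) * (eq_density 1 b y)%:E) =
   2%:E * \int[leb]_(y in `[b, 1%R]) (eq_density 1 b y)%:E.
  rewrite -(ge0_integralZl_EFin leb (measurable_itv _)) //.
  - by move=> y _; rewrite lee_fin eq_density_ge0.
  - by apply/measurable_EFinP; apply: measurable_funTS; exact: measurable_eq_density.
rewrite eq_density_mass// Eb -!EFinM; congr (_%:E).
by field; rewrite gt_eqF.
Qed.

(** The normalization makes this a probability measure for all parameters;
    it does nothing when E(b) = 1 / tau + 1. *)
Definition cut_measure tau b : probability TR R := mnormalize (cut_weighted tau b) (dirac (0%R : TR)).

Lemma cut_measureE tau b : (0 < b < 1)%R -> (0 < tau)%R -> ellE b = (tau^-1 + 1)%R ->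
  cut_measure tau b = cut_weighted tau b :> (set TR -> \bar R).
Proof.
move=> b01 tau0 Eb; apply/funext => A; rewrite /cut_measure /= /mnormalize (cut_weighted_mass b01 tau0 Eb).
by rewrite onee_eq0 /= invr1 mule1.
Qed.

Lemma cut_measure_integral tau b (h : TR -> \bar R) : (0 < b < 1)%R -> (0 < tau)%R -> ellE b = (tau^-1 + 1)%R ->
  \int[cut_measure tau b]_y h y = \int[cut_weighted tau b]_y h y.
Proof.
move=> b01 tau0 Eb; apply: eq_measure_integral => A _ _.
by rewrite /= -/(cut_measure tau b) (cut_measureE b01 tau0 Eb).
Qed.

Definition kernel_potential (m : probability TR R) x := \int[m]_y log_kernel (x, y).

(** The largest value over [-1, 1] of the potential of the superposition of
    arcs in [angle_density_split], reached on the cuts. *)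
Definition inner_deficit b : \bar R :=
  (pi^-1)%:E * \int[leb]_(q in `[0%R, b]) ((ell_e q)%:E * arc_constant q).

Lemma arc_constant_ge0 q : (0 <= q < 1)%R -> 0 <= arc_constant q.
Proof.
move=> q01; have [_ k2] := ellD_arg_gt0 0 q01.
apply: adde_ge0; last by apply: integral_ge0 => t _; exact: lsin_ge0.
rewrite lee_fin mulr_ge0 ?divr_ge0 ?pi_ge0// ln_ge0// ler_pdivlMr// mul1r.
by have := sqr_ge0 q; lra.
Qed.

Lemma measurable_log_kernel1 x : measurable_fun setT (fun y : TR => log_kernel (x, y)).
Proof.
apply: (measurableT_comp (@measurable_log_kernel R)); apply/measurable_fun_pairP.
by split; [exact: measurable_cst|exact: measurable_id].
Qed.

Lemma log_kernel1_ge0 x (y : TR) : 0 <= log_kernel (x, y).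
Proof. exact: log_kernel_ge0. Qed.

(** The potential of [angle_density_split] at x. The term I comes from the
    arcs with parameter q <= b: each contributes its constant if |x| >= q,
    and at most this constant otherwise. The right side is a constant
    because x is always on the arc of parameter 0, which is [-1, 1]. *)
Lemma potential_identity tau b x : (0 < b < 1)%R -> (0 < tau)%R -> ellE b = (tau^-1 + 1)%R ->
  (`|x| <= 1)%R ->
  exists I : \bar R, [/\
    kernel_potential (cut_measure tau b) x + tau%:E * kernel_potential (@lambda R) x
    + tau%:E * I = tau%:E * ((2^-1)%:E * arc_constant 0),
    0 <= I <= inner_deficit b & ((b <= `|x|)%R -> I = inner_deficit b)].
Proof.
move=> b01 tau0 Eb x1; have /andP[b0 b1] := b01.
have mg := measurable_log_kernel_even x.
have g0 y := @log_kernel_even_ge0 R x y.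
have mk := measurable_log_kernel1 x; have k0 := log_kernel1_ge0 x.
have pi0 : (0 <= (pi : R)^-1)%R by rewrite invr_ge0 pi_ge0.
exists ((pi^-1)%:E * \int[leb]_(q in `[0%R, b]) ((ell_e q)%:E * \int[leb]_(t in H) log_kernel_even x (cutpar q t))).
have P0 q : 0 <= \int[leb]_(t in H) log_kernel_even x (cutpar q t) by apply: integral_ge0.
have qb01 q : `[0%R, b]%classic q -> (0 <= q < 1)%R.
  by rewrite /= in_itv/= => /andP[q0 qb]; rewrite q0 (le_lt_trans qb).
have Ple q : `[0%R, b]%classic q ->
   (ell_e q)%:E * \int[leb]_(t in H) log_kernel_even x (cutpar q t) <= (ell_e q)%:E * arc_constant q.
  move=> qb; have q01 := qb01 _ qb; have /andP[q0 _] := q01.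
  apply: lee_wpmul2l; first by rewrite lee_fin ell_e_ge0.
  have [qx|xq] := leP q `|x|%R; first by rewrite potential_arc_outside// qx.
  by rewrite potential_arc_inside.
split.
- have := angle_integral_split b01 mg g0.
  have -> : \int[leb]_(t in H) log_kernel_even x (sin t) = arc_constant 0.
    rewrite -(@potential_arc_outside R 0 x) ?lexx ?ltr01 ?normr_ge0//.
    apply: eq_integral => t; rewrite inE/= => /in_pihalf_cc[/andP[s0 _] _].
    by rewrite /cutpar expr0n/= mul0r add0r sqrtr_sqr ger0_norm.
  move=> ->; rewrite /kernel_potential (cut_measure_integral _ b01 tau0 Eb).
  rewrite (integral_cut_weighted b01 (ltW tau0) mk k0) (integral_lambda mk k0).
  rewrite -/(log_kernel_even x).
  set A := (2^-1)%:E * _; set B := \int[leb]_(y in `[b, 1%R]) _.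
  set C := _ * \int[leb]_(q in `[0%R, b]) _.
  have A0 : 0 <= A.
    apply: mule_ge0; first by rewrite lee_fin invr_ge0.
    by apply: integral_ge0 => y _; exact: g0.
  have B0 : 0 <= B.
    apply: integral_ge0 => y _; apply: mule_ge0; first exact: g0.
    by rewrite lee_fin eq_density_ge0.
  have C0 : 0 <= C.
    apply: mule_ge0; first by rewrite lee_fin.
    apply: integral_ge0 => q /qb01/andP[q0 _].
    by rewrite mule_ge0// lee_fin ell_e_ge0.
  by rewrite (ge0_muleDr _ (adde_ge0 A0 B0) C0) (ge0_muleDr _ A0 B0) (addeC (tau%:E * A)).
- apply/andP; split.
    apply: mule_ge0; first by rewrite lee_fin.
    apply: integral_ge0 => q /qb01/andP[q0 _].
    by rewrite mule_ge0// lee_fin ell_e_ge0.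
  apply: lee_wpmul2l; first by rewrite lee_fin.
  by apply: le_integral_ge0 => q qb; [have /andP[q0 _] := qb01 _ qb; rewrite mule_ge0// lee_fin ell_e_ge0|exact: Ple].
- move=> bx; congr (_ * _); apply: eq_integral => q; rewrite inE => qb.
  have q01 := qb01 _ qb; congr (_ * _); rewrite potential_arc_outside// x1 andbT.
  by move: qb; rewrite /= in_itv/= => /andP[_ /le_trans]; apply.
Qed.

End potentials.

(** * Identification of the equilibrium measure *)

Section identification.
Context (R : realType).
Local Notation TR := (measurableTypeR R).
Local Notation I11 := (`[-1, 1]%classic : set TR).
Implicit Types (a b c t x y k q tau : R) (m : probability TR R).

Lemma maxrN0 (r c : R) : r + c + Num.max (- r) 0 = Num.max r 0 + c.
Proof.
by have [r0|r0] := leP r 0; [rewrite max_l ?oppr_ge0//|rewrite max_r ?oppr_le0 ?ltW//]; lra.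
Qed.

Local Open Scope ereal_scope.

Lemma ereal_cancel_finite (S I J : \bar R) tau (kap : R) : (0 < tau)%R -> 0 <= S -> 0 <= I ->
  S + tau%:E * I = kap%:E -> I <= J -> J \is a fin_num ->
  (kap - tau * fine J)%:E <= S /\ S < +oo /\ (I = J -> S = (kap - tau * fine J)%:E).
Proof.
move=> t0; case: S => [s| |] s0; case: I => [i| |] i0 //; rewrite ?gt0_muley ?lte_fin//=.
  rewrite -EFinM -EFinD => -[e] iJ /fineK JE; move: iJ; rewrite -JE lee_fin => ij.
  rewrite lee_fin ltry; split; first by have := ler_wpM2l (ltW t0) ij; lra.
  by split => // -[<-]; rewrite -e addrK.
Qed.

Lemma ereal_summand_finite (S I : \bar R) tau (kap : R) : (0 < tau)%R -> 0 <= S -> 0 <= I ->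
  S + tau%:E * I = kap%:E -> I \is a fin_num.
Proof.
by move=> t0; case: S => [s| |] s0; case: I => [i| |] i0 //; rewrite ?gt0_muley ?lte_fin.
Qed.

(** The equilibrium conditions for the measure on the two cuts: in
    [potential_identity] the term I is finite, and it is largest on the
    cuts, so that the rest is smallest there. *)
Lemma cut_potential tau b : (0 < b < 1)%R -> (0 < tau)%R -> ellE b = (tau^-1 + 1)%R ->
  let S x := kernel_potential (cut_measure tau b) x + tau%:E * kernel_potential (@lambda R) x in
  exists w : R, [/\ forall x, (`|x| <= 1)%R -> w%:E <= S x,
    forall x, (`|x| <= 1)%R -> S x < +oo
    & forall x, (b <= `|x|)%R -> (`|x| <= 1)%R -> S x = w%:E].
Proof.
move=> b01 tau0 Eb S; have /andP[b0 b1] := b01.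
have S0 x : 0 <= S x.
  have U0 m : 0 <= kernel_potential m x by apply: integral_ge0 => y _; exact: log_kernel1_ge0.
  by rewrite adde_ge0// mule_ge0// lee_fin ltW.
have Cfin : tau%:E * ((2^-1)%:E * arc_constant 0) \is a fin_num.
  rewrite fin_numM// fin_numM// ge0_fin_numE ?arc_constant_lty// arc_constant_ge0//.
  by rewrite lexx ltr01.
have e := fineK Cfin; set kap := fine _ in e.
have inner_fin : inner_deficit b \is a fin_num.
  have n1 : (`|1%R : R| <= 1)%R by rewrite normr1.
  have [I [h /andP[I0 IJ] IE]] := potential_identity b01 tau0 Eb n1.
  rewrite -IE ?normr1 ?ltW//; move: h; rewrite -e.
  exact: (ereal_summand_finite tau0 (S0 1%R) I0).
exists (kap - tau * fine (inner_deficit b))%R; split.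
- move=> x x1; have [I [h /andP[I0 IJ] IE]] := potential_identity b01 tau0 Eb x1.
  rewrite -e in h.
  by have [] := ereal_cancel_finite tau0 (S0 x) I0 h IJ inner_fin.
- move=> x x1; have [I [h /andP[I0 IJ] IE]] := potential_identity b01 tau0 Eb x1.
  rewrite -e in h.
  by have [_ []] := ereal_cancel_finite tau0 (S0 x) I0 h IJ inner_fin.
- move=> x bx x1; have [I [h /andP[I0 IJ] IE]] := potential_identity b01 tau0 Eb x1.
  rewrite -e in h.
  by have [_ [_]] := ereal_cancel_finite tau0 (S0 x) I0 h IJ inner_fin; apply; exact: IE.
Qed.

Lemma integral_prob_cst m (D : set TR) c : measurable D -> m D = 1 ->
  \int[m]_(y in D) c%:E = c%:E.
Proof.
move=> mD mD1; transitivity (c%:E * m D); first exact: integral_cst.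
by rewrite mD1 mule1.
Qed.

(** Here f is bounded below on a set of full measure but may have infinite
    integral; the negative part is finite and can be moved to the other
    side. *)
Lemma integral_shift_bounded m (D : set TR) (f K : TR -> \bar R) c : measurable D -> m D = 1 ->
  (0 <= c)%R -> measurable_fun setT f -> measurable_fun setT K ->
  (forall y, 0 <= K y) -> (forall y, D y -> K y = f y + c%:E) ->
  \int[m]_y f y = \int[m]_y K y - c%:E.
Proof.
move=> mD mD1 c0 mf mK K0 KE.
rewrite (integral_concentrated mD mD1 mf) (integral_concentrated mD mD1 mK) integralE.
have mfp : measurable_fun D (f^\+) by apply: measurable_funTS; exact: measurable_funepos.
have mfn : measurable_fun D (f^\-) by apply: measurable_funTS; exact: measurable_funeneg.
have fnc y : D y -> f^\- y <= c%:E.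
  move=> Dy; rewrite funenegE ge_max lee_fin c0 andbT.
  have := K0 y; rewrite KE//; case: (f y) => [r| |] // h; last by rewrite leNye.
  by move: h; rewrite -EFinD !lee_fin; lra.
have e1 : \int[m]_(y in D) K y + \int[m]_(y in D) f^\- y =
   \int[m]_(y in D) f^\+ y + \int[m]_(y in D) c%:E.
  rewrite -(ge0_integralD m mD (fun y _ => K0 y) (measurable_funTS mK) (fun y _ => funeneg_ge0 _ y) mfn).
  rewrite -(ge0_integralD m mD (fun y _ => funepos_ge0 _ y) mfp (f2 := cst c%:E) (fun _ _ => c0) (measurable_cst _)).
  apply: eq_integral => y; rewrite inE => Dy; rewrite KE//.
  have := fnc y Dy.
  rewrite funenegE funeposE; case: (f y) => [r| |] //= _.
    by rewrite -!EFin_max -!EFinD maxrN0.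
  by rewrite max_r ?leNye// max_l ?leey// adde0.
have c1 : \int[m]_(y in D) c%:E = c%:E by exact: integral_prob_cst.
have nfin : \int[m]_(y in D) f^\- y \is a fin_num.
  rewrite ge0_fin_numE; last by apply: integral_ge0 => y _; exact: funeneg_ge0.
  apply: (@le_lt_trans _ _ (\int[m]_(y in D) c%:E)); last by rewrite c1 ltry.
  by apply: le_integral_ge0 => // y _; exact: funeneg_ge0.
move: e1; rewrite c1 -(fineK nfin).
have : 0 <= \int[m]_(y in D) f^\+ y by apply: integral_ge0 => y _; exact: funepos_ge0.
have : 0 <= \int[m]_(y in D) K y by exact: integral_ge0.
case: (\int[m]_(y in D) f^\+ y) => [r| |] //; case: (\int[m]_(y in D) K y) => [r'| |] // _ _.
rewrite -!EFinD => -[e]; congr EFin; lra.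
Qed.

(** On [-1, 1] the two kernels differ by log 2. *)
Lemma log_potentialE m x : m I11 = 1 -> (`|x| <= 1)%R ->
  log_potential m x%:C%C = kernel_potential m x - (ln 2)%:E.
Proof.
move=> m1 x1; rewrite /log_potential.
pose f (y : TR) := if x == y then +oo else (- ln `|x - y|)%:E.
have fE (y : TR) : lne (inve (Normc.normc ((y : R)%:C - x%:C)%C)%:E) = f y.
  rewrite -rmorphB /= expr0n/= addr0 sqrtr_sqr /f.
  have [->|xy] := eqVneq x y; first by rewrite subrr normr0 /inve eqxx.
  have d0 : (0 < `|x - y|)%R by rewrite normr_gt0 subr_eq0.
  by rewrite distrC /inve gt_eqF//= leNgt invr_gt0 d0/= lnV.
under eq_integral do rewrite fE.
have mf : measurable_fun setT (f : TR -> \bar R).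
  apply: measurable_fun_ifT => //.
    by apply: (@measurable_fun_eqr _ _ R _ (cst x) id); [exact: measurable_cst|exact: measurable_id].
  by apply/measurable_EFinP; meas_rules.
apply: (integral_shift_bounded (measurable_itv _) m1 _ mf (measurable_log_kernel1 x) (log_kernel1_ge0 x)).
  by rewrite ln_ge0// ler1n.
move=> y; rewrite /= in_itv/= -ler_norml => y1; rewrite /f /log_kernel/=.
case: ifPn => // xy; rewrite -EFinD; congr (_%:E).
have d0 : (0 < `|x - y|)%R by rewrite normr_gt0 subr_eq0.
have d2 : (`|x - y| <= 2)%R by rewrite (le_trans (ler_normB _ _))// (_ : 2 = 1 + 1)%R// lerD.
rewrite max_r ?ln_ge0 ?ler_pdivlMr ?mul1r//.
by rewrite ln_div ?posrE// addrC.
Qed.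

(** The complement of the support is covered by the countably many rational
    open intervals of measure 0. *)
Lemma ae_msupport m : {ae m, forall x, msupport m x}.
Proof.
pose F (n : nat) : set TR := match unpickle n with
  | Some (p, q) => if `[< m (`]ratr p, ratr q[%classic : set TR) = 0 >] then `]ratr p, ratr q[%classic else set0
  | None => set0 end.
have Fn n : m.-negligible (F n).
  rewrite /F; case: unpickle => [[p q]|]; last exact: negligible_set0.
  case: asboolP => h; last exact: negligible_set0.
  by apply/negligibleP => //; exact: measurable_itv.
apply: negligibleS (negligible_bigcup Fn) => x /= xs.
have [U [[oU Ux] mU]] : exists U : set R, open_nbhs x U /\ m U = 0.
  apply: contrapT => h; apply: xs => U oU; rewrite lt0e measure_ge0 andbT.
  by apply/negP => /eqP mU; apply: h; exists U.
have [e /= e0 eU] : exists2 e : R, (0 < e)%R & ball x e `<=` U.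
  by have /nbhs_ballP[e /= e0 eU] := open_nbhs_nbhs (conj oU Ux); exists e.
have [p pI] : exists p : rat, ratr p \in `](x - e)%R, x[ by apply: rat_in_itvoo; rewrite ltrBlDr ltrDl.
have [q qI] : exists q : rat, ratr q \in `]x, (x + e)%R[ by apply: rat_in_itvoo; rewrite ltrDl.
move: pI qI; rewrite !in_itv/= => /andP[p1 p2] /andP[q1 q2].
exists (pickle (p, q)); first exact: I.
rewrite /F; rewrite (pickleK (p, q)).
case: asboolP => [_|h]; first by rewrite /= in_itv/= p2 q1.
exfalso; apply: h; apply/eqP; rewrite eq_le measure_ge0 andbT -mU.
apply: le_measure; rewrite ?inE; [exact: measurable_itv|exact: open_measurable|].
move=> y /= yI; apply: eU; move: yI; rewrite in_itv/= => /andP[y1 y2].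
rewrite /ball/= ltr_norml; apply/andP; split; lra.
Qed.

Lemma cut_measure_full tau b (A : set TR) : (0 < b < 1)%R -> (0 < tau)%R -> ellE b = (tau^-1 + 1)%R ->
  measurable A -> two_cut b `<=` A -> cut_measure tau b A = 1.
Proof.
move=> b01 tau0 Eb mA bA; rewrite (cut_measureE b01 tau0 Eb) -(cut_weighted_mass b01 tau0 Eb).
rewrite /cut_weighted /= /weighted [LHS]integral_mkcond; apply: eq_integral => y _.
rewrite patchE; case: ifPn => //; rewrite notin_setE => Ay.
by rewrite /cut_weight indicE memNset ?mulr0// => /bA.
Qed.

Lemma two_cut_sub b : (0 <= b)%R -> two_cut b `<=` I11.
Proof.
move=> b0 y [] /=; rewrite !in_itv/= => /andP[y0 y1]; apply/andP; split => //; lra.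
Qed.

Lemma lambda_mass : @lambda R I11 = 1.
Proof.
have mi : measurable_fun setT (fun y : TR => (\1_I11 y)%:E : \bar R).
  by apply/measurable_EFinP; apply: measurable_indic; exact: measurable_itv.
have i0 (y : TR) : 0 <= (\1_I11 y)%:E :> \bar R by rewrite lee_fin.
have := @integral_lambda R (fun y => (\1_I11 y)%:E) mi i0.
rewrite integral_indic//.
rewrite setIT => ->.
rewrite (eq_integral (cst 2%:E)).
  rewrite integral_cst//= lebesgue_measure_itv/= lte_fin ltr01 -EFinB subr0 mule1 -EFinM.
  by rewrite mulVf.
move=> y; rewrite inE/= in_itv/= => /andP[y0 y1].
rewrite !indicE !mem_set ?EFinD//= in_itv/= ?y1 ?andbT; lra.
Qed.

Definition total_potential tau m x :=
  kernel_potential m x + tau%:E * kernel_potential (@lambda R) x.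

Lemma kernel_potential_ge0 m x : 0 <= kernel_potential m x.
Proof. by apply: integral_ge0 => y _; exact: log_kernel1_ge0. Qed.

Lemma measurable_kernel_potential m : measurable_fun setT (kernel_potential m : TR -> \bar R).
Proof.
exact: (@measurable_fun_fubini_tonelli_F _ _ TR TR R m (@log_kernel R) (@measurable_log_kernel R) (@log_kernel_ge0 R)).
Qed.

Lemma total_potential_ge0 tau m x : (0 <= tau)%R -> 0 <= total_potential tau m x.
Proof.
by move=> t0; rewrite adde_ge0 ?kernel_potential_ge0// mule_ge0 ?lee_fin ?kernel_potential_ge0.
Qed.

Lemma measurable_total_potential tau m : measurable_fun setT (total_potential tau m : TR -> \bar R).
Proof.
apply: emeasurable_funD; first exact: measurable_kernel_potential.
by apply: measurable_funeM; exact: measurable_kernel_potential.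
Qed.

Lemma integral_total_potential tau m n : (0 <= tau)%R ->
  \int[m]_x total_potential tau n x =
  mutual_energy (@log_kernel R) m n + tau%:E * \int[m]_x kernel_potential (@lambda R) x.
Proof.
move=> t0.
have mz : measurable_fun setT (fun x : TR => tau%:E * kernel_potential (@lambda R) x).
  by apply: measurable_funeM; exact: measurable_kernel_potential.
have z0 (x : TR) : setT x -> 0 <= tau%:E * kernel_potential (@lambda R) x.
  by move=> _; rewrite mule_ge0 ?lee_fin ?kernel_potential_ge0.
rewrite (ge0_integralD m measurableT (fun x _ => kernel_potential_ge0 n x)
  (@measurable_kernel_potential n) z0 mz); congr (_ + _).
exact: (ge0_integralZl_EFin m measurableT (fun x _ => kernel_potential_ge0 _ x)
  (@measurable_kernel_potential _) t0).
Qed.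

Lemma integral_ge_const m (D : set TR) (f : TR -> \bar R) c : measurable D -> m D = 1 ->
  measurable_fun setT f -> (forall y, 0 <= f y) -> (forall y, D y -> c%:E <= f y) ->
  c%:E <= \int[m]_y f y.
Proof.
move=> mD mD1 mf f0 fc.
have [c0|c0] := leP c 0%R.
  by apply: (@le_trans _ _ 0); [rewrite lee_fin|exact: integral_ge0].
rewrite (integral_concentrated mD mD1 mf) -[leLHS]mule1 -mD1 -integral_cst//.
by apply: le_integral_ge0 => // y _; rewrite lee_fin ltW.
Qed.

(** The equilibrium conditions in terms of the kernel log (2 / |x - y|),
    whose potentials are larger by (1 + tau) log 2 in total. *)
Lemma equilibrium_total_potential tau m : (0 < tau)%R -> is_equilibrium_measure tau m ->
  (forall x, (`|x| <= 1)%R -> kernel_potential (@lambda R) x < +oo) ->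
  exists w : R, [/\ forall x, (`|x| <= 1)%R -> w%:E <= total_potential tau m x
    & forall x, (`|x| <= 1)%R -> msupport m x -> total_potential tau m x = w%:E].
Proof.
move=> t0 [m1 [om /= [h1 h2]]] lfin; exists (om + (1 + tau) * ln 2)%R.
have W x : (`|x| <= 1)%R -> total_potential tau m x =
   log_potential m x%:C%C + tau%:E * log_potential (@lambda R) x%:C%C + ((1 + tau) * ln 2)%:E.
  move=> x1; rewrite !log_potentialE//; last exact: lambda_mass.
  rewrite /total_potential; have := lfin x x1.
  have := kernel_potential_ge0 (@lambda R) x; have := kernel_potential_ge0 m x.
  case: (kernel_potential (lambda R) x) => [l| |] // _ _ _.
  case: (kernel_potential m x) => [r| |] //.
  by rewrite -!EFinB -!EFinM -!EFinD; congr (_%:E); ring.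
split=> x x1.
  rewrite W// EFinD leeD2r// h2//; by rewrite -ler_norml.
by move=> sx; rewrite W// h1// EFinD.
Qed.

(** Let W_m and W_n be the total potentials of the two measures. Each is
    constant almost everywhere for its own measure and at least that
    constant on [-1, 1], so W_m integrates to no less against n than against
    m, and W_n to no less against m than against n. In the sum of the two
    inequalities the terms in lambda cancel, and what remains is the
    hypothesis of [energy_uniqueness]. *)
Lemma equilibrium_unique tau b m : (0 < b < 1)%R -> (0 < tau)%R -> ellE b = (tau^-1 + 1)%R ->
  is_equilibrium_measure tau m -> forall A, measurable A -> m A = cut_measure tau b A.
Proof.
move=> b01 t0 Eb hm; have /andP[b0 b1] := b01.
have [w [Sge Slt Seq]] := cut_potential b01 t0 Eb.
have lfin x : (`|x| <= 1)%R -> kernel_potential (@lambda R) x < +oo.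
  move=> x1; have := Slt x x1; have := kernel_potential_ge0 (cut_measure tau b) x.
  have := kernel_potential_ge0 (@lambda R) x.
  case: (kernel_potential (lambda R) x) => [l| |] //; first by rewrite ltry.
  by rewrite gt0_muley ?lte_fin//; case: (kernel_potential _ x).
have [w' [Mge Meq]] := equilibrium_total_potential t0 hm lfin.
have m1 : m I11 = 1 by case: hm.
set n := cut_measure tau b in Sge Slt Seq *.
have n1 : n I11 = 1 by apply: (cut_measure_full b01 t0 Eb (measurable_itv _)); exact/two_cut_sub/ltW.
have n2 : n (two_cut b) = 1 by apply: (cut_measure_full b01 t0 Eb (measurable_two_cut b)).
have I1 (x : TR) : I11 x -> (`|x : R| <= 1)%R by rewrite /= in_itv/= ler_norml.
have mt (k : probability TR R) := @measurable_total_potential tau k.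
have tp0 (k : probability TR R) x := @total_potential_ge0 tau k x (ltW t0).
have e1 : \int[m]_x total_potential tau m x = w'%:E.
  rewrite (integral_concentrated (measurable_itv _) m1 (mt m)).
  rewrite (ae_eq_integral (cst w'%:E))//.
  - by apply: integral_prob_cst => //; exact: measurable_itv.
  - exact: measurable_funTS.
  - apply: negligibleS (ae_msupport m) => x /= h sx; apply: h => /I1 x1; exact: Meq.
have e2 : \int[n]_x total_potential tau n x = w%:E.
  rewrite (integral_concentrated (measurable_two_cut b) n2 (mt n)).
  rewrite (eq_integral (cst w%:E)); first exact: (integral_prob_cst _ (measurable_two_cut b) n2).
  move=> x; rewrite inE => xb; apply: Seq; last exact/I1/(two_cut_sub (ltW b0)).
  case: xb; rewrite /= in_itv/= => /andP[x0 x1]; last by rewrite ler_normr x0.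
  by rewrite ler_normr; apply/orP; right; lra.
have e3 : w'%:E <= \int[n]_x total_potential tau m x.
  by apply: (integral_ge_const (measurable_itv _) n1) => // x /I1; exact: Mge.
have e4 : w%:E <= \int[m]_x total_potential tau n x.
  by apply: (integral_ge_const (measurable_itv _) m1) => // x /I1; exact: Sge.
have t0' := ltW t0.
move: e1 e2 e3 e4; rewrite !integral_total_potential//.
have E0 (k l : probability TR R) : 0 <= mutual_energy (@log_kernel R) k l by apply: mutual_energy_ge0; exact: log_kernel_ge0.
have L0 (k : probability TR R) : 0 <= \int[k]_x kernel_potential (@lambda R) x.
  by apply: integral_ge0 => x _; exact: kernel_potential_ge0.
have := E0 m m; have := E0 n n; have := E0 m n; have := E0 n m; have := L0 m; have := L0 n.
case Emm : (mutual_energy _ m m) => [mm| |] //; case Enn : (mutual_energy _ n n) => [nn| |] //.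
all: case: (\int[m]_x _) => [lm| |] //; case: (\int[n]_x _) => [ln| |] //; rewrite ?gt0_muley ?lte_fin//.
move=> _ _ _ _ _ _; rewrite -!EFinM -!EFinD => -[e1] -[e2] e3 e4.
apply: energy_uniqueness => //; rewrite ?Emm ?Enn ?ltry//.
move: e3 e4; rewrite (mutual_energyC n m (@measurable_log_kernel R) (@log_kernel_ge0 R) (@log_kernelC R)).
case: (mutual_energy _ m n) => [mn| |] //; last by move=> _ _; exact: leey.
by rewrite -!EFinD !lee_fin; lra.
Qed.

End identification.

(** * Support and absolute continuity *)

Section density.
Context (R : realType).
Local Notation leb := (@lebesgue_measure R).
Local Notation TR := (measurableTypeR R).
Implicit Types (a b c t x y k q tau : R).

Lemma ellI_gt0 a k : 0 <= a -> 0 <= k < 1 -> 0 < ellI a k.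
Proof.
move=> a0 k01; have p0 : 0 < (pi : R) / 2 by rewrite divr_gt0 ?pi_gt0.
have h t : 0 < a + ellD k t by rewrite ltr_wpDl// ellD_gt0.
have a1 : 0 < a + 1 by rewrite ltr_wpDl.
apply: (@lt_le_trans _ _ ((a + 1)^-1 * (pi / 2))); first by rewrite mulr_gt0 ?invr_gt0.
rewrite -Rintegral_cst_pihalf; apply: le_Rintegral => //.
- by apply: cont_on_integrable => t _; exact: contC.
- apply: cont_on_integrable => t _; apply: contV; first by apply/lt0r_neq0; exact: h.
  by apply: contD; [exact: contC|exact: cont_ellD].
- by move=> t _; rewrite lef_pV2 ?posrE//; [rewrite lerD2l ellD_le1|exact: h].
Qed.

Lemma eq_density_gt0 tau b y : 0 < tau -> 0 <= b -> b < `|y| < 1 -> 0 < eq_density tau b y.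
Proof.
move=> t0 b0 /andP[by_ y1].
have yb : b ^+ 2 < y ^+ 2 by rewrite -(real_normK (num_real y)) ltr_pXn2r ?nnegrE.
have y11 : y ^+ 2 < 1 by rewrite -(real_normK (num_real y)) expr_lt1.
rewrite /eq_density; apply: mulr_gt0; last first.
  by apply: ellI_gt0; rewrite ?sqrtr_ge0 ?b0//= (lt_trans by_).
apply: mulr_gt0; last by rewrite sqrtr_gt0 divr_gt0 ?subr_gt0.
by rewrite mulr_gt0 ?divr_gt0 ?pi_gt0// (le_lt_trans b0).
Qed.

Local Open Scope ereal_scope.

Lemma cut_measure_density tau b (A : set TR) : (0 < b < 1)%R -> (0 < tau)%R -> ellE b = (tau^-1 + 1)%R ->
  measurable A -> cut_measure tau b A = \int[leb]_(x in A `&` two_cut b) (eq_density tau b x)%:E.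
Proof.
move=> b01 t0 Eb mA; rewrite (cut_measureE b01 t0 Eb) /= /weighted [RHS]integral_mkcondr.
apply: eq_integral => y _; rewrite patchE /cut_weight indicE gtr0_norm//.
by case: ifP => _; rewrite /= ?mulr1 ?mulr0.
Qed.

(** A nonnegative function with zero integral vanishes almost everywhere,
    but the density is positive inside the cuts and intervals are not
    negligible. *)
Lemma density_measure_gt0 tau b p q : (0 < tau)%R -> (0 <= b)%R -> (p < q)%R ->
  (forall y, (p < y < q)%R -> (b < `|y| < 1)%R) ->
  0 < \int[leb]_(y in `]p, q[) (eq_density tau b y)%:E.
Proof.
move=> t0 b0 pq hpq.
have md : measurable_fun `]p, q[ (fun y : TR => (eq_density tau b y)%:E).
  by apply/measurable_EFinP; apply: measurable_funTS; exact: measurable_eq_density.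
rewrite lt0e; apply/andP; split; last first.
  by apply: integral_ge0 => y _; rewrite lee_fin eq_density_ge0// ltW.
apply/eqP => int0.
have [/(_ _) ae _] := @ae_eq_integral_abs _ TR R leb `]p, q[%classic (measurable_itv _) _ md.
have {}ae := ae _.
have /ae h : \int[leb]_(x in `]p, q[) `|(eq_density tau b x)%:E| = 0.
  by rewrite -int0; apply: eq_integral => y _; rewrite gee0_abs// lee_fin eq_density_ge0// ltW.
have neg : leb.-negligible (`]p, q[%classic : set TR).
  apply: negligibleS h => y /= yI /(_ yI)[]; apply/eqP; rewrite gt_eqF//.
  by apply: eq_density_gt0 => //; apply: hpq; move: yI; rewrite in_itv.
move/negligibleP : neg => /(_ (measurable_itv _)).
by rewrite /= lebesgue_measure_itv/= lte_fin pq -EFinB => -[] /eqP; rewrite subr_eq0 gt_eqF.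
Qed.

(** The cuts are closed and carry the measure; and every neighbourhood of a
    point of a cut contains an open interval inside that cut, where the
    density is positive. *)
Lemma msupport_density tau b (m : probability TR R) : (0 < tau)%R -> (0 < b < 1)%R ->
  (forall A : set TR, measurable A -> m A = \int[leb]_(x in A `&` two_cut b) (eq_density tau b x)%:E) ->
  msupport m = two_cut b.
Proof.
move=> t0 b01 mE; have /andP[b0 b1] := b01; have b0' := ltW b0.
have c2 : closed (two_cut b : set R).
  by apply: closedU; exact: itv_closed.
apply/seteqP; split => x /=.
  move=> xs; apply: contrapT => xb.
  have oU : open_nbhs x (~` two_cut b) by split => //; exact: closed_openC.
  have m0 : m (~` two_cut b : set TR) = 0.
    rewrite mE; last by apply: measurableC; exact: measurable_two_cut.
    by rewrite setICl integral_set0.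
  suff : (0 : \bar R) < 0 by rewrite ltxx.
  by rewrite -[X in _ < X]m0; exact: xs oU.
move=> xb U oU; have [oU' Ux] := oU.
have [e /= e0 eU] : exists2 e : R, (0 < e)%R & ball x e `<=` U.
  by have /nbhs_ballP[e /= e0 eU] := open_nbhs_nbhs oU; exists e.
have sub p q : (p < q)%R -> (forall y, (p < y < q)%R -> (b < `|y| < 1)%R) ->
    (x - e <= p)%R -> (q <= x + e)%R -> 0 < m U.
  move=> pq hpq xp qx; rewrite mE; last exact: open_measurable.
  apply: (lt_le_trans (density_measure_gt0 t0 b0' pq hpq)).
  apply: ge0_subset_integral => //.
  - by apply: measurableI; [exact: open_measurable|exact: measurable_two_cut].
  - by apply/measurable_EFinP; apply: measurable_funTS; exact: measurable_eq_density.
  - by move=> y _; rewrite lee_fin eq_density_ge0// ltW.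
  - move=> y /=; rewrite in_itv/= => yI; have /andP[py yq] := yI; split.
      apply: eU; rewrite /ball/= ltr_norml; apply/andP; split; lra.
    have /andP[h1 h2] := hpq y yI.
    move: h1; rewrite ltr_normr => /orP[h|h]; [right|left]; rewrite /= in_itv/=.
      by rewrite ltW//= ltW// (le_lt_trans (ler_norm _)).
    move: h2; rewrite ltr_norml => /andP[h2 h3]; apply/andP; split; lra.
move: xb => [|]; rewrite /= in_itv/= => /andP[x0 x1].
  apply: (sub (Num.max (x - e) (-1))%R (Num.min (x + e) (- b))%R).
  - rewrite gt_max !lt_min; apply/andP; split; apply/andP; split; lra.
  - move=> y; rewrite gt_max lt_min => /andP[/andP[y1 y2] /andP[y3 y4]].
    by rewrite ler0_norm; last lra; apply/andP; split; lra.
  - by rewrite le_max lexx.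
  - by rewrite ge_min lexx.
apply: (sub (Num.max (x - e) b)%R (Num.min (x + e) 1)%R).
- rewrite gt_max !lt_min; apply/andP; split; apply/andP; split; lra.
- move=> y; rewrite gt_max lt_min => /andP[/andP[y1 y2] /andP[y3 y4]].
  by rewrite ger0_norm; last lra; apply/andP; split; lra.
- by rewrite le_max lexx.
- by rewrite ge_min lexx.
Qed.

Lemma density_dominates tau b (m : probability TR R) : (0 < tau)%R ->
  (forall A : set TR, measurable A -> m A = \int[leb]_(x in A `&` two_cut b) (eq_density tau b x)%:E) ->
  m `<< leb.
Proof.
move=> t0 mE N hN A mA AN; have mAb : measurable (A `&` two_cut b : set TR).
  by apply: measurableI => //; exact: measurable_two_cut.
have A0 : leb (A `&` two_cut b) = 0 by apply: hN => // x [/AN].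
rewrite mE// -(@integral_abs_eq0 _ _ R leb _ (fun y => (eq_density tau b y)%:E) mAb _ A0).
- by apply: eq_integral => y _; rewrite gee0_abs// lee_fin eq_density_ge0// ltW.
- by apply/measurable_EFinP; apply: measurable_funTS; exact: measurable_eq_density.
Qed.

End density.

(** * Complex-valued functions of a real variable *)

Section complex_calculus.
Context (R : realType).
Local Notation leb := (@lebesgue_measure R).
Local Notation TR := (measurableTypeR R).
Local Notation Re := complex.Re.
Local Notation Im := complex.Im.
Local Notation normc := Normc.normc.
Local Notation der f x a := (is_derive (x : R) (1%R : R) f a).
Implicit Types (a b t x y : R) (z w c : R[i]) (f g F G : R -> R[i]).

Lemma complex_eqP z w : Re z = Re w -> Im z = Im w -> z = w.
Proof. by case: z w => [a b] [c d] /= -> ->. Qed.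

Lemma cReD z w : Re (z + w) = Re z + Re w. Proof. by case: z w => [a b] [c d]. Qed.
Lemma cImD z w : Im (z + w) = Im z + Im w. Proof. by case: z w => [a b] [c d]. Qed.
Lemma cReN z : Re (- z) = - Re z. Proof. by case: z. Qed.
Lemma cImN z : Im (- z) = - Im z. Proof. by case: z. Qed.
Lemma cReM z w : Re (z * w) = Re z * Re w - Im z * Im w. Proof. by case: z w => [a b] [c d]. Qed.
Lemma cImM z w : Im (z * w) = Re z * Im w + Im z * Re w. Proof. by case: z w => [a b] [c d]. Qed.
Lemma cReV z : Re z^-1 = Re z / (Re z ^+ 2 + Im z ^+ 2). Proof. by case: z. Qed.
Lemma cImV z : Im z^-1 = - (Im z / (Re z ^+ 2 + Im z ^+ 2)). Proof. by case: z. Qed.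

Lemma normc_sqrt z : normc z = Num.sqrt (Re z ^+ 2 + Im z ^+ 2). Proof. by case: z. Qed.

Lemma sqr_normc z : normc z ^+ 2 = Re z ^+ 2 + Im z ^+ 2.
Proof. by rewrite normc_sqrt sqr_sqrtr// addr_ge0// sqr_ge0. Qed.

Lemma complex_neq0 z : (z != 0) = (0 < Re z ^+ 2 + Im z ^+ 2).
Proof.
case: z => a b /=; rewrite lt_neqAle addr_ge0 ?sqr_ge0// andbT (eq_sym 0).
by rewrite paddr_eq0 ?sqr_ge0// !sqrf_eq0 eq_complex.
Qed.

Lemma Re_le_normc z : `|Re z| <= normc z.
Proof.
by rewrite normc_sqrt -sqrtr_sqr ler_wsqrtr// lerDl sqr_ge0.
Qed.

Lemma Im_le_normc z : `|Im z| <= normc z.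
Proof.
by rewrite normc_sqrt -sqrtr_sqr ler_wsqrtr// lerDr sqr_ge0.
Qed.

Lemma Re_real_div x z : Re (x%:C / z) = x * Re z^-1.
Proof. by rewrite cReM /= mul0r subr0. Qed.

(** Continuity, differentiability and integrability of complex-valued
    functions are taken componentwise, so that they reduce to the real
    rules. *)
Definition ccont f t := cont_at (fun s => Re (f s)) t /\ cont_at (fun s => Im (f s)) t.

Definition cder F t c := der (fun s => Re (F s)) t (Re c) /\ der (fun s => Im (F s)) t (Im c).

Definition cintegrable (D : set R) f :=
  leb.-integrable D (EFin \o (fun s => Re (f s))) /\ leb.-integrable D (EFin \o (fun s => Im (f s))).

Lemma cont_ext (h k : R -> R) t : (forall s, k s = h s) -> cont_at h t -> cont_at k t.
Proof. by move=> /funext ->. Qed.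

Lemma der_ext (h k : R -> R) t a : (forall s, k s = h s) -> der h t a -> der k t a.
Proof. by move=> /funext ->. Qed.

Lemma ccontC c t : ccont (fun _ => c) t. Proof. by split; exact: contC. Qed.

Lemma ccontR (h : R -> R) t : cont_at h t -> ccont (fun s => (h s)%:C) t.
Proof. by move=> ch; split => //=; exact: contC. Qed.

Lemma ccontD f g t : ccont f t -> ccont g t -> ccont (fun s => f s + g s) t.
Proof.
move=> [f1 f2] [g1 g2]; split.
  by apply: (cont_ext (fun s => cReD (f s) (g s))); exact: contD.
by apply: (cont_ext (fun s => cImD (f s) (g s))); exact: contD.
Qed.

Lemma ccontN f t : ccont f t -> ccont (fun s => - f s) t.
Proof.
move=> [f1 f2]; split.
  by apply: (cont_ext (fun s => cReN (f s))); exact: contN.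
by apply: (cont_ext (fun s => cImN (f s))); exact: contN.
Qed.

Lemma ccontM f g t : ccont f t -> ccont g t -> ccont (fun s => f s * g s) t.
Proof.
move=> [f1 f2] [g1 g2]; split.
  by apply: (cont_ext (fun s => cReM (f s) (g s))); apply: contD; [exact: contM|apply: contN; exact: contM].
by apply: (cont_ext (fun s => cImM (f s) (g s))); apply: contD; exact: contM.
Qed.

Lemma ccontV f t : f t != 0 -> ccont f t -> ccont (fun s => (f s)^-1) t.
Proof.
rewrite complex_neq0 => f0 [f1 f2].
have cn : cont_at (fun s => (Re (f s) ^+ 2 + Im (f s) ^+ 2)^-1) t.
  apply: contV; first by rewrite gt_eqF.
  by apply: contD; exact: contX.
split; first by apply: (cont_ext (fun s => cReV (f s))); exact: contM.
by apply: (cont_ext (fun s => cImV (f s))); apply: contN; exact: contM.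
Qed.

Lemma ccont_integrable f a b : (forall t, t \in `[a, b] -> ccont f t) -> cintegrable `[a, b] f.
Proof. by move=> cf; split; apply: cont_on_integrable => t /cf[]. Qed.

Lemma cderC c t : cder (fun=> c) t 0. Proof. by split; exact: derC. Qed.

Lemma cderR (h : R -> R) t a : der h t a -> cder (fun s => (h s)%:C) t a%:C.
Proof. by move=> dh; split => //=; exact: derC. Qed.

Lemma cderD F G t c d : cder F t c -> cder G t d -> cder (fun s => F s + G s) t (c + d).
Proof.
move=> [f1 f2] [g1 g2]; split; rewrite ?cReD ?cImD.
  by apply: (der_ext (fun s => cReD (F s) (G s))); exact: derD.
by apply: (der_ext (fun s => cImD (F s) (G s))); exact: derD.
Qed.

Lemma cderN F t c : cder F t c -> cder (fun s => - F s) t (- c).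
Proof.
move=> [f1 f2]; split; rewrite ?cReN ?cImN.
  by apply: (der_ext (fun s => cReN (F s))); exact: derN.
by apply: (der_ext (fun s => cImN (F s))); exact: derN.
Qed.

Lemma cder_eq F t c d : cder F t c -> c = d -> cder F t d. Proof. by move=> h <-. Qed.

Lemma cderM F G t c d : cder F t c -> cder G t d ->
  cder (fun s => F s * G s) t (c * G t + F t * d).
Proof.
move=> [f1 f2] [g1 g2]; split.
  apply: (der_ext (fun s => cReM (F s) (G s))).
  by apply: (is_derive_eq (derD (derM f1 g1) (derN (derM f2 g2)))); rewrite cReD !cReM; ring.
apply: (der_ext (fun s => cImM (F s) (G s))).
by apply: (is_derive_eq (derD (derM f1 g2) (derM f2 g1))); rewrite cImD !cImM; ring.
Qed.

Lemma cderV F t c : F t != 0 -> cder F t c -> cder (fun s => (F s)^-1) t (- c / F t ^+ 2).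
Proof.
move=> F0 [f1 f2]; rewrite complex_neq0 in F0; have n0 := lt0r_neq0 F0.
have dn := @derV R (fun s => Re (F s) ^+ 2 + Im (F s) ^+ 2) t _ n0 (derD (derX 2 f1) (derX 2 f2)).
split.
  apply: (der_ext (fun s => cReV (F s))); apply: (is_derive_eq (derM f1 dn)).
  rewrite cReM cReV cImV cReN cImN expr2 cReM cImM.
  move: (Re (F t)) (Im (F t)) n0 => p q n0.
  have -> : (p * p - q * q) ^+ 2 + (p * q + q * p) ^+ 2 = (p ^+ 2 + q ^+ 2) ^+ 2 by ring.
  by rewrite /=; field.
apply: (der_ext (fun s => cImV (F s))); apply: (is_derive_eq (derN (derM f2 dn))).
rewrite cImM cReV cImV cReN cImN expr2 cReM cImM.
move: (Re (F t)) (Im (F t)) n0 => p q n0.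
have -> : (p * p - q * q) ^+ 2 + (p * q + q * p) ^+ 2 = (p ^+ 2 + q ^+ 2) ^+ 2 by ring.
by rewrite /=; field.
Qed.

Lemma eq_cintegral (D : set R) f g : (forall t, D t -> f t = g t) ->
  cintegral leb D f = cintegral leb D g.
Proof.
by move=> fg; rewrite /cintegral; congr (_ +i* _); apply: eq_Rintegral => t; rewrite inE => /fg ->.
Qed.

Lemma cintegralD (D : set TR) f g : measurable D -> cintegrable D f -> cintegrable D g ->
  cintegral leb D (fun t => f t + g t) = cintegral leb D f + cintegral leb D g.
Proof.
move=> mD [f1 f2] [g1 g2]; rewrite /cintegral; apply: complex_eqP => /=.
  by under eq_Rintegral do rewrite cReD; rewrite RintegralD.
by under eq_Rintegral do rewrite cImD; rewrite RintegralD.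
Qed.

Lemma cintegrableZ (D : set TR) c f : measurable D -> cintegrable D f -> cintegrable D (fun t => c * f t).
Proof.
move=> mD [f1 f2]; split.
  have -> : EFin \o (fun s => Re (c * f s)) =
    (fun s => (Re c)%:E * (Re (f s))%:E - (Im c)%:E * (Im (f s))%:E)%E.
    by apply/funext => s; rewrite /= cReM EFinB !EFinM.
  by apply: integrableB => //; exact: integrableZl.
have -> : EFin \o (fun s => Im (c * f s)) =
  (fun s => (Re c)%:E * (Im (f s))%:E + (Im c)%:E * (Re (f s))%:E)%E.
  by apply/funext => s; rewrite /= cImM EFinD !EFinM.
by apply: integrableD => //; exact: integrableZl.
Qed.

Lemma integrable_realZ (D : set TR) (c : R) (h : R -> R) : measurable D ->
  leb.-integrable D (EFin \o h) -> leb.-integrable D (EFin \o (fun s => c * h s)).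
Proof.
move=> mD hi; rewrite (_ : EFin \o _ = (fun s => c%:E * (h s)%:E)%E); first exact: integrableZl.
by apply/funext => s; rewrite /= EFinM.
Qed.

Lemma cintegralZ (D : set TR) c f : measurable D -> cintegrable D f ->
  cintegral leb D (fun t => c * f t) = c * cintegral leb D f.
Proof.
move=> mD [f1 f2]; rewrite /cintegral; apply: complex_eqP.
  rewrite cReM /=; under eq_Rintegral do rewrite cReM.
  by rewrite RintegralB ?RintegralZl//; exact: integrable_realZ.
rewrite cImM /=; under eq_Rintegral do rewrite cImM.
by rewrite RintegralD ?RintegralZl//; exact: integrable_realZ.
Qed.

Lemma cintegrableN (D : set TR) f : measurable D -> cintegrable D f -> cintegrable D (fun t => - f t).
Proof.
move=> mD fi; have := cintegrableZ (-1) mD fi.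
by under eq_fun do rewrite mulN1r.
Qed.

Lemma cintegralB (D : set TR) f g : measurable D -> cintegrable D f -> cintegrable D g ->
  cintegral leb D (fun t => f t - g t) = cintegral leb D f - cintegral leb D g.
Proof.
move=> mD fi gi; rewrite cintegralD//; last exact: cintegrableN.
congr (_ + _); rewrite -[RHS]mulN1r -cintegralZ//.
by apply: eq_cintegral => t _; rewrite mulN1r.
Qed.

Lemma CFTC F f a b : a <= b -> (forall t, t \in `[a, b] -> cder F t (f t)) ->
  (forall t, t \in `[a, b] -> ccont f t) -> cintegral leb `[a, b] f = F b - F a.
Proof.
move=> ab dF cf; rewrite /cintegral; apply: complex_eqP.
  rewrite cReD cReN /=; have dR t : t \in `[a, b] -> der (fun s => Re (F s)) t (Re (f t)) by move=> /dF[].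
  by rewrite (RFTC_segment ab dR)// => t /cf[].
rewrite cImD cImN /=; have dR t : t \in `[a, b] -> der (fun s => Im (F s)) t (Im (f t)) by move=> /dF[].
by rewrite (RFTC_segment ab dR)// => t /cf[].
Qed.

(** The complex plane without ]-oo, 0], see [slitP]; in this form the
    condition is the one under which [slog] has a nonzero denominator. *)
Definition slit w := 0 < normc w + Re w.

Lemma slitP w : ~ (Im w = 0 /\ Re w <= 0) -> slit w.
Proof.
move=> h; rewrite /slit; have [p0|p0] := ltP 0 (Re w).
  by rewrite ltr_wpDl// normc_sqrt sqrtr_ge0.
have q0 : Im w != 0 by apply/eqP => q0; apply: h.
rewrite -[X in _ < _ + X]opprK subr_gt0 -(ger0_norm (_ : 0 <= - Re w)) ?oppr_ge0// normrN.
rewrite normc_sqrt -sqrtr_sqr ltr_sqrt ?ltrDl ?exprn_even_gt0//.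
by rewrite ltr_wpDl ?sqr_ge0// exprn_even_gt0.
Qed.

Lemma slit_neq0 w : slit w -> w != 0.
Proof.
by apply: contraTneq => ->; rewrite /slit Normc.normc0 add0r ltxx.
Qed.

(** The principal logarithm with the argument written as 2 atan (Im
    w / (|w| + Re w)), the half-angle formula. One expression is valid on
    the whole slit plane, unlike the definition of the argument by cases
    with acos, whose derivative is singular on the real axis. *)
Definition slog w : R[i] := ln (normc w) +i* (2 * atan (Im w / (normc w + Re w))).

Lemma cder_slog F t c : slit (F t) -> cder F t c -> cder (fun s => slog (F s)) t (c / F t).
Proof.
move=> sl [f1 f2]; have := slit_neq0 sl; rewrite complex_neq0 => n0.
have dr : der (fun s => normc (F s)) t ((Re (F t) * Re c + Im (F t) * Im c) / normc (F t)).
  apply: (der_ext (fun s => normc_sqrt (F s))).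
  apply: (is_derive_eq (@der_sqrt R (fun s => Re (F s) ^+ 2 + Im (F s) ^+ 2) t _ n0 (derD (derX 2 f1) (derX 2 f2)))).
  rewrite normc_sqrt /=; have s0 : Num.sqrt (Re (F t) ^+ 2 + Im (F t) ^+ 2) != 0 by rewrite gt_eqF// sqrtr_gt0.
  by field.
have r0 : 0 < normc (F t) by rewrite normc_sqrt sqrtr_gt0.
have r2 := sqr_normc (F t).
split.
  apply: (is_derive_eq (@der_ln R (fun s => normc (F s)) t _ r0 dr)).
  rewrite cReM cReV cImV -r2; move: (normc (F t)) r0 => r r0.
  by field; rewrite gt_eqF.
have rp0 : normc (F t) + Re (F t) != 0 by rewrite gt_eqF.
apply: (is_derive_eq (derM (derC 2 t) (der_atan (derM f2 (@derV R (fun s => normc (F s) + Re (F s)) t _ rp0 (derD dr f1)))))).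
rewrite cImM cReV cImV -r2; move: sl; rewrite /slit.
move: (normc (F t)) (Re (F t)) (Im (F t)) (Re c) (Im c) r0 r2 => r p q p' q' r0 r2 rp.
have -> : (1 + (q / (r + p)) ^+ 2)^-1 = (r + p) / (2 * r).
  rewrite -[RHS]invf_div; congr (_^-1).
  (* The last term is 0 by r2; with it, the equality is an identity of
     rational functions. *)
  have -> : 1 + (q / (r + p)) ^+ 2 = 2 * r / (r + p) - (r ^+ 2 - (p ^+ 2 + q ^+ 2)) / (r + p) ^+ 2.
    by field; rewrite gt_eqF.
  by rewrite r2 subrr mul0r subr0.
transitivity (p' * - (q / r ^+ 2) + q' * (p / r ^+ 2) + q' * (r ^+ 2 - (p ^+ 2 + q ^+ 2)) / (r ^+ 2 * (r + p))).
  by field; rewrite !gt_eqF.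
by rewrite r2 subrr mulr0 mul0r addr0.
Qed.

(** With s = |Im w| / (|w| + Re w), the double-angle formula gives cos (2
    atan s) = Re w / |w|. *)
Lemma clog_slog w : slit w -> clog w = slog w.
Proof.
move=> sl; have := slit_neq0 sl; rewrite complex_neq0 => n0.
have r0 : 0 < normc w by rewrite normc_sqrt sqrtr_gt0.
have r2 := sqr_normc w.
rewrite /clog /slog /carg; congr (_ +i* _).
move: sl; rewrite /slit; move: (normc w) (Re w) (Im w) r0 r2 => r p q r0 r2 rp.
have key : acos (p / r) = 2 * atan (`|q| / (r + p)).
  set s := `|q| / (r + p).
  have s0 : 0 <= s by rewrite divr_ge0// ltW.
  have s2 : 1 + s ^+ 2 = 2 * r / (r + p).
    have -> : 1 + s ^+ 2 = 2 * r / (r + p) - (r ^+ 2 - (p ^+ 2 + q ^+ 2)) / (r + p) ^+ 2.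
      by rewrite /s expr_div_n real_normK ?num_real//; field; rewrite gt_eqF.
    by rewrite r2 subrr mul0r subr0.
  have -> : p / r = cos (2 * atan s).
    rewrite (_ : 2 * atan s = atan s + atan s); last by ring.
    rewrite cosD -!expr2 sin2cos2 cos_atan exprVn sqr_sqrtr ?s2; last first.
      by rewrite divr_ge0 ?mulr_ge0// ltW.
    by field; rewrite !gt_eqF.
  apply: cosK; rewrite in_itv/=.
  have := atan_ltpi2 s; have : 0 <= atan s.
    by move: s0; rewrite le_eqVlt => /predU1P[<-|/lt_atan]; rewrite atan0// => /ltW.
  by move=> h1 h2; apply/andP; split; lra.
case: ifPn => q0; rewrite key; first by rewrite ger0_norm.
by rewrite ltr0_norm ?ltNge// mulNr atanN mulrN opprK.
Qed.

End complex_calculus.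

(** * Complex integrals in closed form *)

Section complex_integrals.
Context (R : realType).
Local Notation leb := (@lebesgue_measure R).
Local Notation H := (`[0%R, ((pi : R) / 2)%R]%classic).
Local Notation Re := complex.Re.
Local Notation Im := complex.Im.
Local Notation normc := Normc.normc.
Local Notation J := (Complex (0 : R) 1).
Implicit Types (a b t x y : R) (z w c : R[i]).

Lemma JJ : J * J = -1 :> R[i]. Proof. by rewrite -expr2 sqr_i. Qed.

Lemma real_trig t : ((cos t)%:C ^+ 2 + (sin t)%:C ^+ 2 = 1 :> R[i]).
Proof. by rewrite -!rmorphXn -rmorphD /= cos2Dsin2 rmorph1. Qed.

(** The real part is Re c cos t, positive except at pi / 2, where the value
    is - j. *)
Lemma slit_cos_sin c j t : 0 < Re c -> j = J \/ j = - J -> t \in `[0, (pi : R) / 2] ->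
  slit (c * (cos t)%:C - j * (sin t)%:C).
Proof.
move=> c0 jJ /in_pihalf_cc[_ /andP[ct0 _]]; apply: slitP.
have -> : Re (c * (cos t)%:C - j * (sin t)%:C) = Re c * cos t.
  by rewrite cReD cReN !cReM /=; case: jJ => -> /=; ring.
rewrite cImD cImN !cImM /= => -[i0]; rewrite pmulr_rle0// => ct.
have {}ct : cos t = 0 by apply/eqP; rewrite eq_le ct.
have := cos2Dsin2 t; rewrite ct expr0n/= add0r => s2.
have s0 : sin t = 0 by move: i0; rewrite ct; case: jJ => -> /=; lra.
by move: s2; rewrite s0 expr0n/= => /eqP; rewrite eq_sym oner_eq0.
Qed.

Lemma cder_cos_sin c j t :
  cder (fun s => c * (cos s)%:C - j * (sin s)%:C) t (- c * (sin t)%:C - j * (cos t)%:C).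
Proof.
have dc : cder (fun s => (cos s)%:C) t (- sin t)%:C by apply: cderR; exact: is_derive_cos.
have ds : cder (fun s => (sin s)%:C) t (cos t)%:C by apply: cderR; exact: is_derive_sin.
apply: (cder_eq (cderD (cderM (cderC c t) dc) (cderN (cderM (cderC j t) ds)))).
by rewrite !mul0r !add0r rmorphN /= mulrN mulNr.
Qed.

Lemma slogJ : slog J = (pi / 2)%:C * J /\ slog (- J) = - ((pi / 2)%:C * J).
Proof.
have n1 : normc J = 1 by rewrite normc_sqrt /= expr0n/= add0r expr1n sqrtr1.
have n2 : normc (- J) = 1 by rewrite normc_sqrt /= oppr0 expr0n/= add0r sqrrN expr1n sqrtr1.
rewrite /slog n1 n2 ln1 /= oppr0 !addr0 divr1 mulNr divr1 atanN atan1.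
by split; apply: complex_eqP; rewrite ?cReN ?cImN ?cReM ?cImM /=; field.
Qed.

(** The integrand is the reciprocal of the product of c cos t - i sin t and
    c cos t + i sin t, so a primitive is i / (2 c) times the difference of
    their logarithms. Both paths start at c and stay in the right half plane
    until they reach - i and i, where the logarithms are - i pi / 2 and i
    pi / 2. *)
Lemma integral_inv_quadratic c : 0 < Re c ->
  cintegral leb H (fun t => (c ^+ 2 * (cos t)%:C ^+ 2 + (sin t)%:C ^+ 2)^-1) = (pi / 2)%:C / c.
Proof.
move=> c0; have p0 : 0 <= (pi : R) / 2 by rewrite divr_ge0// pi_ge0.
have cn0 : c != 0 by apply/eqP => /(congr1 (@complex.Re R)) /=; lra.
have S1 t := @slit_cos_sin c J t c0 (or_introl erefl).
have S2 t := @slit_cos_sin c (- J) t c0 (or_intror erefl).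
pose F t : R[i] := c^-1 * (J / 2 * (slog (c * (cos t)%:C - J * (sin t)%:C) -
  slog (c * (cos t)%:C - - J * (sin t)%:C))).
have e3 t : c ^+ 2 * (cos t)%:C ^+ 2 + (sin t)%:C ^+ 2 =
    (c * (cos t)%:C - J * (sin t)%:C) * (c * (cos t)%:C - - J * (sin t)%:C).
  transitivity (c ^+ 2 * (cos t)%:C ^+ 2 - (J * J) * (sin t)%:C ^+ 2); last by ring.
  by rewrite JJ; ring.
have dF t : t \in `[0, (pi : R) / 2] -> cder F t ((c ^+ 2 * (cos t)%:C ^+ 2 + (sin t)%:C ^+ 2)^-1).
  move=> tI; have sl1 := S1 _ tI; have sl2 := S2 _ tI.
  have d1 := cder_slog sl1 (cder_cos_sin c J t).
  have d2 := cder_slog sl2 (cder_cos_sin c (- J) t).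
  have := cderM (cderC c^-1 t) (cderM (cderC (J / 2) t) (cderD d1 (cderN d2))).
  move=> /cder_eq; apply; rewrite !mul0r !add0r e3.
  have a1 := slit_neq0 sl1; have a2 := slit_neq0 sl2; have T := real_trig t.
  move: (cos t)%:C (sin t)%:C T a1 a2 => C S T a1 a2.
  have e4 : (- c * S - J * C) / (c * C - J * S) - (- c * S - - J * C) / (c * C - - J * S) =
     - (2 * c * J * (C ^+ 2 + S ^+ 2)) / ((c * C - J * S) * (c * C - - J * S)).
    by field; rewrite a1; move: a2; rewrite !mulNr !opprK => ->.
  rewrite e4 T; move: ((c * C - J * S) * (c * C - - J * S)) (mulf_neq0 a1 a2) => X X0.
  transitivity (- (J * J) / X); first by field; rewrite X0 cn0.
  by rewrite JJ opprK mul1r.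
rewrite (CFTC p0 dF).
  rewrite /F cos_pihalf sin_pihalf cos0 sin0 !rmorph0 rmorph1.
  rewrite !(mulr0, mulr1, subr0, sub0r, opprK, subrr) (slogJ).1 (slogJ).2.
  transitivity (- (J * J) * ((pi / 2)%:C / c)); first by field.
  by rewrite JJ opprK mul1r.
move=> t tI; apply: ccontV; first by rewrite e3 mulf_neq0// slit_neq0// ?S1 ?S2.
have cs : ccont (fun s : R => (sin s)%:C) t by apply: ccontR; exact: continuous_sin.
have cc : ccont (fun s : R => (cos s)%:C) t by apply: ccontR; exact: continuous_cos.
by apply: ccontD; [apply: ccontM; [exact: ccontC|exact: ccontM]|exact: ccontM].
Qed.

(** The case c = sqrt(p / q). *)
Lemma integral_inv_quadratic_real p q : 0 < p -> 0 < q ->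
  \int[leb]_(t in H) (p * cos t ^+ 2 + q * sin t ^+ 2)^-1 = pi / 2 / (Num.sqrt p * Num.sqrt q) :> R.
Proof.
move=> p0 q0; pose c : R := Num.sqrt p / Num.sqrt q.
have sp : 0 < Num.sqrt p by rewrite sqrtr_gt0.
have sq : 0 < Num.sqrt q by rewrite sqrtr_gt0.
have c0 : 0 < Re c%:C by rewrite /= divr_gt0.
have E : \int[leb]_(t in H) Re ((c%:C ^+ 2 * (cos t)%:C ^+ 2 + (sin t)%:C ^+ 2)^-1) = pi / 2 * Re (c%:C^-1).
  by rewrite -Re_real_div -(integral_inv_quadratic c0).
have h t : Re (c%:C ^+ 2 * (cos t)%:C ^+ 2 + (sin t)%:C ^+ 2)^-1 = q * (p * cos t ^+ 2 + q * sin t ^+ 2)^-1.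
  rewrite -!rmorphXn -rmorphM -rmorphD -fmorphV /= /c expr_div_n !sqr_sqrtr ?ltW//.
  have -> : p * cos t ^+ 2 + q * sin t ^+ 2 = q * (p / q * cos t ^+ 2 + sin t ^+ 2) by field; rewrite gt_eqF.
  by rewrite invfM mulVKf// gt_eqF.
have pos t : 0 < p * cos t ^+ 2 + q * sin t ^+ 2.
  have := cos2Dsin2 t; have := sqr_ge0 (cos t); have := sqr_ge0 (sin t).
  move: (cos t ^+ 2) (sin t ^+ 2) => u v v0 u0 uv.
  have [u1|u1] := ltP 0 u; first by rewrite ltr_pwDl ?mulr_gt0// mulr_ge0// ltW.
  by rewrite ltr_wpDl ?mulr_ge0 ?mulr_gt0//; [exact: ltW|lra].
move: E; under eq_Rintegral do rewrite h.
rewrite RintegralZl//; last first.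
  by apply: cont_on_integrable => t _; cont_rules; rewrite gt_eqF.
move=> e; apply: (mulfI (lt0r_neq0 q0)); rewrite e /c.
have -> : Re ((Num.sqrt p / Num.sqrt q)%:C^-1) = Num.sqrt q / Num.sqrt p.
  by rewrite -fmorphV /= invf_div.
rewrite -{2}(sqr_sqrtr (ltW q0)).
by field; rewrite !gt_eqF.
Qed.

Lemma complex_off_itv a b z t : complex_off `[a, b] z -> t \in `[a, b] -> z - t%:C != 0.
Proof.
by move=> zo tI; rewrite subr_eq0; apply/eqP => zt; apply: zo; exists t.
Qed.

(** A primitive of 1 / (z - t) on [-1, 1], normalized to vanish at -1.
    Taking the logarithm of the quotient keeps it on one branch for every z
    off [-1, 1]. *)
Definition cauchy_log z t : R[i] := slog ((z + 1) / (z - t%:C)).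

(** If (z + 1) / (z - t) is a nonpositive real then z lies on the segment
    from -1 to t. *)
Lemma slit_cauchy_log z t : complex_off `[-1, 1] z -> t \in `[-1, 1] -> slit ((z + 1) / (z - t%:C)).
Proof.
move=> zo tI; have zt := complex_off_itv zo tI.
apply: slitP => -[i0 r0]; apply: zo.
have uE : (z + 1) / (z - t%:C) = (Re ((z + 1) / (z - t%:C)))%:C by apply: complex_eqP.
move: (Re _) r0 uE => r r0 /(canRL (mulfVK zt)) e.
have e' : z * (1 - r)%:C = (- (1 + r * t))%:C.
  rewrite rmorphB rmorphN rmorphD rmorphM rmorph1 /=; move: e; move: r%:C t%:C => r' t' e.
  by transitivity (z + 1 - 1 - r' * z); [ring|rewrite e; ring].
have r1 : 0 < 1 - r by lra.
exists (- (1 + r * t) / (1 - r)).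
  move: tI; rewrite /= !in_itv/= => /andP[t1 t2]; rewrite ler_pdivlMr// ler_pdivrMr//.
  apply/andP; split; nra.
rewrite rmorphM fmorphV /= -e' mulfK//.
by apply/eqP => /(congr1 (@complex.Re R)) /=; lra.
Qed.

Lemma cder_cauchy_log z t : complex_off `[-1, 1] z -> t \in `[-1, 1] ->
  cder (cauchy_log z) t ((z - t%:C)^-1).
Proof.
move=> zo tI; have zt := complex_off_itv zo tI; have sl := slit_cauchy_log zo tI.
have dt : cder (fun s : R => s%:C) t 1 by apply: cderR; exact: derI.
have du := cderM (cderC (z + 1) t) (cderV zt (cderD (cderC z t) (cderN dt))).
apply: (cder_eq (cder_slog sl du)).
have : z + 1 != 0 by move: (slit_neq0 sl); rewrite mulf_eq0 negb_or => /andP[].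
by rewrite mul0r add0r => z1; field; rewrite z1 zt.
Qed.

Lemma cauchy_log1 z : complex_off `[-1, 1] z -> cauchy_log z 1 = clog ((z + 1) / (z - 1)).
Proof.
move=> zo; have h1 : (1 : R) \in `[-1, 1] by rewrite in_itv/= lexx andbT (le_trans (lerN10 _)).
by rewrite clog_slog//; have := slit_cauchy_log zo h1; rewrite rmorph1.
Qed.

Lemma cauchy_logN1 z : complex_off `[-1, 1] z -> cauchy_log z (-1) = 0.
Proof.
move=> zo; have h1 : (-1 : R) \in `[-1, 1] by rewrite in_itv/= lexx (le_trans (lerN10 _)).
have := complex_off_itv zo h1.
rewrite /cauchy_log rmorphN rmorph1 opprK => z1; rewrite divff//.
by rewrite /slog Normc.normc1 ln1 (_ : Im (1 : R[i]) = 0)// mul0r atan0 mulr0.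
Qed.

Lemma cder_comp F (h : R -> R) t c a : cder F (h t) c -> is_derive (t : R) (1 : R) h a ->
  cder (fun s => F (h s)) t (c * a%:C).
Proof.
move=> [f1 f2] dh; split.
  by apply: (is_derive_eq (der_comp f1 dh)); rewrite cReM /=; ring.
by apply: (is_derive_eq (der_comp f2 dh)); rewrite cImM /=; ring.
Qed.

End complex_integrals.

(** * The Cauchy transform as an integral over an angle *)

Section signed_transfer.
Context (R : realType).
Local Notation leb := (@lebesgue_measure R).
Local Notation TR := (measurableTypeR R).
Local Notation H := (`[0%R, ((pi : R) / 2)%R]%classic).
Implicit Types (a b t x y : R) (f g : R -> R).

Lemma Rintegral_eq_oo a b f g : measurable_fun (`[a, b]%classic : set TR) f ->
  measurable_fun (`[a, b]%classic : set TR) g -> (forall t, t \in `]a, b[ -> f t = g t) ->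
  \int[leb]_(t in `[a, b]) f t = \int[leb]_(t in `[a, b]) g t.
Proof.
move=> mf mg fg; rewrite /Rintegral; congr fine.
have sub : `]a, b[%classic `<=` (`[a, b]%classic : set TR) by exact: subset_itv_oo_cc.
have mo (h : R -> R) : measurable_fun (`[a, b]%classic : set TR) h ->
    measurable_fun (`]a, b[%classic : set TR) (fun t => (h t)%:E).
  by move=> mh; apply/measurable_EFinP; apply: measurable_funS mh.
rewrite integral_itv_bndoo; last exact: mo.
rewrite [RHS]integral_itv_bndoo; last exact: mo.
by apply: eq_integral => t; rewrite inE/= => /fg ->.
Qed.

Lemma cont_bounded a b f : a <= b -> (forall t, t \in `[a, b] -> cont_at f t) ->
  exists M : R, forall t, t \in `[a, b] -> `|f t| <= M.
Proof.
move=> ab cf.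
have cw : {within `[a, b], continuous (fun t => `|f t|)}.
  by apply: cont_on_within => t tI; apply: (cont_comp (g := Num.norm)); [exact: norm_continuous|exact: cf].
by have [c cI cM] := EVT_max ab cw; exists `|f c|.
Qed.

Local Open Scope ereal_scope.

(** The formula for nonnegative test functions is applied to the positive
    and negative parts of g, both of which have finite integrals since g is
    bounded along the path. *)
Lemma signed_transfer (m : {measure set TR -> \bar R}) (D : set TR) (r : R -> R) (Y K : R -> R) (M B : R) :
  (forall h : TR -> \bar R, measurable_fun setT h -> (forall x, 0 <= h x) ->
    \int[m]_(x in D) (h x * (r x)%:E) =
    \int[leb]_(t in H) ((h (Y t) + h (- Y t)%R) * (K t)%:E)) ->
  (forall x, D x -> (0 <= r x)%R) ->
  measurable_fun setT (Y : TR -> R) ->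
  measurable_fun H (K : TR -> R) -> (forall t, t \in H -> (0 <= K t <= B)%R) ->
  forall g : R -> R, measurable_fun setT (g : TR -> R) ->
  (forall t, t \in H -> (`|g (Y t)| <= M)%R /\ (`|g (- Y t)| <= M)%R) ->
  (\int[m]_(x in D) (g x * r x) = \int[leb]_(t in H) ((g (Y t) + g (- Y t)) * K t))%R.
Proof.
move=> tr r0 mY mK KB g mg gM.
have mp (p : R -> R) : measurable_fun setT (p : TR -> R) -> (forall x, 0 <= p x)%R ->
    (forall x, p x <= `|g x|)%R ->
    [/\ \int[m]_(x in D) (p x * r x)%:E = \int[leb]_(t in H) ((p (Y t) + p (- Y t)) * K t)%:E &
    leb.-integrable H (EFin \o (fun t => (p (Y t) + p (- Y t)) * K t)%R)].
  move=> mpp p0 pg; split.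
    have := tr (fun x => (p x)%:E) _ _.
    under eq_integral do rewrite -EFinM.
    move=> ->; [|exact/measurable_EFinP|by move=> x; rewrite lee_fin].
    by apply: eq_integral => t _; rewrite -EFinD -EFinM.
  apply: (@bounded_integrable_itv R 0 (pi / 2) ((M + M) * B)).
    apply: measM => //; apply: measD; apply: measurable_funTS.
      exact: (measurableT_comp mpp mY).
    by apply: (measurableT_comp mpp); exact: measN.
  move=> t tH; have tH' : t \in H by rewrite inE.
  have [g1 g2] := gM t tH'; have /andP[K0 K1] := KB t tH'.
  rewrite ger0_norm; last by rewrite mulr_ge0// addr_ge0.
  apply: ler_pM => //; first by rewrite addr_ge0.
  by rewrite lerD// (le_trans (pg _)).
pose p x := Num.max (g x) 0%R; pose n x := Num.max (- g x)%R 0%R.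
have p0 x : (0 <= p x)%R by rewrite le_max lexx orbT.
have n0 x : (0 <= n x)%R by rewrite le_max lexx orbT.
have pn x : (p x - n x = g x)%R.
  by rewrite /p /n; have [r1|r1] := leP (g x) 0%R; [rewrite max_l ?oppr_ge0//|rewrite max_r ?oppr_le0 ?ltW//]; rewrite ?sub0r ?subr0 ?opprK.
have pg x : (p x <= `|g x|)%R by rewrite ge_max ler_norm normr_ge0.
have ng x : (n x <= `|g x|)%R by rewrite ge_max -normrN ler_norm normr_ge0.
have mpx : measurable_fun setT (p : TR -> R) by apply: measurable_maxr => //; exact: measurable_cst.
have mnx : measurable_fun setT (n : TR -> R).
  by apply: measurable_maxr; [exact: measN|exact: measurable_cst].
have [ep ip] := mp p mpx p0 pg; have [en in_] := mp n mnx n0 ng.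
transitivity (\int[leb]_(t in H) ((p (Y t) + p (- Y t)) * K t) - \int[leb]_(t in H) ((n (Y t) + n (- Y t)) * K t))%R; last first.
  rewrite -RintegralB//; apply: eq_Rintegral => t _.
  by rewrite -!pn; ring.
rewrite {1}/Rintegral integralE.
have -> : \int[m]_(x in D) ((fun x => (g x * r x)%:E)^\+ x) = \int[m]_(x in D) (p x * r x)%:E.
  apply: eq_integral => x; rewrite inE => /r0 rx; rewrite funeposE -EFin_max; congr (_%:E).
  by rewrite /p maxr_pMl// mul0r.
have -> : \int[m]_(x in D) ((fun x => (g x * r x)%:E)^\- x) = \int[m]_(x in D) (n x * r x)%:E.
  apply: eq_integral => x; rewrite inE => /r0 rx; rewrite funenegE -EFinN -EFin_max; congr (_%:E).
  by rewrite /n maxr_pMl// mul0r mulNr.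
by rewrite ep en fineB//; exact: integrable_fin_num.
Qed.

End signed_transfer.

Section cauchy_kernel.
Context (R : realType).
Local Notation leb := (@lebesgue_measure R).
Local Notation TR := (measurableTypeR R).
Local Notation H := (`[0%R, ((pi : R) / 2)%R]%classic).
Local Notation Re := complex.Re.
Local Notation Im := complex.Im.
Implicit Types (a b t x y tau : R) (z w c : R[i]).

(** The quotient of the claimed density, for tau = 1, by the arc density: a
    bounded function on the cut. *)
Definition cut_kernel b y : R := pi^-1 * (`|y ^+ 2 - b ^+ 2| * ellI (Num.sqrt (1 - y ^+ 2)) b).

Lemma measurable_cut_kernel b : measurable_fun setT (cut_kernel b : TR -> R).
Proof.
rewrite /cut_kernel; apply: measM; first exact: meas_cst.
apply: measM; first by meas_rules.
apply: (@measurable_Rintegral_param R (fun p => (Num.sqrt (1 - p.1 ^+ 2) + ellD b p.2)^-1)).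
  by rewrite /ellD; meas_rules.
by move=> p; rewrite invr_ge0 addr_ge0// sqrtr_ge0.
Qed.

Lemma cut_kernel_ge0 b y : 0 <= cut_kernel b y.
Proof.
rewrite mulr_ge0 ?invr_ge0 ?pi_ge0// mulr_ge0//.
by apply: Rintegral_ge0 => t _; rewrite invr_ge0 addr_ge0// sqrtr_ge0.
Qed.

Lemma cut_kernel_le b y : 0 <= b < 1 -> b <= y <= 1 ->
  cut_kernel b y <= pi^-1 * ((pi / 2) / Num.sqrt (1 - b ^+ 2)).
Proof.
move=> b01 /andP[by_ y1]; have /andP[b0 b1] := b01.
rewrite ler_wpM2l ?invr_ge0 ?pi_ge0//.
have /andP[i0 i1] := ellI_bounds (sqrtr_ge0 (1 - y ^+ 2)) b01.
rewrite -[leRHS]mul1r ler_pM//.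
have by2 : b ^+ 2 <= y ^+ 2 by rewrite ler_pXn2r ?nnegrE// (le_trans b0).
have y2 : y ^+ 2 <= 1 by rewrite expr_le1// (le_trans b0).
by rewrite ger0_norm ?subr_ge0//; have := sqr_ge0 b; lra.
Qed.

Lemma eq_density_arc b y : 0 <= b -> b <= y <= 1 ->
  eq_density 1 b y = cut_kernel b y * arc_density b y.
Proof.
move=> b0 /andP[by_ y1]; have y0 := le_trans b0 by_.
have by2 : 0 <= y ^+ 2 - b ^+ 2 by rewrite subr_ge0 ler_pXn2r ?nnegrE.
rewrite eq_density1E ?y0// /cut_kernel ger0_norm// /arc_density invfM.
rewrite -[X in _ = _ * (X * _) * _](sqr_sqrtr by2); have [->|s0] := eqVneq (Num.sqrt (y ^+ 2 - b ^+ 2)) 0.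
  by rewrite expr0n/= !(mul0r, mulr0).
have [->|a0] := eqVneq (Num.sqrt (1 - y ^+ 2)) 0; first by rewrite invr0 !(mul0r, mulr0).
by move: (Num.sqrt _) (Num.sqrt (y ^+ 2 - b ^+ 2)) (ellI _ _) s0 a0 (pi^-1) => a s I s0 a0 p; field; rewrite s0 a0.
Qed.

Local Open Scope ereal_scope.

Lemma cut_measure_transfer tau b (h : TR -> \bar R) : (0 < b < 1)%R -> (0 < tau)%R -> ellE b = (tau^-1 + 1)%R ->
  measurable_fun setT h -> (forall x, 0 <= h x) ->
  \int[cut_measure tau b]_x h x =
  \int[leb]_(t in H) ((h (cutpar b t) + h (- cutpar b t)%R) * (tau * cut_kernel b (cutpar b t))%:E).
Proof.
move=> b01 t0 Eb mh h0; have /andP[b0 b1] := b01; have b01' : (0 <= b < 1)%R by rewrite ltW.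
rewrite (cut_measure_integral _ b01 t0 Eb) (integral_cut_weighted b01 (ltW t0) mh h0).
pose G (y : TR) := (h y + h (- y)%R) * (cut_kernel b y)%:E.
have mG : measurable_fun setT G.
  apply: emeasurable_funM; first exact: measurable_reflect_sum.
  by apply/measurable_EFinP; exact: measurable_cut_kernel.
have G0 y : 0 <= G y by rewrite mule_ge0 ?adde_ge0// lee_fin cut_kernel_ge0.
transitivity (tau%:E * \int[leb]_(y in `[b, 1%R]) (G y * (arc_density b y)%:E)).
  congr (_ * _); apply: eq_integral => y; rewrite inE/= in_itv/= => yI.
  by rewrite (eq_density_arc (ltW b0) yI) EFinM muleA.
rewrite (integral_arc_density b01' mG G0).
have mGY : measurable_fun H (fun t : TR => G (cutpar b t)).
  by apply: measurable_funTS; apply: (measurableT_comp mG); exact: measurable_cutpar.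
rewrite -(ge0_integralZl_EFin leb (measurable_itv _) (fun t _ => G0 _) mGY (ltW t0)).
by apply: eq_integral => t _; rewrite /G EFinM muleCA.
Qed.

Local Close Scope ereal_scope.

Definition even_cauchy z x : R[i] := (z - x%:C)^-1 + (z + x%:C)^-1.

Lemma even_cauchyE z x : z - x%:C != 0 -> z + x%:C != 0 ->
  even_cauchy z x = 2 * z / (z ^+ 2 - x%:C ^+ 2).
Proof.
move=> z1 z2; rewrite /even_cauchy subr_sqr.
by field; rewrite z1 z2.
Qed.

Lemma measurable_Re_cauchy z : measurable_fun setT (fun x : TR => Re ((z - (x : R)%:C)^-1)).
Proof.
have -> : (fun x : TR => Re ((z - (x : R)%:C)^-1)) =
  (fun x : TR => (Re z - x) / ((Re z - x) ^+ 2 + (Im z) ^+ 2)).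
  by apply/funext => x; rewrite cReV cReD cReN cImD cImN /= subr0.
by meas_rules.
Qed.

Lemma measurable_Im_cauchy z : measurable_fun setT (fun x : TR => Im ((z - (x : R)%:C)^-1)).
Proof.
have -> : (fun x : TR => Im ((z - (x : R)%:C)^-1)) =
  (fun x : TR => - (Im z / ((Re z - x) ^+ 2 + (Im z) ^+ 2))).
  by apply/funext => x; rewrite cImV cReD cReN cImD cImN /= subr0.
by meas_rules.
Qed.

Lemma ccont_cauchy z t : z - t%:C != 0 -> ccont (fun x : R => (z - x%:C)^-1) t.
Proof.
move=> zt; apply: ccontV => //.
by apply: ccontD; [exact: ccontC|apply: ccontN; apply: ccontR; exact: contI].
Qed.

Lemma cauchy_bounded z : complex_off `[-1, 1] z ->
  exists M : R, forall t, t \in `[-1, 1] -> `|Re ((z - t%:C)^-1)| <= M /\ `|Im ((z - t%:C)^-1)| <= M.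
Proof.
move=> zo; have N11 : (-1 : R) <= 1 by rewrite (le_trans (lerN10 _)).
have c t : t \in `[-1, 1] -> ccont (fun x : R => (z - x%:C)^-1) t.
  by move=> tI; apply: ccont_cauchy; exact: complex_off_itv zo tI.
have [M1 h1] := cont_bounded N11 (fun t tI => (c t tI).1).
have [M2 h2] := cont_bounded N11 (fun t tI => (c t tI).2).
exists (Num.max M1 M2) => t tI; rewrite !le_max (h1 t tI) (h2 t tI) orbT; split => //.
Qed.

Lemma cutpar_in b t : 0 <= b < 1 -> cutpar b t \in `[-1, 1] /\ - cutpar b t \in `[-1, 1].
Proof.
move=> b01; have /andP[c0 c1] := cutpar_bounds t b01; have /andP[b0 b1] := b01.
by rewrite !in_itv/=; split; apply/andP; split; lra.
Qed.

Lemma cauchy_transform_cutpar tau b z : 0 < b < 1 -> 0 < tau -> ellE b = tau^-1 + 1 ->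
  complex_off `[-1, 1] z ->
  cauchy_transform (cut_measure tau b) z =
  cintegral leb H (fun t => even_cauchy z (cutpar b t) * (tau * cut_kernel b (cutpar b t))%:C).
Proof.
move=> b01 t0 Eb zo; have /andP[b0 b1] := b01; have b01' : 0 <= b < 1 by rewrite ltW.
have [M hM] := cauchy_bounded zo.
have tr (h : TR -> \bar R) : measurable_fun setT h -> (forall x, 0 <= h x)%E ->
  (\int[cut_measure tau b]_(x in setT) (h x * (1%R)%:E) =
  \int[leb]_(t in H) ((h (cutpar b t) + h (- cutpar b t)%R) * (tau * cut_kernel b (cutpar b t))%:E))%E.
  move=> mh h0; rewrite -(cut_measure_transfer b01 t0 Eb mh h0).
  by apply: eq_integral => x _; rewrite mule1.
have mK : measurable_fun H (fun t : TR => tau * cut_kernel b (cutpar b t)).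
  apply: measM; first exact: meas_cst.
  apply: measurable_funTS; apply: (measurableT_comp (@measurable_cut_kernel b)).
  exact: measurable_cutpar.
have KB t : t \in H -> 0 <= tau * cut_kernel b (cutpar b t) <= tau * (pi^-1 * ((pi / 2) / Num.sqrt (1 - b ^+ 2))).
  move=> _; apply/andP; split; first by rewrite mulr_ge0 ?cut_kernel_ge0 ?ltW.
  rewrite ler_pM2l//; apply: cut_kernel_le => //; exact: cutpar_bounds.
have mY := @measurable_cutpar R b setT.
have T := signed_transfer tr (fun x _ => ler01) mY mK KB.
rewrite /cauchy_transform /cintegral; apply: complex_eqP => /=.
  transitivity (\int[cut_measure tau b]_x (Re ((z - x%:C)^-1) * 1)).
    by apply: eq_Rintegral => x _; rewrite mulr1.
  rewrite (T M _ (measurable_Re_cauchy z)); last first.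
    by move=> t _; have [c1 c2] := cutpar_in t b01'; have [? _] := hM _ c1; have [? _] := hM _ c2.
  apply: eq_Rintegral => t _; rewrite cReM /= mulr0 subr0; congr (_ * _).
  by rewrite cReD rmorphN opprK.
transitivity (\int[cut_measure tau b]_x (Im ((z - x%:C)^-1) * 1)).
  by apply: eq_Rintegral => x _; rewrite mulr1.
rewrite (T M _ (measurable_Im_cauchy z)); last first.
  by move=> t _; have [c1 c2] := cutpar_in t b01'; have [_ ?] := hM _ c1; have [_ ?] := hM _ c2.
apply: eq_Rintegral => t _; rewrite cImM /= mulr0 add0r; congr (_ * _).
by rewrite cImD rmorphN opprK.
Qed.

End cauchy_kernel.

(** * Exchange of the two angular integrals *)

Section cauchy_formula_proof.
Context (R : realType).
Local Notation leb := (@lebesgue_measure R).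
Local Notation TR := (measurableTypeR R).
Local Notation H := (`[0%R, ((pi : R) / 2)%R]%classic).
Local Notation Re := complex.Re.
Local Notation Im := complex.Im.
Implicit Types (a b t x y tau : R) (z w c : R[i]).

Definition even_cauchy_primitive z x := cauchy_log z x - cauchy_log z (- x).

Lemma cder_even_cauchy z x : complex_off `[-1, 1] z -> x \in `[-1, 1] ->
  cder (even_cauchy_primitive z) x (even_cauchy z x).
Proof.
move=> zo xI; have xI' : - x \in `[-1, 1].
  by move: xI; rewrite !in_itv/= => /andP[x0 x1]; apply/andP; split; lra.
have dN : is_derive (x : R) (1 : R) (fun s : R => - s) (- 1) by apply: derN; exact: derI.
have d2 := cder_comp (cder_cauchy_log zo xI') dN.
apply: (cder_eq (cderD (cder_cauchy_log zo xI) (cderN d2))).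
by rewrite /even_cauchy !rmorphN rmorph1 mulrN1 !opprK.
Qed.

Lemma ccont_even_cauchy z (h : R -> R) t : complex_off `[-1, 1] z -> h t \in `[-1, 1] ->
  cont_at h t -> ccont (fun s => even_cauchy z (h s)) t.
Proof.
move=> zo xI ch; have z1 := complex_off_itv zo xI.
have xI' : - h t \in `[-1, 1].
  by move: xI; rewrite !in_itv/= => /andP[x0 x1]; apply/andP; split; lra.
have z2 := complex_off_itv zo xI'; rewrite rmorphN opprK in z2.
apply: ccontD; apply: ccontV => //; apply: ccontD; try exact: ccontC.
  by apply: ccontN; exact: ccontR.
exact: ccontR.
Qed.

Lemma integral_even_cauchy_path z (h h' : R -> R) a b : complex_off `[-1, 1] z -> a <= b ->
  (forall t, t \in `[a, b] -> h t \in `[-1, 1]) ->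
  (forall t, t \in `[a, b] -> is_derive (t : R) (1 : R) h (h' t)) ->
  (forall t, t \in `[a, b] -> cont_at h' t) ->
  cintegral leb `[a, b] (fun t => even_cauchy z (h t) * (h' t)%:C) =
  even_cauchy_primitive z (h b) - even_cauchy_primitive z (h a).
Proof.
move=> zo ab hI dh ch'.
have dF t : t \in `[a, b] -> cder (fun s => even_cauchy_primitive z (h s)) t (even_cauchy z (h t) * (h' t)%:C).
  by move=> tI; apply: cder_comp; [apply: cder_even_cauchy => //; exact: hI|exact: dh].
rewrite (CFTC ab dF)// => t tI; apply: ccontM; last by apply: ccontR; exact: ch'.
apply: ccont_even_cauchy => //; first exact: hI.
exact: der_continuous (dh t tI).
Qed.

(** The kernel (y^2 - b^2) / (y^2 - x^2) that links a point y = y(t) of the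
    cut to a point x = b sin u of the gap. *)
Definition cut_ratio b t u : R := (cutpar b t ^+ 2 - b ^+ 2) / (cutpar b t ^+ 2 - (b * sin u) ^+ 2).

Lemma cut_ratio_bounds b t u : 0 <= b < 1 -> 0 <= cut_ratio b t u <= 1.
Proof.
move=> /andP[b0 b1]; rewrite /cut_ratio sqr_cutpar exprMn.
have b2 : b ^+ 2 < 1 by rewrite expr_lt1.
have q0 : 0 <= (1 - b ^+ 2) * sin t ^+ 2 by rewrite mulr_ge0 ?sqr_ge0// subr_ge0 ltW.
have -> : b ^+ 2 + (1 - b ^+ 2) * sin t ^+ 2 - b ^+ 2 = (1 - b ^+ 2) * sin t ^+ 2 by ring.
have le : (1 - b ^+ 2) * sin t ^+ 2 <= b ^+ 2 + (1 - b ^+ 2) * sin t ^+ 2 - b ^+ 2 * sin u ^+ 2.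
  have : 0 <= b ^+ 2 * (1 - sin u ^+ 2) by rewrite mulr_ge0 ?sqr_ge0// subr_ge0 sin2_le1.
  by lra.
have d0 := le_trans q0 le; rewrite divr_ge0//=.
move: le d0; rewrite le_eqVlt => /orP[/eqP <-|lt] d0.
  by have [->|q1] := eqVneq ((1 - b ^+ 2) * sin t ^+ 2) 0; [rewrite mul0r|rewrite divff].
by rewrite ler_pdivrMr ?mul1r ?(ltW lt)// (le_lt_trans q0).
Qed.

Lemma measurable_cut_ratio b (D : set (TR * TR)) :
  measurable_fun D (fun p : TR * TR => cut_ratio b p.1 p.2).
Proof. by rewrite /cut_ratio /cutpar; meas_rules. Qed.

(** The angular form of the part of the density that corresponds to the
    integral over the gap in the formula for the Cauchy transform. *)
Definition ratio_integral b t : R := \int[leb]_(u in H) (ellD b u * cut_ratio b t u).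

Lemma measurable_ratio_integral b : 0 <= b < 1 -> measurable_fun setT (ratio_integral b : TR -> R).
Proof.
move=> b01; apply: (@measurable_Rintegral_param R (fun p => ellD b p.2 * cut_ratio b p.1 p.2)).
  by apply: measM; [rewrite /ellD; meas_rules|exact: measurable_cut_ratio].
by move=> p; have /andP[? _] := cut_ratio_bounds p.1 p.2 b01; rewrite mulr_ge0// sqrtr_ge0.
Qed.

Lemma measurable_cut_ratio1 b t (D : set TR) : measurable_fun D (fun u : TR => cut_ratio b t u).
Proof. by rewrite /cut_ratio; meas_rules. Qed.

Lemma measurable_cut_ratio2 b u (D : set TR) : measurable_fun D (fun t : TR => cut_ratio b t u).
Proof. by rewrite /cut_ratio /cutpar; meas_rules. Qed.

Lemma ratio_kernel_bounds b t u : 0 <= b < 1 -> 0 <= ellD b u * cut_ratio b t u <= 1.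
Proof.
move=> b01; have /andP[r0 r1] := cut_ratio_bounds t u b01.
by rewrite mulr_ge0 ?sqrtr_ge0//= mulr_ile1// ?sqrtr_ge0// ellD_le1.
Qed.

Lemma integrable_ratio_kernel b t : 0 <= b < 1 ->
  leb.-integrable H (EFin \o (fun u => ellD b u * cut_ratio b t u)).
Proof.
move=> b01; apply: (@bounded_integrable_itv R 0 (pi / 2) 1).
  by apply: measM; [rewrite /ellD; meas_rules|exact: measurable_cut_ratio1].
move=> u _; have /andP[r0 r1] := ratio_kernel_bounds t u b01.
by rewrite ger0_norm.
Qed.

Lemma ratio_integral_bounds b t : 0 <= b < 1 -> 0 <= ratio_integral b t <= pi / 2.
Proof.
move=> b01; apply/andP; split.
  by apply: Rintegral_ge0 => u _; have /andP[] := ratio_kernel_bounds t u b01.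
rewrite -[leRHS]mul1r -Rintegral_cst_pihalf; apply: le_Rintegral => //.
- exact: integrable_ratio_kernel.
- by apply: cont_on_integrable => u _; exact: contC.
- by move=> u _; have /andP[] := ratio_kernel_bounds t u b01.
Qed.

Definition dcutpar b t : R := (1 - b ^+ 2) * (sin t * cos t) / cutpar b t.

(** Rationalize the integrand of ellI: with a = sqrt(1 - y^2) and
    D = sqrt(1 - b^2 sin^2 u), one has D^2 - a^2 = y^2 - (b sin u)^2, so
    (y^2 - b^2) / (a + D) is (D - a) [cut_ratio b t u]. The part with D is
    [ratio_integral], and the part with a is elementary. *)
Lemma cut_kernel_split b t : 0 < b < 1 -> t \in `[0, (pi : R) / 2] ->
  cut_kernel b (cutpar b t) = pi^-1 * ratio_integral b t - 2^-1 * dcutpar b t.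
Proof.
move=> b01 tI; have /andP[b0 b1] := b01; have b01' : 0 <= b < 1 by rewrite ltW.
have [/andP[s0 s1] /andP[c0 c1]] := in_pihalf_cc tI.
have r0 : 0 < 1 - b ^+ 2 by rewrite subr_gt0 expr_lt1// ltW.
have pi0 : (pi : R) != 0 by rewrite gt_eqF// pi_gt0.
have yb : cutpar b t ^+ 2 - b ^+ 2 = (1 - b ^+ 2) * sin t ^+ 2 by rewrite sqr_cutpar; ring.
have [st|st] := eqVneq (sin t) 0.
  have r00 : ratio_integral b t = 0.
    rewrite /ratio_integral; transitivity (\int[leb]_(u in H) (0 : R)); last by rewrite Rintegral_cst_pihalf mul0r.
    by apply: eq_Rintegral => u _; rewrite /cut_ratio yb st expr0n/= mulr0 mul0r mulr0.
  rewrite /cut_kernel yb /dcutpar r00 st expr0n/= !(mulr0, mul0r, normr0) subrr//.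
have sp : 0 < sin t by rewrite lt_neqAle eq_sym st.
have q0 : 0 < (1 - b ^+ 2) * sin t ^+ 2 by rewrite mulr_gt0// exprn_gt0.
have /andP[by_ y1] := cutpar_bounds t b01'.
have y0 : 0 < cutpar b t by rewrite (lt_le_trans b0).
have y2 : 0 < cutpar b t ^+ 2 by rewrite exprn_gt0.
set a := Num.sqrt (1 - cutpar b t ^+ 2).
have a0 : 0 <= a by exact: sqrtr_ge0.
have a2 : a ^+ 2 = 1 - cutpar b t ^+ 2.
  by rewrite sqr_sqrtr// subr_ge0 expr_le1// ltW.
have den u : cutpar b t ^+ 2 - (b * sin u) ^+ 2 =
   cutpar b t ^+ 2 * cos u ^+ 2 + (1 - b ^+ 2) * sin t ^+ 2 * sin u ^+ 2.
  by rewrite -yb cos2sin2; ring.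
have den0 u : 0 < cutpar b t ^+ 2 - (b * sin u) ^+ 2.
  have : 0 <= b ^+ 2 * (1 - sin u ^+ 2) by rewrite mulr_ge0 ?sqr_ge0// subr_ge0 sin2_le1.
  by rewrite exprMn; lra.
have D0 u := ellD_gt0 u b01'.
have b01'' : 0 <= b <= 1 by rewrite !ltW.
have key u : (cutpar b t ^+ 2 - b ^+ 2) * (a + ellD b u)^-1 =
   ellD b u * cut_ratio b t u - a * cut_ratio b t u.
  have e : cutpar b t ^+ 2 - (b * sin u) ^+ 2 = (ellD b u - a) * (ellD b u + a).
    by rewrite -subr_sqr a2 sqr_ellD//; ring.
  have d0 := den0 u; rewrite /cut_ratio e in d0 *.
  have aD : 0 < a + ellD b u by rewrite ltr_wpDl.
  have Da : ellD b u - a != 0 by apply/eqP => Da; move: d0; rewrite Da mul0r ltxx.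
  by field; rewrite Da addrC gt_eqF.
have aD0 u : a + ellD b u != 0 by rewrite gt_eqF// ltr_wpDl.
have ratioI : leb.-integrable H (EFin \o (fun u => cut_ratio b t u)).
  apply: (@bounded_integrable_itv R 0 (pi / 2) 1); first exact: measurable_cut_ratio1.
  by move=> u _; have /andP[h0 h1] := cut_ratio_bounds t u b01'; rewrite ger0_norm.
have ratioE : \int[leb]_(u in H) cut_ratio b t u = pi / 2 * (Num.sqrt ((1 - b ^+ 2) * sin t ^+ 2) / cutpar b t).
  transitivity ((1 - b ^+ 2) * sin t ^+ 2 * \int[leb]_(u in H) (cutpar b t ^+ 2 * cos u ^+ 2 + (1 - b ^+ 2) * sin t ^+ 2 * sin u ^+ 2)^-1).
    rewrite -RintegralZl//.
      by apply: eq_Rintegral => u _; rewrite /cut_ratio den yb.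
    by apply: cont_on_integrable => u _; cont_rules; rewrite -den gt_eqF.
  rewrite integral_inv_quadratic_real// sqrtr_sqr (gtr0_norm y0).
  rewrite -{1}(sqr_sqrtr (ltW q0)); have : 0 < Num.sqrt ((1 - b ^+ 2) * sin t ^+ 2) by rewrite sqrtr_gt0.
  by move: (Num.sqrt _) (pi : R) => r p r00; field; rewrite !gt_eqF.
have -> : cut_kernel b (cutpar b t) = pi^-1 * (ratio_integral b t - a * \int[leb]_(u in H) cut_ratio b t u).
  rewrite /cut_kernel ger0_norm ?yb ?(ltW q0)//; congr (_ * _).
  rewrite /ellI -yb -RintegralZl//; last first.
    apply: cont_on_integrable => u _; apply: contV; first exact: (aD0 u).
    by apply: contD; [exact: contC|exact: cont_ellD].
  rewrite /ratio_integral -[X in _ = _ - X]RintegralZl// -RintegralB//.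
  - by apply: eq_Rintegral => u _; exact: key.
  - exact: integrable_ratio_kernel.
  - exact: integrable_realZ.
rewrite ratioE mulrBr; congr (_ - _); rewrite /dcutpar.
have -> : a = Num.sqrt (1 - b ^+ 2) * cos t.
  rewrite /a sqr_cutpar (_ : 1 - _ = (1 - b ^+ 2) * cos t ^+ 2); last by rewrite cos2sin2; ring.
  by rewrite (sqrtrM _ (ltW r0)) sqrtr_sqr ger0_norm.
rewrite (sqrtrM _ (ltW r0)) sqrtr_sqr (gtr0_norm sp) -{3}(sqr_sqrtr (ltW r0)).
by move: (Num.sqrt _) (pi : R) pi0 => r p p0; field; rewrite p0 gt_eqF.
Qed.

Lemma ratio_fubini b (f : R -> R) (M : R) : 0 <= b < 1 -> measurable_fun setT (f : TR -> R) ->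
  (forall t, t \in `[0, (pi : R) / 2] -> `|f t| <= M) ->
  \int[leb]_(t in H) (f t * ratio_integral b t) =
  \int[leb]_(u in H) (ellD b u * \int[leb]_(t in H) (f t * cut_ratio b t u)).
Proof.
move=> b01 mf fM.
have D01 u : 0 <= ellD b u <= 1 by rewrite sqrtr_ge0 ellD_le1.
transitivity (\int[leb]_(t in H) \int[leb]_(u in H) (f t * (ellD b u * cut_ratio b t u))).
  by apply: eq_Rintegral => t _; rewrite RintegralZl//; exact: integrable_ratio_kernel.
rewrite (@Rfubini_bounded R 0 (pi / 2) 0 (pi / 2) M (fun p => f p.1 * (ellD b p.2 * cut_ratio b p.1 p.2))).
- apply: eq_Rintegral => u _; rewrite -RintegralZl//.
    by apply: eq_Rintegral => t _; rewrite mulrCA.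
  apply: (@bounded_integrable_itv R 0 (pi / 2) M).
    by apply: measM; [exact: measurable_funTS|exact: measurable_cut_ratio2].
  move=> t tI; have /andP[r0 r1] := cut_ratio_bounds t u b01.
  by rewrite normrM (ger0_norm r0) -[leRHS]mulr1 ler_pM// fM.
- apply: measM; first by apply: measurable_funTS; exact: (measurableT_comp mf measurable_fst).
  by apply: measM; [rewrite /ellD; meas_rules|exact: measurable_cut_ratio].
- move=> t u tI _; have /andP[r0 r1] := ratio_kernel_bounds t u b01.
  by rewrite normrM (ger0_norm r0) -[leRHS]mulr1 ler_pM// fM.
Qed.

Lemma measurable_even_cauchy z (h : R -> R) : measurable_fun setT (h : TR -> R) ->
  measurable_fun setT (fun t : TR => Re (even_cauchy z (h t))) /\
  measurable_fun setT (fun t : TR => Im (even_cauchy z (h t))).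
Proof.
move=> mh; have mN : measurable_fun setT (fun t : TR => - h t) by exact: measN.
have e t : z + (h t)%:C = z - (- h t)%:C by rewrite rmorphN opprK.
split.
  have -> : (fun t : TR => Re (even_cauchy z (h t))) =
    (fun t : TR => Re ((z - (h t)%:C)^-1) + Re ((z - (- h t)%:C)^-1)).
    by apply/funext => t; rewrite /even_cauchy cReD e.
  apply: measD; first exact: (measurableT_comp (measurable_Re_cauchy z) mh).
  exact: (measurableT_comp (measurable_Re_cauchy z) mN).
have -> : (fun t : TR => Im (even_cauchy z (h t))) =
  (fun t : TR => Im ((z - (h t)%:C)^-1) + Im ((z - (- h t)%:C)^-1)).
  by apply/funext => t; rewrite /even_cauchy cImD e.
apply: measD; first exact: (measurableT_comp (measurable_Im_cauchy z) mh).
exact: (measurableT_comp (measurable_Im_cauchy z) mN).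
Qed.

Lemma even_cauchy_bounded z : complex_off `[-1, 1] z ->
  exists M : R, forall x, x \in `[-1, 1] ->
    `|Re (even_cauchy z x)| <= M /\ `|Im (even_cauchy z x)| <= M.
Proof.
move=> zo; have [M hM] := cauchy_bounded zo; exists (M + M) => x xI.
have xI' : - x \in `[-1, 1].
  by move: xI; rewrite !in_itv/= => /andP[x0 x1]; apply/andP; split; lra.
have [a1 a2] := hM _ xI; have [a3 a4] := hM _ xI'; rewrite rmorphN opprK in a3 a4.
rewrite /even_cauchy cReD cImD; split; apply: (le_trans (ler_normD _ _)); exact: lerD.
Qed.

Lemma eq_cintegral_oo a b (f g : R -> R[i]) : cintegrable `[a, b] g ->
  measurable_fun (`[a, b]%classic : set TR) (fun t : TR => Re (f t)) ->
  measurable_fun (`[a, b]%classic : set TR) (fun t : TR => Im (f t)) ->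
  (forall t, t \in `]a, b[ -> f t = g t) ->
  cintegral leb `[a, b] f = cintegral leb `[a, b] g.
Proof.
move=> [g1 g2] m1 m2 fg.
have mg1 : measurable_fun (`[a, b]%classic : set TR) (fun t : TR => Re (g t)).
  by apply/measurable_EFinP; exact: measurable_int g1.
have mg2 : measurable_fun (`[a, b]%classic : set TR) (fun t : TR => Im (g t)).
  by apply/measurable_EFinP; exact: measurable_int g2.
rewrite /cintegral; congr (_ +i* _).
  by apply: Rintegral_eq_oo => // t tI; rewrite fg.
by apply: Rintegral_eq_oo => // t tI; rewrite fg.
Qed.

Lemma cintegral_real (D : set R) (f : R -> R) : cintegral leb D (fun t => (f t)%:C) = (\int[leb]_(t in D) f t)%:C.
Proof.
rewrite /cintegral /=; congr (_ +i* _).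
by rewrite /Rintegral integral0.
Qed.

Lemma cintegrable_real (D : set TR) (f : R -> R) : measurable D -> leb.-integrable D (EFin \o f) ->
  cintegrable D (fun t => (f t)%:C).
Proof.
move=> mD fi; split => //=.
by rewrite (_ : EFin \o _ = cst 0%E)//; exact: integrable0.
Qed.

(** In the variable v = y(t)^2 the integrand is a product of 1 / (z^2 - v)
    and (v - b^2) / (v - (b sin u)^2). Partial fractions leave
    c^2 / (c^2 cos^2 t + sin^2 t) for the pole at z^2, and the analogous
    real expression for the other; both integrate by
    [integral_inv_quadratic]. The condition Re c > 0 selects the square
    root. *)
Lemma inner_integral b z c u : 0 < b < 1 -> complex_off `[-1, 1] z ->
  0 < Re c -> c ^+ 2 = (z ^+ 2 - b%:C ^+ 2) / (z ^+ 2 - 1) -> u \in `[0, (pi : R) / 2] ->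
  cintegral leb H (fun t => even_cauchy z (cutpar b t) * (cut_ratio b t u)%:C) =
  even_cauchy z (b * sin u) * ((pi / 2)%:C * (c - (b * cos u / ellD b u)%:C)).
Proof.
move=> b01 zo c0 c2 uI; have /andP[b0 b1] := b01; have b01' : 0 <= b < 1 by rewrite ltW.
have [/andP[s0 s1] /andP[cu0 cu1]] := in_pihalf_cc uI.
have mH : measurable (H : set TR) by exact: measurable_itv.
have cn0 : c != 0 by apply/eqP => /(congr1 (@complex.Re R)) /=; lra.
have zt x := @complex_off_itv R (-1) 1 z x zo.
have zt' x : x \in `[-1, 1] -> z ^+ 2 - x%:C ^+ 2 != 0.
  move=> xI; rewrite subr_sqr mulf_neq0 ?zt//.
  have := @zt (- x); rewrite rmorphN opprK; apply.
  by move: xI; rewrite !in_itv/= => /andP[x0 x1]; apply/andP; split; lra.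
have EE x : x \in `[-1, 1] -> even_cauchy z x = 2 * z / (z ^+ 2 - x%:C ^+ 2).
  move=> xI; apply: even_cauchyE; first exact: zt.
  have := @zt (- x); rewrite rmorphN opprK; apply.
  by move: xI; rewrite !in_itv/= => /andP[x0 x1]; apply/andP; split; lra.
have z1 : z ^+ 2 - 1 != 0.
  by have := @zt' 1; rewrite rmorph1 expr1n; apply; rewrite in_itv/= lexx andbT (le_trans (lerN10 _)).
have bs0 : 0 <= b * sin u by rewrite mulr_ge0// ltW.
have bs1 : b * sin u <= b by rewrite ler_piMr// ltW.
have sI : b * sin u \in `[-1, 1] by rewrite in_itv/=; apply/andP; split; lra.
pose s := (b * sin u) ^+ 2.
have sb : s <= b ^+ 2 by rewrite /s ler_pXn2r ?nnegrE// ltW.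
have be1 : 0 < 1 - b ^+ 2 by rewrite subr_gt0 expr_lt1// ltW.
have bs : b ^+ 2 - s = (b * cos u) ^+ 2 by rewrite /s !exprMn cos2sin2; ring.
have D2 : 1 - s = ellD b u ^+ 2 by rewrite sqr_ellD ?(ltW b0) ?(ltW b1)// /s exprMn.
have D0 := ellD_gt0 u b01'.
pose Q t : R[i] := (c ^+ 2 * (cos t)%:C ^+ 2 + (sin t)%:C ^+ 2)^-1.
pose q t : R := (b ^+ 2 - s) / (cutpar b t ^+ 2 - s).
have Q0 t : c ^+ 2 * (cos t)%:C ^+ 2 + (sin t)%:C ^+ 2 = (z ^+ 2 - (cutpar b t)%:C ^+ 2) / (z ^+ 2 - 1).
  rewrite c2 -(rmorphXn _ 2 (cutpar b t)) /= /cutpar sqr_sqrtr; last first.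
    by rewrite addr_ge0 ?sqr_ge0// mulr_ge0 ?sqr_ge0.
  rewrite rmorphD rmorphM !rmorphXn /=; have := real_trig t.
  move: (cos t)%:C (sin t)%:C b%:C => C S B T.
  transitivity ((z ^+ 2 * (C ^+ 2 + S ^+ 2) - (B ^+ 2 * C ^+ 2 + S ^+ 2)) / (z ^+ 2 - 1)).
    by field.
  by rewrite T mulr1.
have cutI t : cutpar b t \in `[-1, 1] by have [] := cutpar_in t b01'.
have Qn0 t : c ^+ 2 * (cos t)%:C ^+ 2 + (sin t)%:C ^+ 2 != 0.
  by rewrite Q0 mulf_neq0 ?invr_eq0// zt'.
have cQ t : ccont Q t.
  apply: ccontV; first exact: Qn0.
  have cs : ccont (fun s : R => (sin s)%:C) t by apply: ccontR; exact: continuous_sin.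
  have cc : ccont (fun s : R => (cos s)%:C) t by apply: ccontR; exact: continuous_cos.
  by apply: ccontD; [apply: ccontM; [exact: ccontC|exact: ccontM]|exact: ccontM].
have iQ : cintegrable H Q by apply: ccont_integrable => t _; exact: cQ.
have den t : cutpar b t ^+ 2 - s = (b ^+ 2 - s) * cos t ^+ 2 + (1 - s) * sin t ^+ 2.
  by rewrite sqr_cutpar cos2sin2; ring.
have [iq Iq] : leb.-integrable H (EFin \o q) /\
    \int[leb]_(t in H) q t = pi / 2 * (b * cos u / ellD b u).
  have [bs00|bs00] := eqVneq (b * cos u) 0.
    have q00 : q = cst 0 by apply/funext => t; rewrite /q bs bs00 expr0n/= mul0r.
    rewrite q00 bs00 mul0r mulr0; split; last by rewrite /Rintegral integral0.
    by rewrite (_ : EFin \o _ = cst 0%E)//; exact: integrable0.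
  have bc0 : 0 < b * cos u by rewrite lt_neqAle eq_sym bs00 mulr_ge0// ltW.
  have p1 : 0 < b ^+ 2 - s by rewrite bs exprn_gt0.
  have p2 : 0 < 1 - s by rewrite D2 exprn_gt0.
  have dp t : 0 < cutpar b t ^+ 2 - s.
    have q0 : 0 <= (1 - b ^+ 2) * sin t ^+ 2 by rewrite mulr_ge0 ?sqr_ge0// ltW.
    by rewrite sqr_cutpar; lra.
  have ci t : cont_at (fun t => (cutpar b t ^+ 2 - s)^-1) t.
    have cc := @cont_cutpar R b t; apply: contV; first by rewrite gt_eqF.
    by apply: contD; [exact: contX|exact: contC].
  split; first by apply: cont_on_integrable => t _; apply: contM; [exact: contC|exact: ci].
  rewrite RintegralZl//; last by apply: cont_on_integrable => t _; exact: ci.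
  under eq_Rintegral do rewrite den.
  rewrite integral_inv_quadratic_real// bs D2 !sqrtr_sqr !gtr0_norm//.
  by move: (pi : R) (ellD b u) (b * cos u) D0 bc0 => p d e d0 e0; field; rewrite !gt_eqF.
have iqc := cintegrable_real mH iq.
have iAQ := cintegrableZ (c ^+ 2) mH iQ.
have iG : cintegrable H (fun t => c ^+ 2 * Q t + - (q t)%:C).
  have [a1 a2] := iAQ; have [a3 a4] := cintegrableN mH iqc.
  split.
    rewrite (_ : EFin \o _ = (fun t => (Re (c ^+ 2 * Q t))%:E + (Re (- (q t)%:C))%:E)%E).
      exact: integrableD.
    by apply/funext => t; rewrite /= cReD EFinD.
  rewrite (_ : EFin \o _ = (fun t => (Im (c ^+ 2 * Q t))%:E + (Im (- (q t)%:C))%:E)%E).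
    exact: integrableD.
  by apply/funext => t; rewrite /= cImD EFinD.
have [mE1 mE2] := measurable_even_cauchy z (@measurable_cutpar R b setT).
have mr := @measurable_cut_ratio2 b u H.
rewrite (@eq_cintegral_oo 0 (pi / 2) _ (fun t => even_cauchy z (b * sin u) * (c ^+ 2 * Q t + - (q t)%:C))).
- rewrite cintegralZ//; congr (_ * _).
  rewrite cintegralB// cintegralZ// integral_inv_quadratic// cintegral_real Iq (rmorphM _ (pi / 2)) /=.
  by move: (pi / 2)%:C (b * cos u / ellD b u)%:C => p e; field.
- exact: cintegrableZ.
- have -> : (fun t : TR => Re (even_cauchy z (cutpar b t) * (cut_ratio b t u)%:C)) =
    (fun t : TR => Re (even_cauchy z (cutpar b t)) * cut_ratio b t u).
    by apply/funext => t; rewrite cReM /= mulr0 subr0.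
  by apply: measM => //; exact: measurable_funTS.
- have -> : (fun t : TR => Im (even_cauchy z (cutpar b t) * (cut_ratio b t u)%:C)) =
    (fun t : TR => Im (even_cauchy z (cutpar b t)) * cut_ratio b t u).
    by apply/funext => t; rewrite cImM /= mulr0 add0r.
  by apply: measM => //; exact: measurable_funTS.
- move=> t tI; have [st0 _ _ _] := in_pihalf tI.
  have dp : 0 < cutpar b t ^+ 2 - s.
    have q0 : 0 < (1 - b ^+ 2) * sin t ^+ 2 by rewrite mulr_gt0// exprn_gt0.
    by rewrite sqr_cutpar; lra.
  rewrite /Q Q0 invf_div c2 (EE _ (cutI t)) (EE _ sI) /cut_ratio /q -/s.
  have zs := zt' _ sI; have zc := zt' _ (cutI t).
  rewrite -(rmorphXn _ 2 (cutpar b t)) /= in zc *.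
  rewrite -(rmorphXn _ 2 (b * sin u)) /= -/s in zs *.
  have vs : (cutpar b t ^+ 2)%:C - s%:C != 0.
    by rewrite -rmorphB /=; apply/eqP => /(congr1 (@complex.Re R)) /= h; move: dp; rewrite h ltxx.
  move: (cutpar b t ^+ 2) (s) vs zs zc => v s' vs zs zc.
  rewrite !rmorphM !fmorphV !rmorphB /= -?expr2 (rmorphXn _ 2 b) /=.
  move: (v%:C) (s'%:C) (b%:C) vs zs zc => {}v {}s' B vs zs zc.
  by field; rewrite z1 vs zs zc.
Qed.

End cauchy_formula_proof.

(** * The integral over the gap and the formula for the Cauchy transform *)

Section assembly.
Context (R : realType).
Local Notation leb := (@lebesgue_measure R).
Local Notation TR := (measurableTypeR R).
Local Notation H := (`[0%R, ((pi : R) / 2)%R]%classic).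
Local Notation Re := complex.Re.
Local Notation Im := complex.Im.
Local Notation normc := Normc.normc.
Implicit Types (a b t x y tau : R) (z w c : R[i]).

Let pi2_gt0 : 0 < (pi : R) / 2. Proof. by rewrite divr_gt0 ?pi_gt0. Qed.

Definition gap_weight b x : R := Num.sqrt ((1 - x ^+ 2) / (b ^+ 2 - x ^+ 2)).

(** The substitution x = b sin u removes the singularity of the weight at
    the ends of the gap. *)
Lemma gap_weight_sin b u : 0 < b < 1 -> u \in `]0, (pi : R) / 2[ ->
  gap_weight b (b * sin u) * (b * cos u) = ellD b u.
Proof.
move=> /andP[b0 b1] /in_pihalf[s0 s1 c0 c1]; rewrite /gap_weight exprMn.
have bc0 : 0 < b * cos u by rewrite mulr_gt0.
have -> : b ^+ 2 - b ^+ 2 * sin u ^+ 2 = (b * cos u) ^+ 2 by rewrite exprMn cos2sin2; ring.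
have d0 : 0 <= 1 - b ^+ 2 * sin u ^+ 2.
  have := sin2_le1 u; have : b ^+ 2 <= 1 by rewrite expr_le1// ltW.
  by have := sqr_ge0 b; have := sqr_ge0 (sin u); nra.
rewrite (sqrtrM _ d0) sqrtrV ?sqr_ge0// sqrtr_sqr gtr0_norm// -mulrA mulVf ?mulr1//.
by rewrite gt_eqF.
Qed.

Local Open Scope ereal_scope.

Lemma integral_gap_sin b (h : TR -> \bar R) : (0 < b < 1)%R ->
  measurable_fun setT h -> (forall x, 0 <= h x) ->
  \int[leb]_(x in `[(- b)%R, b]) (h x * (gap_weight b x)%:E) =
  \int[leb]_(u in H) ((h (b * sin u)%R + h (- (b * sin u))%R) * (ellD b u)%:E).
Proof.
move=> b01 mh h0; have /andP[b0 b1] := b01.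
have mr : measurable_fun setT (fun x : TR => (gap_weight b x)%:E).
  by apply/measurable_EFinP; rewrite /gap_weight; meas_rules.
have r0 x : 0 <= (gap_weight b x)%:E by rewrite lee_fin sqrtr_ge0.
have rN x : gap_weight b (- x) = gap_weight b x by rewrite /gap_weight sqrrN.
pose G (x : TR) := (h x + h (- x)%R) * (gap_weight b x)%:E.
have mhr : measurable_fun setT (fun x : TR => h x * (gap_weight b x)%:E) by exact: emeasurable_funM.
have hr0 x : 0 <= h x * (gap_weight b x)%:E by rewrite mule_ge0.
have mG : measurable_fun setT G by apply: emeasurable_funM => //; exact: measurable_reflect_sum.
have G0 x : 0 <= G x by rewrite mule_ge0// adde_ge0.
rewrite (@ge0_integral_itv_split _ _ 0%R)//; [|by rewrite oppr_le0 ltW|exact: ltW].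
have e0 := integral_sym_fold 0 b mhr hr0; rewrite oppr0 in e0; rewrite addeC e0.
transitivity (\int[leb]_(x in `[0%R, b]) G x).
  by apply: eq_integral => x _; rewrite /G rN ge0_muleDl.
have sin_mono : {in `[0%R, (pi / 2)%R] &, {mono (fun u => b * sin u)%R : x y / (x <= y)%R}}.
  move=> x y; rewrite !in_itv/= => /andP[x0 x1] /andP[y0 y1]; rewrite ler_pM2l//.
  apply: (le_mono_in (D := [pred x : R | x \in `[(- (pi / 2))%R, (pi / 2)%R]])).
  - by move=> u v u_ v_; rewrite ltr_sin.
  - by rewrite inE in_itv/= x1 andbT; have := pi2_gt0; lra.
  - by rewrite inE in_itv/= y1 andbT; have := pi2_gt0; lra.
have dF u : u \in `]0%R, (pi / 2)%R[ -> is_derive (u : R) (1%R : R) (fun u => b * sin u)%R (b * cos u)%R.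
  by move=> _; eapply is_derive_eq; [derive_rules|rewrite /=; ring].
have cF : continuous (fun u => b * sin u)%R.
  by move=> u; apply: contM; [exact: contC|exact: continuous_sin].
have := @ge0_integral_subst R (fun u => b * sin u)%R (fun u => b * cos u)%R 0 (pi / 2) G pi2_gt0 cF sin_mono dF.
rewrite sin0 sin_pihalf mulr0 mulr1 => ->//; first last.
- by move=> u /in_pihalf_cc[_ /andP[c0 _]]; rewrite mulr_ge0// ltW.
- by apply: continuous_subspaceT => u; apply: contM; [exact: contC|exact: continuous_cos].
have mbs : measurable_fun setT (fun u : TR => b * sin u)%R by meas_rules.
rewrite integral_itv_bndoo; last first.
  apply: measurable_funTS; apply: emeasurable_funM; first exact: (measurableT_comp mG mbs).
  by apply/measurable_EFinP; meas_rules.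
rewrite [RHS]integral_itv_bndoo; last first.
  apply: measurable_funTS; apply: emeasurable_funM.
    exact: (measurableT_comp (measurable_reflect_sum mh) mbs).
  by apply/measurable_EFinP; rewrite /ellD; meas_rules.
apply: eq_integral => u; rewrite inE/= => uI.
by rewrite /G -muleA -EFinM gap_weight_sin.
Qed.

Local Close Scope ereal_scope.

Lemma bsin_in b u : 0 < b < 1 -> b * sin u \in `[-1, 1] /\ - (b * sin u) \in `[-1, 1].
Proof.
move=> /andP[b0 b1]; have s1 := sin_le1 u; have s2 := sin_geN1 u.
by rewrite !in_itv/=; split; apply/andP; split; nra.
Qed.

(** Substitute x = b sin u in the integral over the gap and fold it at 0. *)
Lemma gap_cintegral b z : 0 < b < 1 -> complex_off `[-1, 1] z ->
  cintegral leb `[- b, b] (fun x : R => (Num.sqrt ((1 - x ^+ 2) / (b ^+ 2 - x ^+ 2)))%:C / (z - x%:C)) =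
  cintegral leb H (fun u => even_cauchy z (b * sin u) * (ellD b u)%:C).
Proof.
move=> b01 zo; have [M hM] := cauchy_bounded zo.
have mY : measurable_fun setT (fun u : TR => b * sin u) by meas_rules.
have mK : measurable_fun H (fun u : TR => ellD b u) by rewrite /ellD; meas_rules.
have KB u : u \in H -> 0 <= ellD b u <= 1 by rewrite sqrtr_ge0 ellD_le1.
have T := signed_transfer (fun h mh h0 => integral_gap_sin b01 mh h0) (fun x _ => sqrtr_ge0 _) mY mK KB.
rewrite /cintegral; apply: complex_eqP => /=.
  transitivity (\int[leb]_(x in `[- b, b]) (Re ((z - x%:C)^-1) * gap_weight b x)).
    by apply: eq_Rintegral => x _; rewrite Re_real_div mulrC.
  rewrite (T M _ (measurable_Re_cauchy z)); last first.
    by move=> u _; have [c1 c2] := bsin_in u b01; have [? _] := hM _ c1; have [? _] := hM _ c2.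
  apply: eq_Rintegral => u _; rewrite cReM /= mulr0 subr0; congr (_ * _).
  by rewrite cReD rmorphN opprK.
transitivity (\int[leb]_(x in `[- b, b]) (Im ((z - x%:C)^-1) * gap_weight b x)).
  by apply: eq_Rintegral => x _; rewrite cImM /= mul0r addr0 mulrC.
rewrite (T M _ (measurable_Im_cauchy z)); last first.
  by move=> u _; have [c1 c2] := bsin_in u b01; have [_ ?] := hM _ c1; have [_ ?] := hM _ c2.
apply: eq_Rintegral => u _; rewrite cImM /= mulr0 add0r; congr (_ * _).
by rewrite cImD rmorphN opprK.
Qed.

Lemma Re_sqrtc_gt0 w : slit w -> 0 < Re (sqrtc w).
Proof.
by case: w => p q; rewrite /slit /= => h; rewrite sqrtr_gt0 divr_gt0.
Qed.

(** If the quotient is a nonpositive real r, then z^2 = (b^2 - r) / (1 - r)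
    is in [0, 1[, so z is in [-1, 1]. *)
Lemma slit_quotient b z : 0 < b < 1 -> complex_off `[-1, 1] z ->
  slit ((z ^+ 2 - b%:C ^+ 2) / (z ^+ 2 - 1)).
Proof.
move=> /andP[b0 b1] zo.
have zt x := @complex_off_itv R (-1) 1 z x zo.
have zt' x : x \in `[-1, 1] -> z ^+ 2 - x%:C ^+ 2 != 0.
  move=> xI; rewrite subr_sqr mulf_neq0 ?zt//.
  have := @zt (- x); rewrite rmorphN opprK; apply.
  by move: xI; rewrite !in_itv/= => /andP[x0 x1]; apply/andP; split; lra.
have z1 : z ^+ 2 - 1 != 0.
  by have := @zt' 1; rewrite rmorph1 expr1n; apply; rewrite in_itv/= lexx andbT (le_trans (lerN10 _)).
apply: slitP => -[i0 r0].
have uE : (z ^+ 2 - b%:C ^+ 2) / (z ^+ 2 - 1) = (Re ((z ^+ 2 - b%:C ^+ 2) / (z ^+ 2 - 1)))%:C by apply: complex_eqP.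
move: (Re _) r0 uE => r r0 /(canRL (mulfVK z1)) e.
have r1 : 0 < 1 - r by lra.
pose v := (b ^+ 2 - r) / (1 - r).
have zv : z ^+ 2 = v%:C.
  have r1n : (1 - r)%:C != 0 :> R[i] by apply/eqP => /(congr1 (@complex.Re R)) /=; lra.
  apply: (mulIf r1n); rewrite -rmorphM /= divfK ?gt_eqF//.
  rewrite !rmorphB rmorph1 rmorphXn /=; move: e; move: r%:C b%:C => r' b' e.
  by transitivity (z ^+ 2 - b' ^+ 2 - r' * (z ^+ 2 - 1) + b' ^+ 2 - r'); [ring|rewrite e; ring].
have v0 : 0 <= v by rewrite divr_ge0// ?(ltW r1)//; have := sqr_ge0 b; lra.
have v1 : v <= 1 by rewrite ler_pdivrMr// mul1r; have : b ^+ 2 <= 1 by [rewrite expr_le1// ltW]; lra.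
have sI : Num.sqrt v \in `[-1, 1].
  rewrite in_itv/=; have := sqrtr_ge0 v; have : Num.sqrt v <= 1 by rewrite -[leRHS]sqrtr1 ler_wsqrtr.
  by move=> h1 h2; apply/andP; split; lra.
by have := zt' _ sI; rewrite -rmorphXn /= sqr_sqrtr// zv subrr eqxx.
Qed.

Lemma cintegrable_bounded (f : R -> R[i]) (g : R -> R) M N :
  measurable_fun H (fun t : TR => Re (f t)) -> measurable_fun H (fun t : TR => Im (f t)) ->
  measurable_fun H (g : TR -> R) ->
  (forall t, t \in `[0, (pi : R) / 2] -> `|Re (f t)| <= M /\ `|Im (f t)| <= M) ->
  (forall t, t \in `[0, (pi : R) / 2] -> `|g t| <= N) ->
  cintegrable H (fun t => f t * (g t)%:C).
Proof.
move=> m1 m2 mg fM gN; split.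
  apply: (@bounded_integrable_itv R 0 (pi / 2) (M * N)).
    have -> : (fun t : TR => Re (f t * (g t)%:C)) = (fun t : TR => Re (f t) * g t).
      by apply/funext => t; rewrite cReM /= mulr0 subr0.
    exact: measM.
  move=> t tI; have [h1 _] := fM t tI.
  by rewrite cReM /= mulr0 subr0 normrM ler_pM// gN.
apply: (@bounded_integrable_itv R 0 (pi / 2) (M * N)).
  have -> : (fun t : TR => Im (f t * (g t)%:C)) = (fun t : TR => Im (f t) * g t).
    by apply/funext => t; rewrite cImM /= mulr0 add0r.
  exact: measM.
move=> t tI; have [_ h1] := fM t tI.
by rewrite cImM /= mulr0 add0r normrM ler_pM// gN.
Qed.

Lemma ratio_cintegral b z : 0 < b < 1 -> complex_off `[-1, 1] z ->
  cintegral leb H (fun t => even_cauchy z (cutpar b t) * (ratio_integral b t)%:C) =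
  cintegral leb H (fun u => (ellD b u)%:C *
    cintegral leb H (fun t => even_cauchy z (cutpar b t) * (cut_ratio b t u)%:C)).
Proof.
move=> b01 zo; have /andP[b0 b1] := b01; have b01' : 0 <= b < 1 by rewrite ltW.
have [M hM] := even_cauchy_bounded zo.
have [mE1 mE2] := measurable_even_cauchy z (@measurable_cutpar R b setT).
rewrite /cintegral; apply: complex_eqP => /=.
  under eq_Rintegral do rewrite cReM /= mulr0 subr0.
  rewrite (@ratio_fubini R b _ M b01' mE1); last first.
    by move=> t _; have [c1 _] := cutpar_in t b01'; have [? _] := hM _ c1.
  apply: eq_Rintegral => u _; rewrite mul0r subr0; congr (_ * _).
  by apply: eq_Rintegral => t _; rewrite cReM /= mulr0 subr0.
under eq_Rintegral do rewrite cImM /= mulr0 add0r.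
rewrite (@ratio_fubini R b _ M b01' mE2); last first.
  by move=> t _; have [c1 _] := cutpar_in t b01'; have [_ ?] := hM _ c1.
apply: eq_Rintegral => u _; rewrite mul0r addr0; congr (_ * _).
by apply: eq_Rintegral => t _; rewrite cImM /= mulr0 add0r.
Qed.

Lemma der_cutpar b t : 0 < b < 1 -> is_derive (t : R) (1 : R) (cutpar b) (dcutpar b t).
Proof.
move=> b01; have /andP[b0 b1] := b01; have b01' : 0 <= b < 1 by rewrite ltW.
have y0 : 0 < cutpar b t by have /andP[/(lt_le_trans b0)] := cutpar_bounds t b01'.
have := y0; rewrite sqrtr_gt0 => arg0.
eapply is_derive_eq; first by rewrite /cutpar; derive_rules.
by rewrite /dcutpar /= -/(cutpar b t); field; rewrite gt_eqF.
Qed.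

Lemma cont_dcutpar b t : 0 < b < 1 -> cont_at (dcutpar b) t.
Proof.
move=> b01; have /andP[b0 b1] := b01; have b01' : 0 <= b < 1 by rewrite ltW.
have y0 : 0 < cutpar b t by have /andP[/(lt_le_trans b0)] := cutpar_bounds t b01'.
have cc := @cont_cutpar R b t; rewrite /dcutpar.
apply: contM; first by cont_rules.
by apply: contV => //; rewrite gt_eqF.
Qed.

(** Let P be [even_cauchy_primitive z], so that P 0 = 0 and P 1 is the
    logarithm in the formula. The term in the derivative of the
    parametrization contributes - (tau / 2) (P 1 - P b). By [inner_integral]
    the other term is tau / 2 times c times the integral over the gap, minus
    (tau / 2) (P b - P 0), so that P b cancels. *)
Lemma cauchy_transform_cut_measure tau b z : 0 < b < 1 -> 0 < tau -> ellE b = tau^-1 + 1 ->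
  complex_off `[-1, 1] z ->
  cauchy_transform (cut_measure tau b) z = cauchy_formula tau b z.
Proof.
move=> b01 t0 Eb zo; have /andP[b0 b1] := b01; have b01' : 0 <= b < 1 by rewrite ltW.
have mH : measurable (H : set TR) by exact: measurable_itv.
have pi0 : (pi : R) != 0 by rewrite gt_eqF// pi_gt0.
have p20 : 0 <= (pi : R) / 2 by exact: ltW.
have [M hM] := even_cauchy_bounded zo.
have [mE1 mE2] := measurable_even_cauchy z (@measurable_cutpar R b setT).
set A := (z ^+ 2 - b%:C ^+ 2) / (z ^+ 2 - 1).
have c0 := Re_sqrtc_gt0 (slit_quotient b01 zo); rewrite -/A in c0.
have c2 : sqrtc A ^+ 2 = A by exact: sqr_sqrtc.
set c := sqrtc A in c0 c2.
have cutI t : cutpar b t \in `[-1, 1] by have [] := cutpar_in t b01'.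
have i1 : cintegrable H (fun t => even_cauchy z (cutpar b t) * (ratio_integral b t)%:C).
  apply: (@cintegrable_bounded _ _ M (pi / 2)); try exact: measurable_funTS.
  - by apply: measurable_funTS; exact: measurable_ratio_integral.
  - by move=> t _; exact: hM.
  - by move=> t _; have /andP[h0 h1] := ratio_integral_bounds t b01'; rewrite ger0_norm.
have i2 : cintegrable H (fun t => even_cauchy z (cutpar b t) * (dcutpar b t)%:C).
  apply: ccont_integrable => t _; apply: ccontM.
    by apply: ccont_even_cauchy => //; exact: cont_cutpar.
  by apply: ccontR; exact: cont_dcutpar.
have i3 : cintegrable H (fun u => even_cauchy z (b * sin u) * (ellD b u)%:C).
  apply: ccont_integrable => t _; apply: ccontM; last by apply: ccontR; exact: cont_ellD.
  apply: ccont_even_cauchy => //; first by have [] := bsin_in t b01.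
  by apply: contM; [exact: contC|exact: continuous_sin].
have i4 : cintegrable H (fun u => even_cauchy z (b * sin u) * (b * cos u)%:C).
  apply: ccont_integrable => t _; apply: ccontM.
    apply: ccont_even_cauchy => //; first by have [] := bsin_in t b01.
    by apply: contM; [exact: contC|exact: continuous_sin].
  by apply: ccontR; apply: contM; [exact: contC|exact: continuous_cos].
rewrite (cauchy_transform_cutpar b01 t0 Eb zo).
transitivity (cintegral leb H (fun t => (tau / pi)%:C * (even_cauchy z (cutpar b t) * (ratio_integral b t)%:C) -
   (tau / 2)%:C * (even_cauchy z (cutpar b t) * (dcutpar b t)%:C))).
  apply: eq_cintegral => t tI; rewrite cut_kernel_split//.
  have -> : tau * (pi^-1 * ratio_integral b t - 2^-1 * dcutpar b t) =
    tau / pi * ratio_integral b t - tau / 2 * dcutpar b t by ring.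
  by rewrite rmorphB !rmorphM /=; ring.
rewrite cintegralB//; try exact: cintegrableZ.
rewrite !cintegralZ//.
have -> : cintegral leb H (fun t => even_cauchy z (cutpar b t) * (dcutpar b t)%:C) =
    even_cauchy_primitive z 1 - even_cauchy_primitive z b.
  rewrite (integral_even_cauchy_path zo p20 (fun t _ => cutI t) (fun t _ => der_cutpar t b01)
    (fun t _ => @cont_dcutpar b t b01)).
  rewrite /cutpar cos_pihalf sin_pihalf cos0 sin0 expr0n/= !expr1n !mulr0 mulr1 add0r addr0 sqrtr1 sqrtr_sqr.
  by rewrite gtr0_norm.
have g1 : cintegral leb H (fun u => even_cauchy z (b * sin u) * (b * cos u)%:C) =
    even_cauchy_primitive z b - even_cauchy_primitive z 0.
  have dS t : t \in `[0, (pi : R) / 2] -> is_derive (t : R) (1 : R) (fun u => b * sin u) (b * cos t).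
    by move=> _; eapply is_derive_eq; [derive_rules|rewrite /=; ring].
  rewrite (integral_even_cauchy_path zo p20 (fun t _ => (bsin_in t b01).1) dS).
    by rewrite sin_pihalf sin0 mulr1 mulr0.
  by move=> t _; apply: contM; [exact: contC|exact: continuous_cos].
have -> : cintegral leb H (fun t => even_cauchy z (cutpar b t) * (ratio_integral b t)%:C) =
   ((pi / 2)%:C * c) * cintegral leb H (fun u => even_cauchy z (b * sin u) * (ellD b u)%:C)
   - (pi / 2)%:C * (even_cauchy_primitive z b - even_cauchy_primitive z 0).
  rewrite ratio_cintegral// -g1 -!cintegralZ// -cintegralB//; try exact: cintegrableZ.
  apply: eq_cintegral => u uI; rewrite (inner_integral b01 zo c0 c2 uI).
  have D0 : (ellD b u)%:C != 0 :> R[i].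
    by apply/eqP => /(congr1 (@complex.Re R)) /= h; have := ellD_gt0 u b01'; rewrite h ltxx.
  rewrite [(b * cos u / ellD b u)%:C]rmorphM fmorphV /=.
  by move: (ellD b u)%:C (b * cos u)%:C (pi / 2)%:C D0 => d e p D0; field.
rewrite -(gap_cintegral b01 zo) /cauchy_formula.
have -> : even_cauchy_primitive z 0 = 0 by rewrite /even_cauchy_primitive oppr0 subrr.
have -> : even_cauchy_primitive z 1 = clog ((z + 1) / (z - 1)).
  by rewrite /even_cauchy_primitive cauchy_log1// cauchy_logN1// subr0.
have -> : (z ^+ 2 - (b ^+ 2)%:C) / (z ^+ 2 - 1) = A by rewrite /A rmorphXn.
rewrite -/c; move: (cintegral _ _ _) (clog _) (even_cauchy_primitive z b) => X L P.
have tp : (tau / 2)%:C = (tau / pi)%:C * (pi / 2)%:C :> R[i].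
  by rewrite -rmorphM /=; congr (_%:C); move: (pi : R) pi0 => p p0; field.
by rewrite tp; ring.
Qed.

(** * Continuity of the Cauchy transform off the cuts *)

Lemma Rintegral_concentrated (m : probability TR R) (D : set TR) (f : TR -> R) :
  measurable D -> m D = 1%E -> measurable_fun setT f ->
  \int[m]_x f x = \int[m]_(x in D) f x.
Proof.
move=> mD mD1 mf; rewrite /Rintegral; congr fine.
by apply: integral_concentrated => //; exact/measurable_EFinP.
Qed.

Lemma Rintegral_dist (m : probability TR R) (D : set TR) (f g : TR -> R) (M K : R) :
  measurable D -> m D = 1%E -> measurable_fun setT f -> measurable_fun setT g ->
  (forall x, D x -> `|f x| <= M /\ `|g x| <= M) -> (forall x, D x -> `|f x - g x| <= K) ->
  `|\int[m]_x f x - \int[m]_x g x| <= K.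
Proof.
move=> mD mD1 mf mg fgM fgK.
have int (h : TR -> R) (N : R) : measurable_fun setT h -> (forall x, D x -> `|h x| <= N) ->
    m.-integrable D (EFin \o h).
  move=> mh hN; apply: measurable_bounded_integrable => //.
  - by apply: le_lt_trans (probability_le1 m mD) _; exact: ltry.
  - exact: measurable_funTS.
  - exists N; split; first exact: num_real.
    by move=> N' NN' x /= Dx; rewrite (le_trans (hN _ Dx))// ltW.
have fi : m.-integrable D (EFin \o f) by apply: (int _ M) => // x /fgM[].
have gi : m.-integrable D (EFin \o g) by apply: (int _ M) => // x /fgM[].
rewrite (Rintegral_concentrated mD mD1 mf) (Rintegral_concentrated mD mD1 mg) -RintegralB//.
have mfg : measurable_fun setT (fun x : TR => f x - g x) by apply: measD => //; exact: measN.
apply: le_trans (le_normr_Rintegral mD _) _.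
  exact: (int _ K mfg fgK).
have ci : m.-integrable D (EFin \o cst K).
  by apply: (int _ `|K|) => // x _; exact: lexx.
have ni : m.-integrable D (EFin \o (fun x : TR => `|f x - g x|)).
  by apply: (int _ K); [exact: meas_norm|move=> x Dx; rewrite normr_id; exact: fgK].
apply: le_trans (le_Rintegral mD ni ci fgK) _.
by rewrite /Rintegral (integral_prob_cst K mD mD1).
Qed.

(** The reciprocal distance to z is continuous on each of the two compact
    cuts. *)
Lemma cauchy_distance_bounded b z : complex_off (two_cut b) z ->
  exists2 M : R, 0 < M & forall x, two_cut b x -> (normc (z - x%:C))^-1 <= M.
Proof.
move=> zo.
have nz x : two_cut b x -> 0 < normc (z - x%:C).
  move=> xb; rewrite normc_sqrt sqrtr_gt0 -complex_neq0 subr_eq0.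
  by apply/eqP => zx; apply: zo; exists x.
have bnd p q : (forall x, x \in `[p, q] -> two_cut b x) ->
    exists M : R, forall x, x \in `[p, q] -> (normc (z - x%:C))^-1 <= M.
  move=> pq; have [qp|pq'] := ltP q p.
    exists 0 => x; rewrite in_itv/= => /andP[x0 x1].
    by have := lt_le_trans qp (le_trans x0 x1); rewrite ltxx.
  have cf t : t \in `[p, q] -> cont_at (fun x => (normc (z - x%:C))^-1) t.
    move=> /pq/nz n0; apply: contV; first by rewrite gt_eqF.
    apply: (@cont_ext R (fun x => Num.sqrt ((Re z - x) ^+ 2 + Im z ^+ 2))).
      by move=> x; rewrite normc_sqrt cReD cReN cImD cImN /= subr0.
    by cont_rules.
  have [M hM] := cont_bounded pq' cf; exists M => x xI.
  by apply: le_trans (hM x xI); exact: ler_norm.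
have [M1 h1] := bnd (-1) (- b) (fun x xI => or_introl xI).
have [M2 h2] := bnd b 1 (fun x xI => or_intror xI).
(* The constant 1 keeps the bound positive when the cuts are empty. *)
exists (Num.max 1 (Num.max M1 M2)); first by rewrite lt_max ltr01.
by move=> x [|] /= xI; rewrite !le_max ?(h1 _ xI) ?(h2 _ xI) ?orbT.
Qed.

(** If w is within 1 / (2 M) of z, where 1 / M is at most the distance of z
    from the cuts, then both kernels are bounded on the cuts, and their
    difference is (w - z) times their product. *)
Lemma cauchy_transform_continuous (m : probability TR R) b z :
  m (two_cut b) = 1%E -> complex_off (two_cut b) z ->
  forall e : R, 0 < e -> exists2 d : R, 0 < d & forall w, normc (z - w) <= d ->
    normc (cauchy_transform m z - cauchy_transform m w) <= e.
Proof.
move=> mb zo e e0; have [M M0 hM] := cauchy_distance_bounded zo.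
have mD := measurable_two_cut b.
pose K := 4 * M ^+ 2.
have K0 : 0 < K by rewrite mulr_gt0// exprn_gt0.
exists (Num.min (2 * M)^-1 (e / K)).
  by rewrite lt_min invr_gt0 mulr_gt0//= divr_gt0.
move=> w; rewrite le_min => /andP[w1 w2].
have normcN (x : R[i]) : normc (- x) = normc x by rewrite !normc_sqrt cReN cImN !sqrrN.
have nz x : two_cut b x -> M^-1 <= normc (z - x%:C).
  move=> xb; have n0 : 0 < normc (z - x%:C).
    rewrite normc_sqrt sqrtr_gt0 -complex_neq0 subr_eq0.
    by apply/eqP => zx; apply: zo; exists x.
  by rewrite -[leRHS]invrK lef_pV2 ?posrE ?invr_gt0//; exact: hM.
have nw x : two_cut b x -> (2 * M)^-1 <= normc (w - x%:C).
  move=> xb; have := nz x xb.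
  have := ler_normD (z - w) (w - x%:C); rewrite !normc_def -rmorphD lecR -!normc_sqrt.
  rewrite (_ : z - w + (w - x%:C) = z - x%:C); last by ring.
  have : (2 * M)^-1 = M^-1 / 2 by field; rewrite gt_eqF.
  by move: w1; lra.
have nV x (y : R[i]) N : 0 < N -> N^-1 <= normc y -> normc y^-1 <= N.
  move=> N0 Ny; rewrite Normc.normcV -[leRHS]invrK lef_pV2 ?posrE ?invr_gt0//.
  by rewrite (lt_le_trans _ Ny)// invr_gt0.
have M20 : 0 < 2 * M by rewrite mulr_gt0.
have bz x : two_cut b x -> normc ((z - x%:C)^-1) <= 2 * M.
  by move=> xb; apply: le_trans (nV x _ M M0 (nz x xb)) _; rewrite ler_peMl ?ltW// ltr1n.
have bw x : two_cut b x -> normc ((w - x%:C)^-1) <= 2 * M.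
  by move=> xb; exact: (nV x _ _ M20 (nw x xb)).
have dif x : two_cut b x -> normc ((z - x%:C)^-1 - (w - x%:C)^-1) <= e / 2.
  move=> xb.
  have z0 : z - x%:C != 0.
    by rewrite complex_neq0 -sqrtr_gt0 -normc_sqrt (lt_le_trans _ (nz x xb))// invr_gt0.
  have w0 : w - x%:C != 0.
    by rewrite complex_neq0 -sqrtr_gt0 -normc_sqrt (lt_le_trans _ (nw x xb))// invr_gt0.
  have -> : (z - x%:C)^-1 - (w - x%:C)^-1 = - (z - w) * (z - x%:C)^-1 * (w - x%:C)^-1.
    by field; rewrite z0 w0.
  rewrite !Normc.normcM normcN.
  have n0 (y : R[i]) : 0 <= normc y by rewrite normc_sqrt sqrtr_ge0.
  apply: (@le_trans _ _ (e / K * M * (2 * M))).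
    apply: ler_pM => //; first by rewrite mulr_ge0.
      by apply: ler_pM => //; exact: nV (nz x xb).
    exact: bw.
  by rewrite le_eqVlt; apply/orP; left; apply/eqP; rewrite /K; field; rewrite gt_eqF.
have dR : `|Re (cauchy_transform m z - cauchy_transform m w)| <= e / 2.
  rewrite cReD cReN /=; apply: (@Rintegral_dist m _ _ _ (2 * M) _ mD mb).
  - exact: measurable_Re_cauchy.
  - exact: measurable_Re_cauchy.
  - by move=> x xb; split; apply: le_trans (Re_le_normc _) _; [exact: bz|exact: bw].
  - move=> x xb; rewrite -cReN -cReD; apply: le_trans (Re_le_normc _) _; exact: dif.
have dI : `|Im (cauchy_transform m z - cauchy_transform m w)| <= e / 2.
  rewrite cImD cImN /=; apply: (@Rintegral_dist m _ _ _ (2 * M) _ mD mb).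
  - exact: measurable_Im_cauchy.
  - exact: measurable_Im_cauchy.
  - by move=> x xb; split; apply: le_trans (Im_le_normc _) _; [exact: bz|exact: bw].
  - move=> x xb; rewrite -cImN -cImD; apply: le_trans (Im_le_normc _) _; exact: dif.
move: (cauchy_transform m z - cauchy_transform m w) dR dI => v dR dI.
rewrite normc_sqrt -[leRHS](ger0_norm (ltW e0)) -sqrtr_sqr ler_wsqrtr//.
have e20 : 0 <= e / 2 by rewrite divr_ge0// ltW.
have h1 : Re v ^+ 2 <= (e / 2) ^+ 2 by rewrite -real_normK ?num_real// ler_pXn2r ?nnegrE.
have h2 : Im v ^+ 2 <= (e / 2) ^+ 2 by rewrite -real_normK ?num_real// ler_pXn2r ?nnegrE.
by have := sqr_ge0 e; have : (e / 2) ^+ 2 = e ^+ 2 / 4 by [field]; lra.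
Qed.

End assembly.

Theorem theorem4p1 (R : realType) (tau : R)
    (mu : probability (measurableTypeR R) R)
    (htau : 2 / (pi - 2) < tau)
    (hmu : is_equilibrium_measure tau mu) :
  exists beta : R,
    [/\ 0 < beta < 1,
        ellE beta = tau^-1 + 1,
        (forall k : R, 0 <= k <= 1 -> ellE k = tau^-1 + 1 -> k = beta)
      & 1 < tau^-1 + 1 < pi / 2] /\
    [/\ mu `<< lebesgue_measure,
        msupport mu = two_cut beta,
        (forall A : set (measurableTypeR R), measurable A ->
          mu A = (\int[lebesgue_measure]_(x in A `&` two_cut beta)
                    (eq_density tau beta x)%:E)%E),
        (forall z : R[i], complex_off `[-1, 1] z ->
          cauchy_transform mu z = cauchy_formula tau beta z)
      & (forall z : R[i], complex_off (msupport mu) z ->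
          (cauchy_formula tau beta : R[i]^o -> R[i]^o) w
            @[w --> within (complex_off `[-1, 1]) (nbhs (z : R[i]^o))]
          --> (cauchy_transform mu z : R[i]^o))].
Proof.
have [b [b01 Eb bU t1]] := ellE_solution htau; exists b; split; first by split.
have t0 : 0 < tau by rewrite -invr_gt0; case/andP: t1; rewrite ltrDr.
have /andP[b0 b1] := b01.
have muE := equilibrium_unique b01 t0 Eb hmu.
have mE (A : set (measurableTypeR R)) : measurable A -> mu A =
    (\int[lebesgue_measure]_(x in A `&` two_cut b) (eq_density tau b x)%:E)%E.
  by move=> mA; rewrite muE// cut_measure_density.
have sE : msupport mu = two_cut b := msupport_density t0 b01 mE.
have muT : mu (two_cut b) = 1%E.
  rewrite muE; last exact: measurable_two_cut.
  by apply: (cut_measure_full b01 t0 Eb (measurable_two_cut b)).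
have ctE z : cauchy_transform mu z = cauchy_transform (cut_measure tau b) z.
  rewrite /cauchy_transform /cintegral; congr (_ +i* _); rewrite /Rintegral; congr fine;
    by apply: eq_measure_integral => A mA _; exact: muE.
have CE z : complex_off `[-1, 1] z -> cauchy_transform mu z = cauchy_formula tau b z.
  by move=> zo; rewrite ctE; exact: cauchy_transform_cut_measure.
split => //; first exact: density_dominates t0 mE.
move=> z; rewrite sE => zo; apply/cvgrPdist_le => /= e e0.
have [er er0 eE] : exists2 r : R, 0 < r & e = r%:C.
  by case: e e0 => p q; rewrite ltcE /= => /andP[/eqP -> p0]; exists p.
have [d d0 hd] := cauchy_transform_continuous muT zo er0.
rewrite near_withinE; near=> w => wo.
rewrite -CE// eE normc_def lecR -normc_sqrt; apply: hd.
near: w.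
have d0' : 0 < d%:C :> R[i] by rewrite ltcR.
apply/(@nbhs_ballP R[i] R[i]^o); exists d%:C => //= y.
by rewrite /ball/= normc_def ltcR -normc_sqrt => /ltW.
Unshelve. all: by end_near.
Qed.
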